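(* Let $k$ be any commutative ring, let $n,m$ be even, let $W\in k[x_1,\dots,x_n]$ and $V\in k[z_1,\dots,z_m]$ be potentials, and let $X:W\to V$ be a $1$-morphism in $\mathcal{LG}_k$ given by a finite-rank matrix factorisation $X\in\mathrm{hmf}(k[x_1,\dots,x_n,z_1,\dots,z_m],V-W)$. Let $\Phi:X\to X$ be a $2$-endomorphism, $\phi\in\underline{\mathrm{End}}(\Delta_V)= k[z]/(\partial V)$ and $\psi\in\underline{\mathrm{End}}(\Delta_W)= k[x]/(\partial W)$. Then the defect operators $\mathcal D^\Phi_l(X)(\phi)\in\underline{\mathrm{End}}(\Delta_W)= k[x]/(\partial W)$ and $\mathcal D^\Phi_r(X)(\psi)\in\underline{\mathrm{End}}(\Delta_V)= k[z]/(\partial V)$ are given by $$\mathcal D_l^\Phi(X)(\phi)=(-1)^{\binom{n+1}2}\,\mathrm{Res}_{k[x,z]/k[x]}\left[\frac{\phi(z)\,\mathrm{str}\big(\Phi\,\partial_{x_1}d_X\cdots\partial_{x_n}d_X\,\partial_{z_1}d_X\cdots\partial_{z_m}d_X\big)\,\underline{\mathrm dz}}{\partial_{z_1}V,\dots,\partial_{z_m}V}\right],$$ $$\mathcal D_r^\Phi(X)(\psi)=(-1)^{\binom{m+1}2}\,\mathrm{Res}_{k[x,z]/k[z]}\left[\frac{\psi(x)\,\mathrm{str}\big(\Phi\,\partial_{x_1}d_X\cdots\partial_{x_n}d_X\,\partial_{z_1}d_X\cdots\partial_{z_m}d_X\big)\,\underline{\mathrm dx}}{\partial_{x_1}W,\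dots,\partial_{x_n}W}\right].$$
   Context: Potentials. $W\in R=k[x_1,\dots,x_n]$ is a potential if the sequence $\partial_{x_1}W,\dots,\partial_{x_n}W$ is quasi-regular, $R/(\partial_{x_i}W)_i$ is a finitely generated free $k$-module, and the Koszul complex of this sequence is exact except in degree zero. Write $k[x]/(\partial W)=R/(\partial_{x_1}W,\dots,\partial_{x_n}W)$. Factorisations. For a ring $Q$ and $U\in Q$, a matrix factorisation of $U$ is a $\mathbb Z_2$-graded free $Q$-module $X$ with an odd $Q$-linear $d_X$, $d_X^2=U\cdot1_X$. Morphisms are even $Q$-linear maps commuting with $d$, taken up to homotopy ($d\lambda+\lambda d$, $\lambda$ odd). $\mathrm{HMF}(Q,U)$ is the homotopy category, $\mathrm{hmf}(Q,U)$ its full subcategory of finite-rank objects, $\mathrm{hmf}(Q,U)^\omega$ the full subcategory of $\mathrm{HMF}(Q,U)$ of direct summands of finite-rank objects. $[1]$ shifts the grading and negates the differential. $X^\vee=\mathrm{Hom}_Q(X,Q)$ has $d_{X^\vee}(\nu)=-(-1)^{|\nu|}\nu\circ d_X$. Units. $R^{\mathrm e}=k[x,x']$, $\widetilde W=W(x)-W(x')$. With ${}^{t_i}$ replacing $x_i$ by $x'_i$, $\partial^{x,x'}_{[i]}f=({}^{t_1\cdots t_{i-1}}f-{}^{t_1\cdots t_i}f)/(x_i-x_i')$. $\Delta_W=\bigwedge(\bigoplus_iR^{\mathrm e}\theta_i)$ with differential $\sum_i\partial^{x,x'}_{[i]}W\,\theta_i\wedge(-)+\sum_i(x_i-x_i')\theta_i^*$.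 $\pi:\Delta_W\to R$ is projection to $\theta$-degree $0$ followed by multiplication. One has $\underline{\mathrm{End}}(\Delta_W)\cong k[x]/(\partial W)$ (endomorphisms in the homotopy category; a polynomial acts by multiplication). $\mathcal{LG}_k$: objects are pairs $(R=k[x_1,\dots,x_n],W)$ with $W$ a potential; $\mathcal{LG}_k((R,W),(S,V))=\mathrm{hmf}(R\otimes_kS,V-W)^\omega$; composition of $X:W_1\to W_2$, $Y:W_2\to W_3$ is $Y\otimes_{R_2}X$; units $\Delta_W$; unitors $\lambda_X=\pi\otimes1:\Delta_V\otimes X\to X$, $\rho_X=1\otimes\pi:X\otimes\Delta_W\to X$. Adjunction maps. Let $X:W\to V$ be finite-rank, $R=k[x]$, $S=k[z]$, with homogeneous basis $\{e_i\}$, dual basis $\{e_i^*\}$, $d_X(e_i)=\sum_j(d_X)_{ji}e_j$. Put $X^\dagger=R[n]\otimes_RX^\vee$, ${}^\dagger X=X^\vee\otimes_SS[m]$; for $n,m$ even both are just $X^\vee$. The adjunctions ${}^\dagger X\dashv X\dashv X^\dagger$ are given by $\widetilde{\mathrm{coev}}_X:\Delta_W\to X^\dagger\otimes_SX$, $\gamma\mapsto\sum_{i,j}(-1)^{(l+1)|e_j|+s}\{\partial^{x,x'}_{[b_l]}d_X\cdots\partial^{x,x'}_{[b_1]}d_X\}_{ji}\,e_i^*\otimes e_j$ for a monomial $\gamma$ with $\gamma\wedge\theta_{b_1}\cdots\theta_{b_l}=(-1)^s\theta_1\cdots\theta_n$, $b_1<\dots<b_l$; $\mathrm{coev}_X:\Delta_V\to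 X\otimes_R{}^\dagger X$, $\gamma'\mapsto\sum_{i,j}(-1)^{\binom{l+1}2+s+m+ml}\{\partial^{z,z'}_{[b_1]}d_X\cdots\partial^{z,z'}_{[b_l]}d_X\}_{ij}\,e_i\otimes e_j^*$ for $\gamma'\wedge\theta_{b_1}\cdots\theta_{b_l}=(-1)^s\theta_1\cdots\theta_m$; $\widetilde{\mathrm{ev}}_X:X\otimes_RX^\dagger\to\Delta_V$, $ge_j\otimes e_i^*\mapsto\sum_{l}\sum_{i_1<\dots<i_l}(-1)^{l+(n+1)|e_j|}\theta_{i_1}\cdots\theta_{i_l}\mathrm{Res}_{R/k}\big[\{\partial^{z,z'}_{[i_l]}d_X\cdots\partial^{z,z'}_{[i_1]}d_X\Lambda^{(x)}\}_{ij}\,g\,\underline{\mathrm dx}/(\partial_{x_1}W,\dots,\partial_{x_n}W)\big]$ for $g\in R$; $\mathrm{ev}_X:{}^\dagger X\otimes_SX\to\Delta_W$, $e_i^*\otimes ge_j\mapsto\sum_l\sum_{i_1<\dots<i_l}(-1)^{\binom l2+l|e_j|+m}\theta_{i_1}\cdots\theta_{i_l}\mathrm{Res}_{S/k}\big[\{\Lambda^{(z)}\partial^{x,x'}_{[i_1]}d_X\cdots\partial^{x,x'}_{[i_l]}d_X\}_{ij}\,g\,\underline{\mathrm dz}/(\partial_{z_1}V,\dots,\partial_{z_m}V)\big]$ for $g\in S$, extended linearly over $k[x,x']$ resp. $k[z,z']$ (unprimed variables act on the first tensor factor, primed on the second). Here $\mathrm{Res}$ is the Grothendieck residue symbol, linear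 over the remaining variables, $\underline{\mathrm dx}=\mathrm dx_1\cdots\mathrm dx_n$, $\underline{\mathrm dz}=\mathrm dz_1\cdots\mathrm dz_m$, $\Lambda^{(x)}=\lambda_1\cdots\lambda_n$ with $\lambda_i=-\partial_{x_i}d_X$, and $\Lambda^{(z)}=\mu_1\cdots\mu_m$ with $\mu_j=\partial_{z_j}d_X$. Defect operators ($n,m$ even). With ${}^\dagger X=X^\dagger=X^\vee$ and associators suppressed, $\mathcal D_l^\Phi(X)(\phi)=\mathrm{ev}_X\circ\big(1_{X^\vee}\otimes(\lambda_X\circ(\phi\otimes\Phi)\circ\lambda_X^{-1})\big)\circ\widetilde{\mathrm{coev}}_X$ and $\mathcal D_r^\Phi(X)(\psi)=\widetilde{\mathrm{ev}}_X\circ\big((\rho_X\circ(\Phi\otimes\psi)\circ\rho_X^{-1})\otimes1_{X^\vee}\big)\circ\mathrm{coev}_X$. $\mathrm{str}$ is the supertrace over $k[x,z]$, and $\partial_{x_i}d_X$ is the entrywise derivative of the matrix of $d_X$ in a chosen homogeneous basis. *)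

(* Defs.v *)
From HB Require Import structures.
From mathcomp Require Import all_boot all_order all_fingroup all_algebra.
From mathcomp Require Import mpoly.
From Stdlib Require Import ClassicalEpsilon.

Set Implicit Arguments.
Unset Strict Implicit.
Unset Printing Implicit Defensive.

Import GRing.Theory.
Local Open Scope ring_scope.

Definition mxact (A : comNzRingType) (I J : finType) (M : I -> J -> A)
    (u : {ffun J -> A}) : {ffun I -> A} :=
  [ffun i => \sum_j M i j * u j].

(* Z/2-graded free modules with an odd endomorphism, over B.  The module is
   given by a homogeneous basis [gidx] over a ring [gring], and B acts through
   [gact].  Finite-rank objects have gring = B.  A composite Y (x)_S X over
   k[x, x'] is free of finite rank only over the larger ring k[x, z, x'] in
   which the intermediate variables z are kept; there gring = k[x, z, x'],
   B = k[x, x'], and all maps and homotopies below are only B-linear. *)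
Record gfree (B : comNzRingType) := GFree {
  gring : comNzRingType;
  gact : {rmorphism B -> gring};
  gidx : finType;
  gpar : gidx -> bool;
  gdmx : gidx -> gidx -> gring  (* d e_j = \sum_i (gdmx i j) e_i *)
}.

Section HomotopyCategory.
Variable B : comNzRingType.

Definition gel (M : gfree B) := {ffun gidx M -> gring M}.

Definition gscale (M : gfree B) (b : B) (u : gel M) : gel M :=
  [ffun i => gact M b * u i].

Definition gdiff (M : gfree B) : gel M -> gel M := mxact (@gdmx B M).

Definition ghomog (M : gfree B) (p : bool) (u : gel M) : Prop :=
  forall i, gpar i != p -> u i = 0.

Definition glinear (M N : gfree B) (f : gel M -> gel N) : Prop :=
  forall (b : B) (u v : gel M), f (gscale b u + v) = gscale b (f u) + f v.

Definition gdegree (s : bool) (M N : gfree B) (f : gel M -> gel N) : Prop :=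
  forall (p : bool) (u : gel M), ghomog p u -> ghomog (s (+) p) (f u).

Definition gmor (M N : gfree B) (f : gel M -> gel N) : Prop :=
  [/\ glinear f, gdegree false f & forall u, f (gdiff u) = gdiff (f u)].

Definition homotopic (M N : gfree B) (f g : gel M -> gel N) : Prop :=
  exists h : gel M -> gel N,
    [/\ glinear h, gdegree true h &
        forall u, f u - g u = gdiff (h u) + h (gdiff u)].

Definition hinverse (M N : gfree B) (f : gel M -> gel N)
    (g : gel N -> gel M) : Prop :=
  [/\ gmor f, gmor g, homotopic (f \o g) id & homotopic (g \o f) id].

(* The matrix of a map out of a finite-rank object; it determines the map when
   [gact M] is the identity. *)
Definition gmx (M N : gfree B) (f : gel M -> gel N) (i : gidx N) (j : gidx M)
    : gring N :=
  f [ffun j' => (j' == j)%:R] i.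

End HomotopyCategory.

(* Finite-rank matrix factorisations of U, with a chosen homogeneous basis. *)
Record mfact (Q : comNzRingType) (U : Q) := MFact {
  mfrk : nat;
  mfpar : 'I_mfrk -> bool;
  mfd : 'M[Q]_mfrk;
  mfd_odd : forall i j, mfpar i = mfpar j -> mfd i j = 0;
  mfd_sq : mfd *m mfd = U%:M
}.

Definition mfobj (Q : comNzRingType) (U : Q) (X : mfact U) : gfree Q :=
  GFree idfun (@mfpar Q U X) (fun i j => mfd X i j).

Definition str (A : comNzRingType) (r : nat) (p : 'I_r -> bool) (M : 'M[A]_r)
    : A :=
  \sum_i (-1) ^+ p i * M i i.

(* d(e_i^* ) = - (-1)^|e_i| e_i^* o d *)
Definition dual_dmx (A : comNzRingType) (I : finType) (p : I -> bool)
    (d : I -> I -> A) : I -> I -> A :=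
  fun j i => - (-1) ^+ p i * d i j.

Definition tens_par (I J : finType) (p : I -> bool) (q : J -> bool)
    (ij : I * J) : bool := p ij.1 (+) q ij.2.

(* d (x) 1 + 1 (x) d' with the Koszul sign *)
Definition tens_dmx (A : comNzRingType) (I J : finType) (p : I -> bool)
    (d : I -> I -> A) (d' : J -> J -> A) : I * J -> I * J -> A :=
  fun s t => d s.1 t.1 * (s.2 == t.2)%:R
             + (-1) ^+ p t.1 * (s.1 == t.1)%:R * d' s.2 t.2.

Definition tens_mx (A : comNzRingType) (I J : finType)
    (f : I -> I -> A) (g : J -> J -> A) : I * J -> I * J -> A :=
  fun s t => f s.1 t.1 * g s.2 t.2.

Definition id_mx (A : comNzRingType) (I : finType) : I -> I -> A :=
  fun i j => (i == j)%:R.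

(* The exterior algebra on theta_0, ..., theta_(n-1) has basis
   theta_S = theta_{s_1} ... theta_{s_l}, S = {s_1 < ... < s_l}.  [koszul_mx a b]
   is the matrix of  \sum_i a_i theta_i /\ (-) + \sum_i b_i theta_i^*. *)
Definition koszul_mx (A : comNzRingType) (n : nat) (a b : 'I_n -> A)
    (T S : {set 'I_n}) : A :=
  \sum_(i < n) (-1) ^+ #|[set s in S | (s < i)%N]| *
    ((if (i \notin S) && (T == i |: S) then a i else 0)
     + (if (i \in S) && (T == S :\ i) then b i else 0)).

Definition theta_par (n : nat) (S : {set 'I_n}) : bool := odd #|S|.

(* theta_S /\ theta_(~: S) = (-1)^(shuffle S) theta_0 ... theta_(n-1) *)
Definition shuffle (n : nat) (S : {set 'I_n}) : nat :=
  #|[set st : 'I_n * 'I_n |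
      [&& st.1 \in S, st.2 \notin S & (st.2 < st.1)%N]]|.

Section Sequences.
Variables (k : comNzRingType) (n : nat).
Notation R := {mpoly k[n]}.
Variable t : 'I_n -> R.

Definition in_ideal (f : R) : Prop :=
  exists c : 'I_n -> R, f = \sum_i c i * t i.

(* f lies in the d-th power of the ideal (t) *)
Definition in_ideal_pow (d : nat) (f : R) : Prop :=
  exists2 F : {mpoly R[n]}, F \is d.-homog & F.@[t] = f.

Definition quasi_regular : Prop :=
  forall (d : nat) (F : {mpoly R[n]}), F \is d.-homog ->
    in_ideal_pow d.+1 F.@[t] -> forall mon, in_ideal F@_mon.

(* The classes of b_0, ..., b_(N-1) form a k-basis of R/(t). *)
Definition basis_mod (N : nat) (b : 'I_N -> R) : Prop :=
  forall f : R, exists! c : {ffun 'I_N -> k},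
    in_ideal (f - \sum_i c i *: b i).

Definition koszul_exact : Prop :=
  forall (j : nat) (u : {ffun {set 'I_n} -> R}), (0 < j)%N ->
    (forall S : {set 'I_n}, #|S| != j -> u S = 0) ->
    mxact (koszul_mx (fun=> 0) t) u = 0 ->
    exists2 v : {ffun {set 'I_n} -> R},
      (forall S : {set 'I_n}, #|S| != j.+1 -> v S = 0) &
      mxact (koszul_mx (fun=> 0) t) v = u.

(* The residue symbol f |-> Res[f dx_1 ... dx_n / t_1, ..., t_n], following
   Lipman's definition through Hochschild homology.  A k-basis of P = R/(t),
   lifted to R, gives a k-linear section P -> R, and for r in R
     r b_j = \sum_i (r_0)_ij b_i + \sum_l t_l \sum_i (r_l)_ij b_i  mod (t)^2
   with r_0, r_l in End_k(P).  Each r |-> r_l is a 1-cocycle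
   D_l : R -> End_k(P), and the residue is the trace of the cup product
   D_1 ... D_n evaluated on the Hochschild cycle
     \sum_pi sgn(pi) f (x) x_pi(1) (x) ... (x) x_pi(n)
   that represents f dx_1 ... dx_n.  The result does not depend on the basis
   and its lifts; [residue] makes one choice of them for all f. *)
Definition is_residue (rho : R -> k) : Prop :=
  exists (N : nat) (b : 'I_N -> R)
         (E0 : R -> 'M[k]_N) (E1 : 'I_n -> R -> 'M[k]_N),
    [/\ basis_mod b,
        (forall (r : R) (j : 'I_N),
           in_ideal_pow 2 (r * b j - \sum_i E0 r i j *: b i
                           - \sum_l t l * \sum_i E1 l r i j *: b i)) &
        (forall f : R, rho f =
           \sum_(s : 'S_n) (-1) ^+ s *
             \tr (E0 f * \prod_(l < n) E1 l 'X_(s l)))].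

Definition residue : R -> k := epsilon (inhabits (fun=> 0)) is_residue.

End Sequences.

Section Potentials.
Variables (k : comNzRingType) (n : nat).

Definition grad (W : {mpoly k[n]}) (i : 'I_n) : {mpoly k[n]} := W^`M(i).

Definition potential (W : {mpoly k[n]}) : Prop :=
  [/\ quasi_regular (grad W),
      (exists (N : nat) (b : 'I_N -> {mpoly k[n]}), basis_mod (grad W) b) &
      koszul_exact (grad W)].

End Potentials.

(* Points, i.e. values of the variables of a polynomial ring, and blocks of
   variables. *)
Definition pt (T : Type) (a b : nat) (f : 'I_a -> T) (g : 'I_b -> T)
    (v : 'I_(a + b)) : T :=
  match split v with inl i => f i | inr j => g j end.

Section Substitution.
Variables (k : comNzRingType) (a b : nat).

Definition msub (h : 'I_a -> {mpoly k[b]})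
    : {rmorphism {mpoly k[a]} -> {mpoly k[b]}} := mmap (@mpolyC b k) h.

Definition mixed (u u' : 'I_a -> {mpoly k[b]}) (c : nat) (w : 'I_a)
    : {mpoly k[b]} := if (w < c)%N then u' w else u w.

(* The divided difference of f in the v-th variable, between the points u and
   u', with the variables before v evaluated at u': this is the polynomial
   (f(u'_<v, u_>=v) - f(u'_<=v, u_>v)) / (u_v - u'_v), as [ddiffP] shows. *)
Definition ddiff (u u' : 'I_a -> {mpoly k[b]}) (v : 'I_a) (f : {mpoly k[a]})
    : {mpoly k[b]} :=
  \sum_(mon <- msupp f) (f@_mon)%:MP *
    (\prod_(w | w != v) mixed u u' v w ^+ mon w) *
    (\sum_(s < mon v) u v ^+ ((mon v).-1 - s) * u' v ^+ s).

Lemma ddiffP u u' v f :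
  (u v - u' v) * ddiff u u' v f =
  msub (mixed u u' v) f - msub (mixed u u' v.+1) f.
Proof.
rewrite /msub /= /mmap /ddiff -sumrB mulr_sumr; apply: eq_bigr => mon _.
have split_v c : (c == v :> nat) || (c == v.+1) ->
    mmap1 (mixed u u' c) mon =
    (\prod_(w | w != v) mixed u u' v w ^+ mon w) * mixed u u' c v ^+ mon v.
  move=> hc; rewrite /mmap1 (bigD1 v) //= mulrC; congr (_ * _).
  apply: eq_bigr => w; rewrite -val_eqE /= /mixed => wv.
  by case/orP: hc => /eqP ->; rewrite // ltnS leq_eqVlt (negbTE wv).
rewrite mulrCA -subrXX !split_v ?eqxx ?orbT //.
have -> : mixed u u' v v = u v by rewrite /mixed ltnn.
have -> : mixed u u' v.+1 v = u' v by rewrite /mixed ltnSn.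
by rewrite !mulrA -mulrBr.
Qed.

End Substitution.

(* The extension of a k-linear functional rho on k[z] to the polynomials in
   further variables; g sends each variable either to a z, as a constant of
   {mpoly k[z]}, or to one of the p variables that are kept. *)
Definition coef_ext (k : comNzRingType) (a m p : nat) (rho : {mpoly k[m]} -> k)
    (g : 'I_a -> {mpoly {mpoly k[m]}[p]}) (f : {mpoly k[a]}) : {mpoly k[p]} :=
  map_mpoly rho (mmap (@mpolyC p _ \o @mpolyC m k) g f).

Section Unit.
Variables (k : comNzRingType) (n : nat) (W : {mpoly k[n]}).

Definition fstv (i : 'I_n) : {mpoly k[n + n]} := 'X_(lshift n i).
Definition sndv (i : 'I_n) : {mpoly k[n + n]} := 'X_(rshift n i).

Definition Delta : gfree {mpoly k[n + n]} :=
  GFree idfun (@theta_par n)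
    (koszul_mx (fun i => ddiff fstv sndv i W) (fun i => fstv i - sndv i)).

End Unit.

Section Defects.
Variables (k : comNzRingType) (n m : nat).

Definition inx : {mpoly k[n]} -> {mpoly k[n + m]} :=
  msub (fun i => 'X_(lshift m i)).
Definition inz : {mpoly k[m]} -> {mpoly k[n + m]} :=
  msub (fun j => 'X_(rshift n j)).

Variables (W : {mpoly k[n]}) (V : {mpoly k[m]}) (X : mfact (inz V - inx W)).

Notation r := (mfrk X).
Notation XQ := (mfobj X).
Notation d := (mfd X).
Notation par := (@mfpar _ _ X).

Definition dx (i : 'I_n) : 'M[{mpoly k[n + m]}]_r :=
  map_mx (mderiv (lshift m i)) d.
Definition dz (j : 'I_m) : 'M[{mpoly k[n + m]}]_r :=
  map_mx (mderiv (rshift n j)) d.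

(* The variables of k[z, z', x], the ring of Delta_V (x) X. *)
Definition lu_z (j : 'I_m) : {mpoly k[m + m + n]} := 'X_(lshift n (lshift m j)).
Definition lu_z' (j : 'I_m) : {mpoly k[m + m + n]} := 'X_(lshift n (rshift m j)).
Definition lu_x (i : 'I_n) : {mpoly k[m + m + n]} := 'X_(rshift (m + m) i).

(* Delta_V over k[z, z'] and X over k[x, z'], tensored over k[z']; a
   factorisation over k[x, z]. *)
Definition DeltaX : gfree {mpoly k[n + m]} :=
  GFree (msub (pt lu_x lu_z)) (tens_par (@theta_par m) par)
    (tens_dmx (@theta_par m)
       (fun T S => msub (pt lu_z lu_z') (gdmx (g:=Delta V) T S))
       (fun i j => msub (pt lu_x lu_z') (d i j))).

(* lambda_X = pi (x) 1 *)
Definition lunitor (u : gel DeltaX) : gel XQ :=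
  [ffun i => msub (pt (pt (fun j => 'X_(rshift n j)) (fun j => 'X_(rshift n j)))
                      (fun i' => 'X_(lshift m i')))
                  (u (set0, i))].

Definition DeltaX_tens (phi : gel (Delta V) -> gel (Delta V))
    (Phi : gel XQ -> gel XQ) : gel DeltaX -> gel DeltaX :=
  mxact (tens_mx (fun T S => msub (pt lu_z lu_z') (gmx phi T S))
                 (fun i j => msub (pt lu_x lu_z') (gmx Phi i j))).

(* The variables of k[z, x, x'], the ring of X (x) Delta_W. *)
Definition ru_z (j : 'I_m) : {mpoly k[m + n + n]} := 'X_(lshift n (lshift n j)).
Definition ru_x (i : 'I_n) : {mpoly k[m + n + n]} := 'X_(lshift n (rshift m i)).
Definition ru_x' (i : 'I_n) : {mpoly k[m + n + n]} := 'X_(rshift (m + n) i).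

(* X over k[x, z] and Delta_W over k[x, x'], tensored over k[x]; a
   factorisation over k[x', z], where x' is the x of the base ring. *)
Definition XDelta : gfree {mpoly k[n + m]} :=
  GFree (msub (pt ru_x' ru_z)) (tens_par par (@theta_par n))
    (tens_dmx par
       (fun i j => msub (pt ru_x ru_z) (d i j))
       (fun T S => msub (pt ru_x ru_x') (gdmx (g:=Delta W) T S))).

(* rho_X = 1 (x) pi *)
Definition runitor (u : gel XDelta) : gel XQ :=
  [ffun i => msub (pt (pt (fun j => 'X_(rshift n j)) (fun i' => 'X_(lshift m i')))
                      (fun i' => 'X_(lshift m i')))
                  (u (i, set0))].

Definition XDelta_tens (Phi : gel XQ -> gel XQ)
    (psi : gel (Delta W) -> gel (Delta W)) : gel XDelta -> gel XDelta :=
  mxact (tens_mx (fun i j => msub (pt ru_x ru_z) (gmx Phi i j))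
                 (fun T S => msub (pt ru_x ru_x') (gmx psi T S))).

(* The variables of k[x, z, x'], the ring of X^v (x)_S X, and the points of
   its two factors. *)
Definition l_x (i : 'I_n) : {mpoly k[n + m + n]} := 'X_(lshift n (lshift m i)).
Definition l_z (j : 'I_m) : {mpoly k[n + m + n]} := 'X_(lshift n (rshift n j)).
Definition l_x' (i : 'I_n) : {mpoly k[n + m + n]} := 'X_(rshift (n + m) i).
Definition lp := pt l_x l_z.
Definition lp' := pt l_x' l_z.

(* The index (i, j) stands for e_i^* (x) e_j. *)
Definition XdualX : gfree {mpoly k[n + n]} :=
  GFree (msub (pt l_x l_x')) (tens_par par par)
    (tens_dmx par
       (dual_dmx par (fun i j => msub lp (d i j)))
       (fun i j => msub lp' (d i j))).

Definition dd_x (b : 'I_n) : 'M[{mpoly k[n + m + n]}]_r :=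
  map_mx (ddiff lp lp' (lshift m b)) d.

(* \tilde{coev}_X on the basis element theta_S, with l = #|~: S| *)
Definition coevt_mx (ij : 'I_r * 'I_r) (S : {set 'I_n}) : {mpoly k[n + m + n]} :=
  (-1) ^+ ((#|~: S|.+1 * par ij.2) + shuffle S) *
  (\prod_(b <- rev (enum (~: S))) dd_x b) ij.2 ij.1.

Definition coevt (u : gel (Delta W)) : gel XdualX :=
  [ffun ij => \sum_(S : {set 'I_n}) coevt_mx ij S * msub (pt l_x l_x') (u S)].

(* Res_{k[x,z,x']/k[x,x']} with respect to the partial derivatives of V *)
Definition res_l (f : {mpoly k[n + m + n]}) : {mpoly k[n + n]} :=
  coef_ext (residue (grad V))
    (pt (pt (fun i => 'X_(lshift n i)) (fun j => ('X_j)%:MP))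
        (fun i => 'X_(rshift n i))) f.

Definition ev_mx (S : {set 'I_n}) (ij : 'I_r * 'I_r) : {mpoly k[n + m + n]} :=
  (-1) ^+ ('C(#|S|, 2) + #|S| * par ij.2 + m) *
  ((\prod_(j < m) map_mx (msub lp) (dz j)) *
   \prod_(b <- enum S) dd_x b) ij.1 ij.2.

Definition ev (u : gel XdualX) : gel (Delta W) :=
  [ffun S => \sum_(ij : 'I_r * 'I_r) res_l (ev_mx S ij * u ij)].

(* 1 (x) f on X^v (x) X *)
Definition XdualX_map (f : gel XQ -> gel XQ) : gel XdualX -> gel XdualX :=
  mxact (tens_mx (@id_mx _ 'I_r) (fun i j => msub lp' (gmx f i j))).

(* The variables of k[z, x, z'], the ring of X (x)_R X^v, and the points of
   its two factors. *)
Definition r_z (j : 'I_m) : {mpoly k[m + n + m]} := 'X_(lshift m (lshift n j)).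
Definition r_x (i : 'I_n) : {mpoly k[m + n + m]} := 'X_(lshift m (rshift m i)).
Definition r_z' (j : 'I_m) : {mpoly k[m + n + m]} := 'X_(rshift (m + n) j).
Definition rp := pt r_x r_z.
Definition rp' := pt r_x r_z'.

(* The index (i, j) stands for e_i (x) e_j^*. *)
Definition XXdual : gfree {mpoly k[m + m]} :=
  GFree (msub (pt r_z r_z')) (tens_par par par)
    (tens_dmx par
       (fun i j => msub rp (d i j))
       (dual_dmx par (fun i j => msub rp' (d i j)))).

Definition dd_z (b : 'I_m) : 'M[{mpoly k[m + n + m]}]_r :=
  map_mx (ddiff rp rp' (rshift n b)) d.

(* coev_X on the basis element theta_S, with l = #|~: S| *)
Definition coev_mx (ij : 'I_r * 'I_r) (S : {set 'I_m}) : {mpoly k[m + n + m]} :=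
  (-1) ^+ ('C(#|~: S|.+1, 2) + shuffle S + m + m * #|~: S|) *
  (\prod_(b <- enum (~: S)) dd_z b) ij.1 ij.2.

Definition coev (u : gel (Delta V)) : gel XXdual :=
  [ffun ij => \sum_(S : {set 'I_m}) coev_mx ij S * msub (pt r_z r_z') (u S)].

(* Res_{k[z,x,z']/k[z,z']} with respect to the partial derivatives of W *)
Definition res_r (f : {mpoly k[m + n + m]}) : {mpoly k[m + m]} :=
  coef_ext (residue (grad W))
    (pt (pt (fun j => 'X_(lshift m j)) (fun i => ('X_i)%:MP))
        (fun j => 'X_(rshift m j))) f.

(* The entry at e_j (x) e_i^*, with ji = (j, i). *)
Definition evt_mx (S : {set 'I_m}) (ji : 'I_r * 'I_r) : {mpoly k[m + n + m]} :=
  (-1) ^+ (#|S| + n.+1 * par ji.1) *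
  ((\prod_(b <- rev (enum S)) dd_z b) *
   \prod_(i < n) map_mx (msub rp) (- dx i)) ji.2 ji.1.

Definition evt (u : gel XXdual) : gel (Delta V) :=
  [ffun S => \sum_(ji : 'I_r * 'I_r) res_r (evt_mx S ji * u ji)].

(* f (x) 1 on X (x) X^v *)
Definition XXdual_map (f : gel XQ -> gel XQ) : gel XXdual -> gel XXdual :=
  mxact (tens_mx (fun i j => msub rp (gmx f i j)) (@id_mx _ 'I_r)).

(* A morphism of the homotopy category is treated as a homotopy class:
   [defect_l Phi phi D] says that D represents the class D_l^Phi(X)(phi).  The
   inverse of lambda_X exists only up to homotopy. *)
Definition defect_l (Phi : gel XQ -> gel XQ)
    (phi : gel (Delta V) -> gel (Delta V)) (D : gel (Delta W) -> gel (Delta W))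
    : Prop :=
  exists linv : gel XQ -> gel DeltaX, hinverse lunitor linv /\
    homotopic D
      (ev \o XdualX_map (lunitor \o DeltaX_tens phi Phi \o linv) \o coevt).

Definition defect_r (Phi : gel XQ -> gel XQ)
    (psi : gel (Delta W) -> gel (Delta W)) (D : gel (Delta V) -> gel (Delta V))
    : Prop :=
  exists rinv : gel XQ -> gel XDelta, hinverse runitor rinv /\
    homotopic D
      (evt \o XXdual_map (runitor \o XDelta_tens Phi psi \o rinv) \o coev).

(* str(Phi d_{x_1}d_X ... d_{x_n}d_X d_{z_1}d_X ... d_{z_m}d_X) *)
Definition defect_str (Phi : gel XQ -> gel XQ) : {mpoly k[n + m]} :=
  str par ((\matrix_(i < r, j < r) gmx Phi i j) *
           (\prod_(i < n) dx i) * (\prod_(j < m) dz j)).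

(* Res_{k[x,z]/k[x]}[- dz / dV] and Res_{k[x,z]/k[z]}[- dx / dW] *)
Definition res_z (f : {mpoly k[n + m]}) : {mpoly k[n]} :=
  coef_ext (residue (grad V)) (pt (fun i => 'X_i) (fun j => ('X_j)%:MP)) f.
Definition res_x (f : {mpoly k[n + m]}) : {mpoly k[m]} :=
  coef_ext (residue (grad W)) (pt (fun i => ('X_i)%:MP) (fun j => 'X_j)) f.

End Defects.

(* A polynomial p acts on Delta_W by multiplication with p(x); its action
   through p(x') is homotopic to this one. *)
Definition Delta_mul (k : comNzRingType) (n : nat) (W p : {mpoly k[n]})
    : gel (Delta W) -> gel (Delta W) :=
  gscale (msub (@fstv k n) p).

(* Main.v *)
(* Setting z' = z kills the Koszul part z_j - z'_j of Delta_V (x) X, and divided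
   differences contract that part.  A chain map that dies under the unitor is
   therefore null-homotopic, so lambda_X is a homotopy equivalence and carries
   phi (x) Phi to phi(z) Phi.  Evaluation and coevaluation are chain maps because
   d(x) - d(x') telescopes along the divided differences of d.

   For an endomorphism F of Delta_W let g_S be the coefficient of 1 in
   F(theta_S), restricted to x' = x.  The g_S form a Koszul cycle for the partial
   derivatives of W; by exactness g_S lies in (dW) for S <> set0, and F is
   null-homotopic as soon as g_set0 does.  So D_l is multiplication by its g_set0,
   which is Res[phi str(Phi d_n ... d_1 Lambda)] with d_i = d_X / dx_i and Lambda
   the product of the z-derivatives of d_X.

   It remains to reverse the word d_n ... d_1.  Since d_a d_b + d_b d_a is minus
   the second derivative of W up to an anticommutator with d_X, a transposition
   costs a second derivative of W times a shorter even word.  The residues of the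
   shorter words vanish modulo (dW) because they are, up to sign, the g_S of the
   same D_l with S <> set0.  For D_r only the x-block and the z-block are
   exchanged, and the mixed second derivatives of V - W are zero. *)

Require Import Defs.
From HB Require Import structures.
From mathcomp Require Import all_boot all_order all_fingroup all_algebra.
From mathcomp Require Import mpoly ring zify.
From Stdlib Require Import ClassicalEpsilon.

Set Implicit Arguments.
Unset Strict Implicit.
Unset Printing Implicit Defensive.

Import GRing.Theory.
Local Open Scope ring_scope.

(** * Koszul matrices *)

(** Over an arbitrary [k] nothing can be divided, so identities for divided differences are checked
    after multiplication by a difference of two variables, a nonzerodivisor because its leading
    coefficient is a sign. Delta_V (x) X and X (x) Delta_W have a basis only over a ring that keeps
    the intermediate variables. Null-homotopies of maps into them are therefore built from divided
    differences, one intermediate variable at a time, and are linear because no base variable is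
    eliminated. For Delta_W the roles change: x' is eliminated although it is a base variable, but
    there a basis over the base ring is available. Only the part of a differential that lowers the
    exterior degree is inverted; the rest is absorbed by induction on that degree, which is bounded.
    The residue enters through linearity and its vanishing on the ideal of the partial derivatives.
    Parity matters twice: an even number of odd factors lets Lambda commute with d_X modulo that
    ideal, and a transposition is harmless when the other letters are even in number, since the
    signs met while pushing d_X out to the left and to the right then agree. *)

Section Flip.
Variable n : nat.
Implicit Types (S T : {set 'I_n}) (i j : 'I_n).

(** Wedging with theta_i and contracting with its dual both send theta_S, when nonzero, to a
    multiple of the monomial of the symmetric difference of [S] and {i}. Treating both as one
    involution merges the two halves of a Koszul differential. *)
Definition flip S i : {set 'I_n} := if i \in S then S :\ i else i |: S.

Lemma in_flip S i j : (j \in flip S i) = (j == i) (+) (j \in S).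
Proof.
rewrite /flip; case: ifP => iS; rewrite !inE; case: eqP => [->|] //=.
  by rewrite iS.
by rewrite iS.
Qed.

Lemma flipK S i : flip (flip S i) i = S.
Proof. by apply/setP=> j; rewrite !in_flip addKb. Qed.

Lemma flipC S i j : flip (flip S i) j = flip (flip S j) i.
Proof. by apply/setP=> l; rewrite !in_flip addbCA. Qed.

Lemma flip_eq S T i : (T == flip S i) = (S == flip T i).
Proof. by apply/eqP/eqP => ->; rewrite flipK. Qed.

Lemma flip_setC S i : flip (~: S) i = ~: flip S i.
Proof. by apply/setP=> j; rewrite inE !in_flip inE addbN. Qed.

Lemma card_flip S i :
  #|flip S i| = if i \in S then #|S|.-1 else #|S|.+1.
Proof.
rewrite /flip; case: ifP => iS; last by rewrite cardsU1 iS.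
by rewrite [in RHS](cardsD1 i S) iS.
Qed.

Lemma odd_flip S i : odd #|flip S i| = ~~ odd #|S|.
Proof.
rewrite card_flip; case: ifP => // iS.
by rewrite (cardsD1 i S) iS /= negbK.
Qed.

Variable A : comNzRingType.

(** The sign of carrying theta_i to its place in theta_S. It does not depend on whether [i] lies in
    [S], so wedge and contraction share it. *)
Definition sg S i : A := (-1) ^+ #|[set s in S | (s < i)%N]|.

Lemma sgE S i : sg S i = \prod_(s < n) (if (s \in S) && (s < i)%N then -1 else 1).
Proof.
rewrite -big_mkcond /= /sg -prodr_const; apply: eq_bigl => s.
by rewrite inE.
Qed.

Lemma sg_flip S i j : sg (flip S i) j = (-1) ^+ (i < j)%N * sg S j.
Proof.
rewrite !sgE [in LHS](bigD1 i) //= [in RHS](bigD1 i) //= mulrA.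
congr (_ * _); last first.
  by apply: eq_bigr => s /negbTE sN; rewrite in_flip sN.
rewrite in_flip eqxx /=.
by case: (i \in S); case: (i < j)%N; rewrite /= ?expr1 ?expr0 ?mulr1 ?mul1r ?mulrNN ?mulr1.
Qed.

Lemma sg_flipxx S i : sg (flip S i) i = sg S i.
Proof. by rewrite sg_flip ltnn mul1r. Qed.

Lemma sgK S i : sg S i * sg S i = 1.
Proof. by rewrite /sg -exprD addnn -mul2n exprM sqrrN !expr1n. Qed.

Lemma koszul_mxE (a b : 'I_n -> A) T S :
  koszul_mx a b T S =
  \sum_i (if T == flip S i then sg S i * (if i \in S then b i else a i) else 0).
Proof.
apply: eq_bigr => i _; rewrite -/(sg S i) /flip.
by case: (i \in S); rewrite /= ?add0r ?addr0; case: ifP; rewrite ?mulr0.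
Qed.

Lemma koszul_col (a b : 'I_n -> A) S (F : {set 'I_n} -> A) :
  \sum_T F T * koszul_mx a b T S =
  \sum_i sg S i * (if i \in S then b i else a i) * F (flip S i).
Proof.
under eq_bigr do rewrite koszul_mxE mulr_sumr.
rewrite exchange_big; apply: eq_bigr => i _ /=.
rewrite (bigD1 (flip S i)) //= eqxx [X in _ + X]big1 => [|T /negbTE ->].
  by rewrite addr0 mulrC.
exact: mulr0.
Qed.

(** Column [S] meets row [T] through [i] exactly when [S = flip T i], and then [i] lies in one of
    the two sets only: this is why [a] and [b] trade places compared with [koszul_col]. *)
Lemma koszul_row (a b : 'I_n -> A) T (F : {set 'I_n} -> A) :
  \sum_S koszul_mx a b T S * F S =
  \sum_i sg T i * (if i \in T then a i else b i) * F (flip T i).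
Proof.
under eq_bigr do rewrite koszul_mxE mulr_suml.
rewrite exchange_big; apply: eq_bigr => i _ /=.
rewrite (bigD1 (flip T i)) //= [X in _ + X]big1 => [|S neqS].
  rewrite addr0 flipK eqxx sg_flipxx in_flip eqxx.
  by case: (i \in T).
by rewrite flip_eq (negbTE neqS) mul0r.
Qed.

Lemma koszul_act (a b : 'I_n -> A) (u : {ffun {set 'I_n} -> A}) T :
  mxact (koszul_mx a b) u T =
  \sum_i sg T i * (if i \in T then a i else b i) * u (flip T i).
Proof. by rewrite ffunE koszul_row. Qed.

Lemma sum_antisym (F : 'I_n -> 'I_n -> A) :
  (forall i j, (i < j)%N -> F i j + F j i = 0) ->
  \sum_i \sum_j F i j = \sum_i F i i.
Proof.
move=> Fsym.
have -> : \sum_i \sum_j F i j = \sum_i F i i +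
    \sum_(i < n) (\sum_(j < n | (i < j)%N) F i j + \sum_(j < n | (j < i)%N) F i j).
  rewrite -big_split; apply: eq_bigr => i _.
  rewrite (bigD1 i) //=; congr (_ + _).
  rewrite (bigID (fun j : 'I_n => (i < j)%N)) /=; congr (_ + _).
    by apply: eq_bigl => j; rewrite -val_eqE /=; case: ltngtP.
  by apply: eq_bigl => j; rewrite -val_eqE /=; case: ltngtP.
rewrite [X in _ + X]big_split /= [X in _ + (_ + X)](exchange_big_dep predT) //=.
rewrite -big_split /= [X in _ + X]big1 ?addr0 // => i _.
by rewrite -big_split big1 // => j; exact: Fsym.
Qed.

(** Flipping [i] then [j] cancels against flipping [j] then [i], because by [sg_flip] exactly one of
    the two signs changes. A diagonal term flips [i] twice, once through [a i] and once through
    [b i]. *)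
Lemma koszul_sq (a b : 'I_n -> A) (u : {ffun {set 'I_n} -> A}) T :
  mxact (koszul_mx a b) (mxact (koszul_mx a b) u) T =
  (\sum_i a i * b i) * u T.
Proof.
rewrite koszul_act.
under eq_bigr do rewrite koszul_act mulr_sumr.
rewrite sum_antisym => [|i j lt_ij].
  rewrite mulr_suml; apply: eq_bigr => i _.
  rewrite sg_flipxx flipK in_flip eqxx /= !mulrA -(mulrA (sg T i)).
  rewrite (mulrC _ (sg T i)) mulrA sgK mul1r.
  by case: (i \in T) => //=; rewrite (mulrC (b i)).
have neq_ij : (i == j) = false by rewrite -val_eqE /= ltn_eqF.
rewrite !sg_flip !in_flip (flipC T j i) (eq_sym j) neq_ij lt_ij.
rewrite (ltnNge j i) (ltnW lt_ij) /= expr1 expr0.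
move: (u _) (sg T i) (sg T j) (if i \in T then _ else _) (if j \in T then _ else _).
by move=> x y z v w; ring.
Qed.

End Flip.

Arguments sg {n} A S i.

(** * Substitutions and graded maps *)

Section PolynomialMaps.
Variable k : comNzRingType.

Lemma mpoly_rmorph_eq (a : nat) (S : comNzRingType)
    (f g : {rmorphism {mpoly k[a]} -> S}) :
  (forall c, f c%:MP = g c%:MP) -> (forall i, f 'X_i = g 'X_i) -> f =1 g.
Proof.
move=> fgC fgX p; rewrite [p]mpolyE !raddf_sum /=; apply: eq_bigr => mon _.
rewrite -mul_mpolyC !rmorphM fgC mpolyXE_id !rmorph_prod; congr (_ * _).
by apply: eq_bigr => i _; rewrite !rmorphXn fgX.
Qed.

Lemma msubC a b (h : 'I_a -> {mpoly k[b]}) c : msub h c%:MP = c%:MP.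
Proof. exact: mmapC. Qed.

Lemma msubX a b (h : 'I_a -> {mpoly k[b]}) i : msub h 'X_i = h i.
Proof. by rewrite /= mmapX mmap1U. Qed.

Lemma msubZ a b (h : 'I_a -> {mpoly k[b]}) c p : msub h (c *: p) = c *: msub h p.
Proof. by rewrite -mul_mpolyC rmorphM msubC mul_mpolyC. Qed.

Lemma eq_msub a b (h h' : 'I_a -> {mpoly k[b]}) : h =1 h' -> msub h =1 msub h'.
Proof.
move=> hh'; apply: mpoly_rmorph_eq => [c|i]; first by rewrite !msubC.
by rewrite !msubX hh'.
Qed.

Lemma msub_comp a b c (g : 'I_b -> {mpoly k[c]}) (h : 'I_a -> {mpoly k[b]}) p :
  msub g (msub h p) = msub (fun i => msub g (h i)) p.
Proof.
pose F : {rmorphism _ -> _} := msub g \o msub h.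
apply: (mpoly_rmorph_eq (f := F)) => [e|i]; first by rewrite /F [LHS]/= !msubC.
by rewrite /F [LHS]/= !msubX.
Qed.

Lemma msub_id a (h : 'I_a -> {mpoly k[a]}) :
  (forall i, h i = 'X_i) -> msub h =1 id.
Proof.
move=> hX p; apply: (mpoly_rmorph_eq (g := idfun)) => [c|i] /=.
  exact: msubC.
by rewrite (msubX h) hX.
Qed.

(** [k] may have zero divisors, so the argument goes through leading monomials: the larger of the
    two variables has coefficient 1, if need be after negation. *)
Lemma lreg_subX a (i j : 'I_a) : i != j ->
  GRing.lreg ('X_i - 'X_j : {mpoly k[a]}).
Proof.
have lreg_lt (i' j' : 'I_a) : (U_(j')%MM < (U_(i')%MM : 'X_{1..a}))%O ->
    GRing.lreg ('X_i' - 'X_j' : {mpoly k[a]}).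
  move=> lt_ji; apply: lreg_mleadc.
  rewrite mleadDl ?mleadN ?mleadXm // mcoeffB !mcoeffX eqxx.
  by rewrite (Order.POrderTheory.lt_eqF lt_ji) subr0; exact: lreg1.
move=> neq_ij; have : (U_(i)%MM : 'X_{1..a}) != U_(j)%MM by rewrite eq_mnm1.
case: Order.TotalTheory.ltgtP => // [lt_ij|lt_ji] _; last exact: lreg_lt.
move: (lreg_lt _ _ lt_ij) => reg p q.
by rewrite -opprB !mulNr => /oppr_inj /reg.
Qed.

(** Where the two points coincide [ddiffP] degenerates to 0 = 0, so the explicit sum is used: its
    geometric factor collapses to [mon v] equal powers, as in the derivative. *)
Lemma msub_ddiff_diag a b c (u u' : 'I_a -> {mpoly k[b]}) (v : 'I_a)
    (g : 'I_b -> {mpoly k[c]}) (h : 'I_a -> {mpoly k[c]}) f :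
  (forall w, msub g (u w) = h w) -> (forall w, msub g (u' w) = h w) ->
  msub g (ddiff u u' v f) = msub h (mderiv v f).
Proof.
move=> gu gu'; rewrite /ddiff /mderiv !rmorph_sum; apply: eq_bigr => mon _.
rewrite msubZ [msub h _]mmapX !(rmorphM (msub g)) msubC (rmorph_prod (msub g)) (rmorph_sum (msub g)).
have -> : mmap1 h (mon - U_(v)) =
    (\prod_(w | w != v) h w ^+ mon w) * h v ^+ (mon v).-1.
  rewrite /mmap1 (bigD1 v) //= mnmBE mnm1E eqxx subn1 mulrC; congr (_ * _).
  by apply: eq_bigr => w wv; rewrite mnmBE mnm1E eq_sym (negbTE wv) subn0.
have -> : \prod_(w | w != v) msub g (mixed u u' v w ^+ mon w) =
    \prod_(w | w != v) h w ^+ mon w.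
  apply: eq_bigr => w wv; rewrite (rmorphXn (msub g)) /mixed.
  by case: ifP; rewrite ?gu ?gu'.
have -> : \sum_(s < mon v) msub g (u v ^+ ((mon v).-1 - s) * u' v ^+ s) =
    h v ^+ (mon v).-1 *+ mon v.
  rewrite (eq_bigr (fun=> h v ^+ (mon v).-1)) ?sumr_const ?card_ord // => s _.
  rewrite (rmorphM (msub g)) !(rmorphXn (msub g)) gu gu' -exprD subnK //.
  by case: s => s /=; case: (mon v).
rewrite -mul_mpolyC mpolyCM mpolyC_nat -mulr_natl.
by ring.
Qed.

End PolynomialMaps.

Section Points.
Variables (T : Type) (a b : nat) (f : 'I_a -> T) (g : 'I_b -> T).

Lemma ptl i : pt f g (lshift b i) = f i.
Proof.
rewrite /pt; case: splitP => j /= ej; first by congr f; exact: val_inj.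
by have := ltn_ord i; rewrite ej ltnNge leq_addr.
Qed.

Lemma ptr j : pt f g (rshift a j) = g j.
Proof.
rewrite /pt; case: splitP => i /= ei; first by have := ltn_ord i; rewrite -ei ltnNge leq_addr.
by congr g; apply: val_inj; exact: esym (addnI ei).
Qed.

Definition ptE := (ptl, ptr).

Lemma split_ind (P : 'I_(a + b) -> Prop) :
  (forall i, P (lshift b i)) -> (forall j, P (rshift a j)) -> forall v, P v.
Proof.
move=> Pl Pr v; case: (splitP v) => [i|j] e.
  by have -> : v = lshift b i by exact: val_inj.
by have -> : v = rshift a j by exact: val_inj.
Qed.

End Points.

Section PointSubstitution.
Variables (k : comNzRingType) (a b c : nat).
Variables (f : 'I_a -> {mpoly k[c]}) (g : 'I_b -> {mpoly k[c]}).

Lemma msub_ptl p : msub (pt f g) (msub (fun i => 'X_(lshift b i)) p) = msub f p.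
Proof. by rewrite msub_comp; apply: eq_msub => i; rewrite msubX ptE. Qed.

Lemma msub_ptr p : msub (pt f g) (msub (fun j => 'X_(rshift a j)) p) = msub g p.
Proof. by rewrite msub_comp; apply: eq_msub => i; rewrite msubX ptE. Qed.

End PointSubstitution.

Section MatrixAction.
Variable A : comNzRingType.
Implicit Types I J L : finType.

Lemma mxactD I J (M : I -> J -> A) u v : mxact M (u + v) = mxact M u + mxact M v.
Proof.
apply/ffunP=> i; rewrite !ffunE -big_split; apply: eq_bigr => j _.
by rewrite ffunE mulrDr.
Qed.

Lemma mxact0 I J (M : I -> J -> A) : mxact M 0 = 0.
Proof. by apply/ffunP=> i; rewrite !ffunE big1 // => j _; rewrite ffunE mulr0. Qed.

Lemma mxactN I J (M : I -> J -> A) u : mxact M (- u) = - mxact M u.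
Proof.
apply/ffunP=> i; rewrite !ffunE -sumrN; apply: eq_bigr => j _.
by rewrite ffunE mulrN.
Qed.

Lemma mxactB I J (M : I -> J -> A) u v : mxact M (u - v) = mxact M u - mxact M v.
Proof. by rewrite mxactD mxactN. Qed.

Lemma mxactZ I J (M : I -> J -> A) c (u : {ffun J -> A}) :
  mxact M [ffun j => c * u j] = [ffun i => c * mxact M u i].
Proof.
apply/ffunP=> i; rewrite !ffunE mulr_sumr; apply: eq_bigr => j _.
by rewrite ffunE mulrCA.
Qed.

Lemma mxact_comp I J L (M : I -> J -> A) (M' : J -> L -> A) u :
  mxact M (mxact M' u) = mxact (fun i l => \sum_j M i j * M' j l) u.
Proof.
apply/ffunP=> i; rewrite !ffunE.
under eq_bigr do rewrite ffunE mulr_sumr.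
rewrite exchange_big; apply: eq_bigr => l _; rewrite mulr_suml.
by apply: eq_bigr => j _; rewrite mulrA.
Qed.

Lemma mxact_add I J (M M' : I -> J -> A) u :
  mxact (fun i j => M i j + M' i j) u = mxact M u + mxact M' u.
Proof.
apply/ffunP=> i; rewrite !ffunE -big_split; apply: eq_bigr => j _.
by rewrite mulrDl.
Qed.

Lemma eq_mxact I J (M M' : I -> J -> A) u :
  (forall i j, M i j = M' i j) -> mxact M u = mxact M' u.
Proof. by move=> eM; apply/ffunP=> i; rewrite !ffunE; apply: eq_bigr => j _; rewrite eM. Qed.

Lemma mxact_delta I J (M : I -> J -> A) j :
  mxact M [ffun j' => (j' == j)%:R] = [ffun i => M i j].
Proof.
apply/ffunP=> i; rewrite !ffunE (bigD1 j) //= ffunE eqxx mulr1 big1 ?addr0 //.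
by move=> j' /negbTE neq; rewrite ffunE neq mulr0.
Qed.

Lemma sum_deltal I (i : I) (F : I -> A) : \sum_j (i == j)%:R * F j = F i.
Proof.
rewrite (bigD1 i) //= eqxx mul1r big1 ?addr0 // => j.
by rewrite eq_sym => /negbTE ->; rewrite mul0r.
Qed.

Lemma sum_deltar I (i : I) (F : I -> A) : \sum_j F j * (j == i)%:R = F i.
Proof.
by rewrite -[RHS]sum_deltal; apply: eq_bigr => j _; rewrite mulrC eq_sym.
Qed.

End MatrixAction.

Section GradedMaps.
Variable B : comNzRingType.
Implicit Types M N P : gfree B.

Lemma gscaleE M b (u : gel M) i : gscale b u i = Defs.gact M b * u i.
Proof. exact: ffunE. Qed.

Lemma gscale1 M (u : gel M) : gscale 1 u = u.
Proof. by apply/ffunP=> i; rewrite gscaleE rmorph1 mul1r. Qed.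

Lemma gscaleN1 M (u : gel M) : gscale (-1) u = - u.
Proof. by apply/ffunP=> i; rewrite gscaleE rmorphN1 mulN1r ffunE. Qed.

Lemma gscaleA M b c (u : gel M) : gscale b (gscale c u) = gscale (b * c) u.
Proof. by apply/ffunP=> i; rewrite !gscaleE rmorphM mulrA. Qed.

Lemma gscaleD M b (u v : gel M) : gscale b (u + v) = gscale b u + gscale b v.
Proof. by apply/ffunP=> i; rewrite gscaleE !ffunE mulrDr. Qed.

Lemma gscale0 M b : gscale b (0 : gel M) = 0.
Proof. by apply/ffunP=> i; rewrite gscaleE ffunE mulr0. Qed.

Section Linear.
Variables (M N : gfree B) (f : gel M -> gel N).
Hypothesis f_lin : glinear f.

Lemma glinD u v : f (u + v) = f u + f v.
Proof. by have := f_lin 1 u v; rewrite !gscale1. Qed.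

Lemma glin0 : f 0 = 0.
Proof. by apply/(addIr (f 0)); rewrite -glinD !add0r. Qed.

Lemma glinZ b u : f (gscale b u) = gscale b (f u).
Proof. by have := f_lin b u 0; rewrite glin0 !addr0. Qed.

Lemma glinN u : f (- u) = - f u.
Proof. by rewrite -!gscaleN1 glinZ. Qed.

Lemma glinB u v : f (u - v) = f u - f v.
Proof. by rewrite glinD glinN. Qed.

Lemma glin_sum (I : Type) (s : seq I) (F : I -> gel M) :
  f (\sum_(i <- s) F i) = \sum_(i <- s) f (F i).
Proof.
elim: s => [|i s IHs]; first by rewrite !big_nil glin0.
by rewrite !big_cons glinD IHs.
Qed.

End Linear.

Lemma glin_comp M N P (g : gel N -> gel P) (f : gel M -> gel N) :
  glinear g -> glinear f -> glinear (g \o f).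
Proof. by move=> g_lin f_lin b u v; rewrite /= f_lin g_lin. Qed.

Lemma glin_add M N (f g : gel M -> gel N) :
  glinear f -> glinear g -> glinear (fun u => f u + g u).
Proof.
move=> f_lin g_lin b u v; rewrite f_lin g_lin gscaleD -!addrA; congr (_ + _).
by rewrite addrCA.
Qed.

Lemma glin_opp M N (f : gel M -> gel N) :
  glinear f -> glinear (fun u => - f u).
Proof.
move=> f_lin b u v; rewrite f_lin opprD; congr (_ + _).
by rewrite -gscaleN1 gscaleA mulrC -gscaleA gscaleN1.
Qed.

Lemma glin_sub M N (f g : gel M -> gel N) :
  glinear f -> glinear g -> glinear (fun u => f u - g u).
Proof. by move=> f_lin g_lin; apply: glin_add => //; exact: glin_opp. Qed.

Lemma glin_gscale M c : glinear (gscale c : gel M -> gel M).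
Proof. by move=> b u v; rewrite gscaleD !gscaleA mulrC. Qed.

Lemma glin_mxact M (K : gidx M -> gidx M -> gring M) : glinear (mxact K : gel M -> gel M).
Proof. by move=> b u v; rewrite mxactD; congr (_ + _); exact: mxactZ. Qed.

Lemma glin_gdiff M : glinear (@gdiff B M).
Proof. exact: glin_mxact. Qed.

Lemma ghomogD M p (u v : gel M) : ghomog p u -> ghomog p v -> ghomog p (u + v).
Proof. by move=> hu hv i ip; rewrite ffunE hu // hv // addr0. Qed.

Lemma ghomogN M p (u : gel M) : ghomog p u -> ghomog p (- u).
Proof. by move=> hu i ip; rewrite ffunE hu // oppr0. Qed.

Lemma gdeg_comp M N P s t (g : gel N -> gel P) (f : gel M -> gel N) :
  gdegree s g -> gdegree t f -> gdegree (s (+) t) (g \o f).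
Proof. by move=> g_deg f_deg p u /f_deg /g_deg; rewrite addbA. Qed.

Lemma gdeg_add M N s (f g : gel M -> gel N) :
  gdegree s f -> gdegree s g -> gdegree s (fun u => f u + g u).
Proof. by move=> f_deg g_deg p u hu; apply: ghomogD; [exact: f_deg | exact: g_deg]. Qed.

Lemma gdeg_opp M N s (f : gel M -> gel N) :
  gdegree s f -> gdegree s (fun u => - f u).
Proof. by move=> f_deg p u hu; apply: ghomogN; exact: f_deg. Qed.

Lemma gdeg_mxact M s (K : gidx M -> gidx M -> gring M) :
  (forall i j, gpar i != s (+) gpar j -> K i j = 0) ->
  gdegree s (mxact K : gel M -> gel M).
Proof.
move=> K_deg p u hu i ip; rewrite ffunE big1 // => j _.
have [ij|ij] := eqVneq (gpar i) (s (+) gpar j); last by rewrite K_deg ?mul0r.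
by rewrite hu ?mulr0 //; apply: contraNneq ip => <-; rewrite ij.
Qed.

Lemma gmor_comp M N P (g : gel N -> gel P) (f : gel M -> gel N) :
  gmor g -> gmor f -> gmor (g \o f).
Proof.
move=> [g_lin g_deg gd] [f_lin f_deg fd]; split; first exact: glin_comp.
  exact: (gdeg_comp g_deg f_deg).
by move=> u; rewrite /= fd gd.
Qed.

Lemma homotopic_refl M N (f : gel M -> gel N) : homotopic f f.
Proof.
exists (fun=> 0); split=> [b u v|p u _ i _|u].
- by rewrite gscale0 addr0.
- by rewrite ffunE.
- by rewrite subrr addr0 (glin0 (@glin_gdiff _)).
Qed.

Lemma eq_homotopic M N (f g : gel M -> gel N) : f =1 g -> homotopic f g.
Proof.
have [h [h_lin h_deg hd]] := homotopic_refl g.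
by move=> fg; exists h; split=> // u; rewrite fg hd.
Qed.

Lemma homotopic_sym M N (f g : gel M -> gel N) : homotopic f g -> homotopic g f.
Proof.
case=> h [h_lin h_deg hd]; exists (fun u => - h u); split.
- exact: glin_opp.
- exact: gdeg_opp.
- by move=> u; rewrite (glinN (@glin_gdiff _)) -opprD -hd opprB.
Qed.

Lemma homotopic_trans M N (f g e : gel M -> gel N) :
  homotopic f g -> homotopic g e -> homotopic f e.
Proof.
case=> h [h_lin h_deg hd] [h' [h'_lin h'_deg h'd]].
exists (fun u => h u + h' u); split.
- exact: glin_add.
- exact: gdeg_add.
- move=> u; rewrite (glinD (@glin_gdiff _)) addrACA -hd -h'd.
  by rewrite addrA subrK.
Qed.

Lemma homotopic_compl M N P (g : gel N -> gel P) (f f' : gel M -> gel N) :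
  gmor g -> homotopic f f' -> homotopic (g \o f) (g \o f').
Proof.
move=> [g_lin g_deg gd] [h [h_lin h_deg hd]]; exists (g \o h); split.
- exact: glin_comp.
- exact: (gdeg_comp g_deg h_deg).
- by move=> u; rewrite /= -(glinB g_lin) hd (glinD g_lin) gd.
Qed.

Lemma homotopic_compr M N P (g g' : gel N -> gel P) (f : gel M -> gel N) :
  gmor f -> homotopic g g' -> homotopic (g \o f) (g' \o f).
Proof.
move=> [f_lin f_deg fd] [h [h_lin h_deg hd]]; exists (h \o f); split.
- exact: glin_comp.
- by have := gdeg_comp h_deg f_deg; rewrite addbF.
- by move=> u; rewrite /= hd fd.
Qed.

End GradedMaps.

Section FiniteRank.
Variables (B : comNzRingType) (I : finType) (p : I -> bool) (d : I -> I -> B).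
Let M : gfree B := GFree idfun p d.
Let e (j : I) : gel M := [ffun j' => (j' == j)%:R].

Lemma ghomog_basis j : ghomog (p j) (e j).
Proof. by move=> i ip; rewrite ffunE; case: (i =P j) ip => [->|] //=; rewrite eqxx. Qed.

Lemma gel_basis (u : gel M) : u = \sum_j gscale (u j) (e j).
Proof.
apply/ffunP=> i; rewrite sum_ffunE (bigD1 i) //= !ffunE eqxx mulr1.
rewrite big1 ?addr0 // => j /negbTE ji.
by rewrite !ffunE eq_sym ji mulr0.
Qed.

Variable N : gfree B.

Lemma glin_basis (f : gel M -> gel N) u :
  glinear f -> f u = \sum_j gscale (u j) (f (e j)).
Proof.
by move=> f_lin; rewrite {1}[u]gel_basis glin_sum //; apply: eq_bigr => j _; rewrite glinZ.
Qed.

Lemma glin_gmx (f : gel M -> gel N) u i :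
  glinear f -> f u i = \sum_j gmx f i j * Defs.gact N (u j).
Proof.
move=> f_lin; rewrite glin_basis // sum_ffunE; apply: eq_bigr => j _.
by rewrite gscaleE mulrC.
Qed.

(** Out of an object that is free over [B] itself a map may be prescribed on the basis. This gives
    linear lifts even where the lifting procedure is not [B]-linear. *)
Definition gext (F : I -> gel N) (u : gel M) : gel N := \sum_j gscale (u j) (F j).

Lemma glin_gext F : glinear (gext F).
Proof.
move=> b u v; rewrite /gext.
have -> : gscale b (\sum_j gscale (u j) (F j)) = \sum_j gscale b (gscale (u j) (F j)).
  by rewrite (glin_sum (glin_gscale b)).
rewrite -big_split; apply: eq_bigr => j _; apply/ffunP=> i.
by rewrite !ffunE rmorphD rmorphM mulrDl !mulrA.
Qed.

Lemma gdeg_gext s F : (forall j, ghomog (s (+) p j) (F j)) -> gdegree s (gext F).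
Proof.
move=> hF q u hu i iq; rewrite sum_ffunE big1 // => j _; rewrite gscaleE.
have [pj|pj] := eqVneq (p j) q; first by rewrite hF ?mulr0 // pj.
by rewrite hu // rmorph0 mul0r.
Qed.

End FiniteRank.

(** * Lifting along Koszul contractions *)

Section Contraction.
Variables (A : comNzRingType) (n : nat) (t : 'I_n -> A).
Variables (sub : 'I_n -> {rmorphism A -> A}) (dd : 'I_n -> A -> A).
Hypothesis t_reg : forall i, GRing.lreg (t i).
Hypothesis t_dd : forall i f, t i * dd i f = f - sub i f.
Hypothesis sub_tt : forall i, sub i (t i) = 0.
Hypothesis sub_t : forall i j, i != j -> sub i (t j) = t j.

Lemma ddD i f g : dd i (f + g) = dd i f + dd i g.
Proof. by apply: (t_reg (i := i)); rewrite mulrDr !t_dd rmorphD opprD addrACA. Qed.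

Lemma dd0 i : dd i 0 = 0.
Proof. by apply: (t_reg (i := i)); rewrite t_dd rmorph0 subrr mulr0. Qed.

Lemma ddZ i c f : sub i c = c -> dd i (c * f) = c * dd i f.
Proof.
by move=> ci; apply: (t_reg (i := i)); rewrite mulrCA !t_dd rmorphM ci mulrBr.
Qed.

Lemma dd_tt i f : dd i (t i * f) = f.
Proof. by apply: (t_reg (i := i)); rewrite t_dd rmorphM sub_tt mul0r subr0. Qed.

Lemma dd_sum i (I : finType) (P : pred I) (F : I -> A) :
  dd i (\sum_(j | P j) F j) = \sum_(j | P j) dd i (F j).
Proof. exact: (big_morph _ (ddD i) (dd0 i)). Qed.

Notation mod := {ffun {set 'I_n} -> A}.
Notation delta := (mxact (koszul_mx (fun=> 0) t)).
Implicit Types u v : mod.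

(** The operator theta_i wedge [dd i], a contracting homotopy in the direction of [t i]. What it
    leaves over, [restr i], sets [t i] and theta_i to zero. *)
Definition creat i u : mod :=
  [ffun S : {set _} => if i \in S then sg A S i * dd i (u (flip S i)) else 0].

Definition restr i u : mod := [ffun S : {set _} => if i \in S then 0 else sub i (u S)].

Lemma sub_sg i (S : {set 'I_n}) j : sub i (sg A S j) = sg A S j.
Proof. by rewrite /sg rmorphXn rmorphN1. Qed.

(** The homotopy formula delta creat + creat delta = 1 - restr, on cycles. At [S] without [i] only
    the term of [i] survives, and it is [t i * dd i (u S)]. *)
Lemma delta_creat i u : delta u = 0 -> delta (creat i u) = u - restr i u.
Proof.
move=> du; apply/ffunP=> S; rewrite koszul_act !ffunE.
case: ifP => iS; last first.
  rewrite (bigD1 i) //= iS ffunE in_flip eqxx iS /= flipK sg_flipxx.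
  rewrite mulrAC !mulrA sgK mul1r mulrC t_dd big1 ?addr0 // => j ji.
  by rewrite ffunE in_flip eq_sym (negbTE ji) iS /= mulr0.
(* For [i] in [S], the cycle equation at [S] without [i] contains [t i * u S]. Applying [dd i]
   isolates [u S] and turns the other terms into those of [delta (creat i u)]. *)
have := congr1 (fun v : mod => v (flip S i)) du.
rewrite koszul_act [X in _ = X]ffunE (bigD1 i) //= in_flip eqxx iS /= flipK.
rewrite sg_flipxx => /(congr1 (dd i)); rewrite ddD dd_sum dd0.
rewrite -mulrA ddZ ?sub_sg // dd_tt => /eqP; rewrite addr_eq0 => /eqP usum.
rewrite subr0 -[RHS]mul1r -(sgK A S i) -mulrA usum mulrN mulr_sumr.
rewrite (bigD1 i) //= iS mulr0 mul0r add0r -sumrN.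
apply: eq_bigr => j ji; rewrite ffunE !in_flip (negbTE ji) eq_sym (negbTE ji) iS /=.
case: (j \in S); first by rewrite !mulr0 !mul0r dd0 mulr0 oppr0.
rewrite ddZ; last by rewrite rmorphM sub_sg sub_t // eq_sym.
rewrite !sg_flip flipC.
have : (-1) ^+ (j < i)%N = - (-1) ^+ (i < j)%N :> A.
  by move: ji; rewrite -val_eqE /=; case: ltngtP; rewrite //= ?expr1 ?expr0 ?opprK.
move: (dd _ _) (sg A S i) (sg A S j) ((-1) ^+ (j < i)%N) ((-1) ^+ (i < j)%N).
by move=> x y z v w ->; ring.
Qed.

Lemma delta_restr i u : delta u = 0 -> delta (restr i u) = 0.
Proof.
move=> du; have -> : restr i u = u - delta (creat i u).
  by rewrite delta_creat // opprB addrC subrK.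
rewrite mxactB du sub0r; apply/ffunP=> S; rewrite ffunE koszul_sq.
by rewrite big1 ?mul0r ?ffunE ?oppr0 // => j _; rewrite mul0r.
Qed.

(** Variables are eliminated in turn: the part of a cycle that [creat i] does not bound is
    [restr i u], again a cycle, and is handed to the remaining variables. *)
Fixpoint contr_seq (l : seq 'I_n) u : mod :=
  if l is i :: l' then creat i u + contr_seq l' (restr i u) else 0.

Definition contr : mod -> mod := contr_seq (enum 'I_n).

Lemma delta_contr_seq l u : delta u = 0 ->
  delta (contr_seq l u) =
  u - [ffun S : {set _} => if has (mem S) l then 0 else foldl (fun f i => sub i f) (u S) l].
Proof.
elim: l u => [|i l IHl] u du /=.
  rewrite mxact0; apply/ffunP=> S; by rewrite !ffunE subrr.
rewrite mxactD delta_creat // IHl ?delta_restr // addrA subrK; congr (_ - _).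
apply/ffunP=> S; rewrite !ffunE.
case: (i \in S) => //=; case: ifP => // _.
by elim: l {IHl} => //= j l IHl; rewrite rmorph0.
Qed.

Definition kdeg p u := forall S : {set _}, #|S| != p -> u S = 0.

Lemma contr_deg p u : kdeg p u -> kdeg p.+1 (contr u).
Proof.
rewrite /contr; elim: (enum _) u => [|i l IHl] u hu S hS /=; first by rewrite ffunE.
rewrite !ffunE IHl // => [|{hS} {}S hS]; last first.
  by rewrite ffunE hu // rmorph0 if_same.
rewrite addr0; case: ifP => // iS; rewrite hu ?dd0 ?mulr0 //.
apply: contraNneq hS => <-; rewrite card_flip iS (cardsD1 i S) iS.
by [].
Qed.

(** Once all variables are eliminated, only the component at [set0] with every [t i] set to zero is
    left. It is absent in positive degree and zero by hypothesis in degree zero. *)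
Lemma delta_contr p u : delta u = 0 -> kdeg p u ->
  (p = 0%N -> foldl (fun f i => sub i f) (u set0) (enum 'I_n) = 0) ->
  delta (contr u) = u.
Proof.
move=> du hu u0; rewrite delta_contr_seq //; apply/ffunP=> S; rewrite !ffunE.
case: ifP => [_|/negbT/hasPn hS]; first by rewrite subr0.
have {hS} -> : S = set0.
  by apply/setP=> i; rewrite inE; apply/negbTE/hS; rewrite mem_enum.
have [/u0 -> |p0] := eqVneq p 0%N; first by rewrite subr0.
rewrite hu ?cards0 1?eq_sym // add0r.
by rewrite -[RHS]oppr0; congr (- _); elim: (enum _) => //= i l IHl; rewrite rmorph0.
Qed.

Lemma contrD u v : contr (u + v) = contr u + contr v.
Proof.
rewrite /contr; elim: (enum _) u v => [|i l IHl] u v /=; first by rewrite addr0.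
have -> : restr i (u + v) = restr i u + restr i v.
  by apply/ffunP=> S; rewrite !ffunE; case: ifP; rewrite ?addr0 ?rmorphD.
rewrite IHl addrACA; congr (_ + _).
by apply/ffunP=> S; rewrite !ffunE; case: ifP; rewrite ?addr0 // ddD mulrDr.
Qed.

Lemma contrZ c u : (forall i, sub i c = c) ->
  contr [ffun S => c * u S] = [ffun S => c * contr u S].
Proof.
move=> hc; rewrite /contr; elim: (enum _) u => [|i l IHl] u /=.
  by apply/ffunP=> S; rewrite !ffunE mulr0.
have -> : restr i [ffun S => c * u S] = [ffun S => c * restr i u S].
  by apply/ffunP=> S; rewrite !ffunE; case: ifP; rewrite ?mulr0 ?rmorphM ?hc.
rewrite IHl; apply/ffunP=> S; rewrite !ffunE mulrDr; congr (_ + _).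
by case: ifP; rewrite ?mulr0 // ddZ ?hc // mulrCA.
Qed.

End Contraction.

Section Acyclic.
Variables (B : comNzRingType) (M N : gfree B) (U : B).
Variables (deg : gidx N -> nat) (dmax : nat) (del : gel N -> gel N).
Variable (eps0 : gel N -> Prop).

Definition gfil p (u : gel N) := forall i, (deg i < p)%N -> u i = 0.
Definition hdeg p (u : gel N) := forall i, deg i != p -> u i = 0.
Definition gcomp p (u : gel N) : gel N := [ffun i => if deg i == p then u i else 0].

Hypothesis deg_max : forall i, (deg i <= dmax)%N.
Hypothesis N_odd : gdegree true (@gdiff B N).
Hypothesis M_odd : gdegree true (@gdiff B M).
Hypothesis N_sq : forall u : gel N, gdiff (gdiff u) = gscale U u.
Hypothesis M_sq : forall u : gel M, gdiff (gdiff u) = gscale U u.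
Hypothesis rest_fil : forall p u, gfil p u -> gfil p (gdiff u - del u).
Hypothesis del_comp : forall p u, gfil p u -> gfil p (del u) -> del (gcomp p u) = 0.
Hypothesis lift : forall p q (E : gel M -> gel N),
  glinear E -> gdegree q E -> (forall u, hdeg p (E u)) ->
  (forall u, del (E u) = 0) -> (p = 0%N -> forall u, eps0 (E u)) ->
  exists H : gel M -> gel N, [/\ glinear H, gdegree (~~ q) H,
    forall u, hdeg p.+1 (H u) & forall u, del (H u) = E u].

(** The Koszul sign of the differential passing a map of parity [q], so that even chain maps and odd
    ones are lifted by one statement. *)
Definition gsgn (P : gfree B) (q : bool) (u : gel P) : gel P := if q then - u else u.

Lemma gsgn_lin (P Q : gfree B) q (f : gel P -> gel Q) :
  glinear f -> glinear (fun u => gsgn q (f u)).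
Proof. by case: q => // f_lin; exact: glin_opp. Qed.

Lemma fil_hom p q u : (p <= q)%N -> hdeg q u -> gfil p u.
Proof. by move=> le_pq hu i lt_ip; rewrite hu // neq_ltn (leq_trans lt_ip le_pq). Qed.

Lemma filB p u v : gfil p u -> gfil p v -> gfil p (u - v).
Proof. by move=> hu hv i ip; rewrite !ffunE hu // hv // subrr. Qed.

Lemma fil_gsgn p q u : gfil p u -> gfil p (gsgn q u).
Proof. by case: q => //= hu i ip; rewrite ffunE hu // oppr0. Qed.

(** Obstruction theory along the filtration by [deg]. The lowest component of [E] is a [del]-cycle,
    hence equals [del H] with [H] one degree higher; subtracting the boundary of [H] raises the
    filtration of [E] by one. After [dmax.+1] rounds nothing is left. All corrections live in
    positive degree, so the total [H] vanishes in degree zero. *)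
Lemma acyclic_lift q (E : gel M -> gel N) :
  glinear E -> gdegree q E ->
  (forall u, gdiff (E u) = gsgn q (E (gdiff u))) ->
  (forall u, eps0 (gcomp 0 (E u))) ->
  exists H : gel M -> gel N, [/\ glinear H, gdegree (~~ q) H,
    forall u i, deg i = 0%N -> H u i = 0 &
    forall u, E u = gdiff (H u) + gsgn q (H (gdiff u))].
Proof.
move=> E_lin E_deg E_cl E_eps.
suff {E E_lin E_deg E_cl E_eps} main c p E : (p + c = dmax.+1)%N ->
    glinear E -> gdegree q E -> (forall u, gfil p (E u)) ->
    (forall u, gdiff (E u) = gsgn q (E (gdiff u))) ->
    (p = 0%N -> forall u, eps0 (gcomp 0 (E u))) ->
    exists H : gel M -> gel N, [/\ glinear H, gdegree (~~ q) H,
      forall u i, deg i = 0%N -> H u i = 0 &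
      forall u, E u = gdiff (H u) + gsgn q (H (gdiff u))].
  by apply: (main dmax.+1 0%N).
elim: c p E => [|c IHc] p E pc E_lin E_deg E_fil E_cl E_eps.
  exists (fun=> 0); split=> [b u v|r u _ i _|u i _|u].
  - by rewrite gscale0 addr0.
  - by rewrite ffunE.
  - by rewrite ffunE.
  - apply/ffunP=> i; rewrite E_fil; last by rewrite -(addn0 p) pc ltnS.
    by rewrite (glin0 (@glin_gdiff _ _)) /gsgn; case: (q); rewrite ?oppr0 addr0 ffunE.
pose F u := gcomp p (E u).
have F_lin : glinear F.
  move=> b u v; apply/ffunP=> i; rewrite /F E_lin !ffunE.
  by case: ifP; rewrite ?mulr0 ?addr0.
have F_deg : gdegree q F.
  by move=> r u hu i ir; rewrite ffunE (E_deg _ _ hu) ?if_same.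
have del_E u : gfil p (del (E u)).
  have -> : del (E u) = gdiff (E u) - (gdiff (E u) - del (E u)).
    by rewrite opprB addrC subrK.
  by apply: filB; [rewrite E_cl; exact: fil_gsgn | exact: rest_fil].
have [|||H [H_lin H_deg H_hom H_del]] := lift F_lin F_deg (p := p).
- by move=> u i ip; rewrite ffunE (negbTE ip).
- by move=> u; exact: del_comp.
- by move=> p0 u; rewrite /F p0; exact: E_eps.
(* [del (H u)] cancels the component of degree [p]. Both the rest of [gdiff (H u)] and [H (gdiff u)]
   lie in filtration [p.+1]. *)
pose E' u := E u - (gdiff (H u) + gsgn q (H (gdiff u))).
have D_lin : glinear (fun u => gdiff (H u) + gsgn q (H (gdiff u))).
  apply: glin_add; first by apply: (glin_comp _ H_lin); exact: glin_gdiff.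
  by apply: gsgn_lin; apply: (glin_comp H_lin); exact: glin_gdiff.
have [||||||H' [H'_lin H'_deg H'_0 H'_E]] := IHc p.+1 E'.
- by rewrite addSnnS.
- exact: glin_sub.
- apply: gdeg_add => //; apply: gdeg_opp; apply: gdeg_add.
    by have := gdeg_comp N_odd H_deg; rewrite addTb negbK.
  have Hd : gdegree q (fun u => H (gdiff u)).
    by have := gdeg_comp H_deg M_odd; rewrite addbT negbK.
  by rewrite /gsgn; case: (q) Hd => //; exact: gdeg_opp.
- have fB (v w : gel N) i : (v - w) i = v i - w i by rewrite !ffunE.
  have fD (v w : gel N) i : (v + w) i = v i + w i by rewrite ffunE.
  move=> u i; rewrite ltnS leq_eqVlt /E' fB fD => /orP[/eqP ip|ip].
    have -> : gsgn q (H (gdiff u)) i = 0.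
      by rewrite (@fil_gsgn p.+1) //; [exact: fil_hom (H_hom _) | rewrite ip].
    have := @rest_fil p.+1 (H u) (fil_hom (leqnn _) (H_hom u)) i.
    rewrite ip ltnSn => /(_ isT); rewrite fB H_del [F u i]ffunE ip eqxx.
    by rewrite addr0 => /eqP; rewrite subr_eq0 => /eqP ->; rewrite subrr.
  have -> : gsgn q (H (gdiff u)) i = 0.
    by apply: (@fil_gsgn p.+1); [exact: fil_hom (H_hom _) | exact: ltnW].
  have -> : gdiff (H u) i = 0.
    have := @rest_fil p (H u) (fil_hom (leqnSn _) (H_hom u)) i ip.
    by rewrite fB H_del [F u i]ffunE (ltn_eqF ip) subr0.
  by rewrite E_fil // addr0 subrr.
- move=> u; rewrite /E' (glinB (@glin_gdiff _ _)) E_cl (glinD (@glin_gdiff _ _)).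
  rewrite N_sq M_sq (glinZ H_lin) /gsgn; case: (q); last first.
    by rewrite [X in _ - X]addrC.
  by rewrite (glinN (@glin_gdiff _ _)) !opprD !opprK; congr (_ + _); rewrite addrC.
- by [].
exists (fun u => H u + H' u); split.
- exact: glin_add.
- exact: gdeg_add.
- by move=> u i i0; rewrite ffunE H'_0 // H_hom ?i0 // addr0.
- move=> u; have := H'_E u; rewrite /E' => /eqP; rewrite subr_eq => /eqP ->.
  rewrite (glinD (@glin_gdiff _ _)) addrC addrACA; congr (_ + _).
  by rewrite /gsgn; case: (q); rewrite ?opprD.
Qed.

End Acyclic.

Section Elimination.
Variables (k : comNzRingType) (a N : nat) (e y : 'I_a -> 'I_N) (b : bool).
Hypothesis e_inj : injective e.
Hypothesis ye : forall i j, y i != e j.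

(** [e i] is eliminated in favour of [y i]. The Koszul entry is always unprimed minus primed, so [b]
    is true when the primed variable is eliminated and false when the unprimed one is. *)
Definition elim_t (i : 'I_a) : {mpoly k[N]} := (-1) ^+ b * ('X_(e i) - 'X_(y i)).

Definition elim_pt (i : 'I_a) (v : 'I_N) : {mpoly k[N]} :=
  if v == e i then 'X_(y i) else 'X_v.

Definition elim_sub (i : 'I_a) : {rmorphism {mpoly k[N]} -> {mpoly k[N]}} :=
  msub (elim_pt i).

Definition elim_dd (i : 'I_a) (f : {mpoly k[N]}) : {mpoly k[N]} :=
  (-1) ^+ b * ddiff (fun v => 'X_v) (elim_pt i) (e i) f.

Lemma elim_subX i v : elim_sub i 'X_v = if v == e i then 'X_(y i) else 'X_v.
Proof. exact: msubX. Qed.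

Lemma elim_sub_sgn i (c : bool) : elim_sub i ((-1) ^+ c) = (-1) ^+ c.
Proof. by rewrite rmorphXn rmorphN1. Qed.

Lemma elim_t_reg i : GRing.lreg (elim_t i).
Proof.
apply: lregM; first exact: lreg_sign.
by apply: lreg_subX; rewrite eq_sym ye.
Qed.

Lemma elim_t_dd i f : elim_t i * elim_dd i f = f - elim_sub i f.
Proof.
rewrite /elim_t /elim_dd mulrACA -signr_addb addbb mul1r.
have := ddiffP (fun v => 'X_v) (elim_pt i) (e i) f.
have -> : elim_pt i (e i) = 'X_(y i) by rewrite /elim_pt eqxx.
move=> ->; congr (_ - _); last first.
  apply: eq_msub => v; rewrite /mixed /elim_pt -val_eqE /= ltnS leq_eqVlt.
  by case: (ltngtP v (e i)).
apply: (@msub_id k N) => v; rewrite /mixed /elim_pt -val_eqE /=.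
by case: (ltngtP v (e i)).
Qed.

Lemma elim_sub_tt i : elim_sub i (elim_t i) = 0.
Proof.
rewrite rmorphM rmorphB !elim_subX eqxx (negbTE (ye i i)) subrr.
exact: mulr0.
Qed.

Lemma elim_sub_t i j : i != j -> elim_sub i (elim_t j) = elim_t j.
Proof.
move=> ij; rewrite rmorphM rmorphB elim_sub_sgn !elim_subX (negbTE (ye _ _)).
by rewrite (inj_eq e_inj) eq_sym (negbTE ij).
Qed.

(** Successive eliminations compose to a single substitution, which agrees on variables with [g]
    followed by its section [s]. Hence whatever [g] kills is killed by the eliminations. *)
Lemma elim_fold_eq0 M (g : 'I_N -> {mpoly k[M]}) (s : 'I_M -> {mpoly k[N]}) f :
  (forall v, (forall i, v != e i) -> msub s (g v) = 'X_v) ->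
  (forall i, msub s (g (e i)) = 'X_(y i)) ->
  msub g f = 0 -> foldl (fun f i => elim_sub i f) f (enum 'I_a) = 0.
Proof.
move=> sgX sge gf0.
have [h hP] : exists h, forall f,
    foldl (fun f i => elim_sub i f) f (enum 'I_a) = msub h f.
  elim: (enum 'I_a) => [|i l [h hP]] /=.
    by exists (fun v => 'X_v) => f'; rewrite (msub_id (fun=> erefl)).
  by exists (fun v => msub h (elim_pt i v)) => f'; rewrite hP msub_comp.
suff -> : foldl (fun f i => elim_sub i f) f (enum 'I_a) = msub s (msub g f).
  by rewrite gf0 rmorph0.
rewrite hP msub_comp; apply: eq_msub => v; rewrite -(msubX h) -hP.
have fixed l w : (forall i, w != e i) ->
    foldl (fun f i => elim_sub i f) 'X_w l = 'X_w.
  by move=> we; elim: l => //= i l IHl; rewrite -/(elim_sub i) elim_subX (negbTE (we i)).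
have [/existsP[i /eqP ->]|/existsPn ve] := boolP [exists i, v == e i]; last first.
  by rewrite fixed // sgX.
rewrite sge; have : i \in enum 'I_a by rewrite mem_enum.
elim: (enum _) => //= j l IHl; rewrite inE -/(elim_sub j) elim_subX (inj_eq e_inj).
by case: eqP => [-> _|_ /=]; [apply: fixed | exact: IHl].
Qed.

End Elimination.

Section KoszulModule.
Variables (k : comNzRingType) (a L : nat) (e y : 'I_a -> 'I_L) (b : bool).
Hypothesis e_inj : injective e.
Hypothesis ye : forall i j, y i != e j.
Variables (B : comNzRingType) (K I : finType).
Variables (act : {rmorphism B -> {mpoly k[L]}}) (par : K -> bool)
  (dm : K -> K -> {mpoly k[L]}).
Let N : gfree B := GFree act par dm.

(* The basis of [N] is identified with pairs of an exterior monomial [th] and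
   an index [ix]; the two orders of the factors of a tensor product, and the
   Koszul complex itself, are instances. *)
Variables (th : K -> {set 'I_a}) (ix : K -> I) (mk : {set 'I_a} -> I -> K).
Variables (q s : I -> bool).
Hypothesis th_mk : forall T i, th (mk T i) = T.
Hypothesis ix_mk : forall T i, ix (mk T i) = i.
Hypothesis mk_th : forall x, mk (th x) (ix x) = x.
Hypothesis parE : forall x, par x = odd #|th x| (+) q (ix x).

Let t := elim_t k e y b.
Let t_reg i : GRing.lreg (t i). Proof. exact: elim_t_reg. Qed.
Let t_dd i f : t i * elim_dd e y b i f = f - elim_sub k e y i f.
Proof. exact: elim_t_dd. Qed.
Let sub_tt i : elim_sub k e y i (t i) = 0. Proof. exact: elim_sub_tt. Qed.
Let sub_t i j : i != j -> elim_sub k e y i (t j) = t j.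
Proof. exact: elim_sub_t. Qed.
Let delta := @mxact {mpoly k[L]} _ _ (koszul_mx (fun=> 0) t).
Let ctr := contr (elim_sub k e y) (elim_dd e y b).

Definition slice (u : gel N) i : {ffun {set 'I_a} -> {mpoly k[L]}} :=
  [ffun T => u (mk T i)].

(** [s] carries the Koszul sign met by the exterior differential when the exterior factor stands
    second, as in X (x) Delta_W; it is constantly false when that factor stands first. *)
Definition kdel (u : gel N) : gel N :=
  [ffun x => (-1) ^+ s (ix x) * delta (slice u (ix x)) (th x)].

Definition kctr (u : gel N) : gel N :=
  [ffun x => (-1) ^+ s (ix x) * ctr (slice u (ix x)) (th x)].

Let deg (x : gidx N) := #|th x|.

Variables (M : nat) (g : 'I_L -> {mpoly k[M]}) (sec : 'I_M -> {mpoly k[L]}).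
Hypothesis secX : forall v, (forall i, v != e i) -> msub sec (g v) = 'X_v.
Hypothesis sece : forall i, msub sec (g (e i)) = 'X_(y i).

Definition keps0 (u : gel N) : Prop := forall i, msub g (u (mk set0 i)) = 0.

Lemma slice_kctr u i : slice (kctr u) i =
  [ffun T => (-1) ^+ s i * ctr (slice u i) T].
Proof. by apply/ffunP=> T; rewrite !ffunE ix_mk th_mk. Qed.

Lemma sliceD u v i : slice (u + v) i = slice u i + slice v i.
Proof. by apply/ffunP=> T; rewrite !ffunE. Qed.

Let ctr0 : ctr 0 = 0.
Proof.
have := contrD t_reg t_dd 0 0; rewrite addr0 => ctr00.
by apply: (addrI (ctr 0)); rewrite addr0 /ctr -ctr00.
Qed.

Lemma kctrD u v : kctr (u + v) = kctr u + kctr v.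
Proof.
apply/ffunP=> x; rewrite !ffunE sliceD.
by rewrite /ctr (contrD t_reg t_dd) ffunE mulrDr.
Qed.

Lemma kctrZ c u : (forall i, elim_sub k e y i (act c) = act c) ->
  kctr (gscale c u) = gscale c (kctr u).
Proof.
move=> hc; apply/ffunP=> x; rewrite !ffunE mulrCA; congr (_ * _).
have -> : slice (gscale c u) (ix x) = [ffun T => act c * slice u (ix x) T].
  by apply/ffunP=> T; rewrite !ffunE.
by rewrite /ctr (contrZ t_reg t_dd) ?ffunE.
Qed.

Lemma kctr_hom p u : hdeg deg p u -> hdeg deg p.+1 (kctr u).
Proof.
move=> hu x xp; rewrite ffunE /ctr.
rewrite (contr_deg t_reg t_dd (p := p)) ?mulr0 // => T Tp.
by rewrite ffunE hu // /deg th_mk.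
Qed.

Lemma kctr_par p r u : hdeg deg p u -> ghomog r u -> ghomog (~~ r) (kctr u).
Proof.
move=> hu ru x; have [xp|/(kctr_hom hu) //] := eqVneq (deg x) p.+1.
rewrite /= parE -/(deg x) xp /= => xr; rewrite ffunE.
suff -> : slice u (ix x) = 0 by rewrite ctr0 ffunE mulr0.
apply/ffunP=> T; rewrite !ffunE.
have [Tp|Tp] := eqVneq #|T| p; last by rewrite hu // /deg th_mk.
rewrite ru //= parE th_mk ix_mk Tp.
by apply: contraNneq xr => <-; rewrite addNb.
Qed.

Lemma kdel_kctr p u : hdeg deg p u -> kdel u = 0 -> (p = 0%N -> keps0 u) ->
  kdel (kctr u) = u.
Proof.
move=> hu du u0; apply/ffunP=> x; rewrite ffunE slice_kctr.
rewrite /delta mxactZ ffunE mulrA -signr_addb addbb mul1r.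
rewrite (@delta_contr _ _ _ _ _ t_reg t_dd
  sub_tt sub_t p).
- by rewrite ffunE mk_th.
- apply/ffunP=> T; have : kdel u (mk T (ix x)) = 0 by rewrite du ffunE.
  rewrite [kdel _ _]ffunE ix_mk th_mk => /(congr1 (fun f => (-1) ^+ s (ix x) * f)).
  by rewrite mulr0 mulrA -signr_addb addbb mul1r => ->; rewrite ffunE.
- by move=> T Tp; rewrite ffunE hu // /deg th_mk.
- move=> /u0 /(_ (ix x)); rewrite ffunE.
  exact: (elim_fold_eq0 e_inj ye secX sece).
Qed.

(** [kdel] lowers the degree by exactly one, so the component of [kdel u] in degree [p - 1] depends
    on the component of [u] in degree [p] alone. *)
Lemma kdel_comp p u : gfil deg p u -> gfil deg p (kdel u) -> kdel (gcomp deg p u) = 0.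
Proof.
move=> hu hdu; apply/ffunP=> x; rewrite ffunE [RHS]ffunE /delta koszul_act.
have [xp|xp] := eqVneq (deg x).+1 p.
  have := hdu x; rewrite -xp ltnSn => /(_ isT); rewrite ffunE /delta koszul_act.
  move=> h0; rewrite -[RHS]h0; congr (_ * _); apply: eq_bigr => i _.
  rewrite !ffunE /deg th_mk.
  case: ifP => iT; first by rewrite !mulr0 !mul0r.
  by rewrite card_flip iT eqxx.
rewrite big1 ?mulr0 // => i _; rewrite !ffunE /deg th_mk.
case: ifP => iT; first by rewrite mulr0 mul0r.
by rewrite card_flip iT (negbTE xp) mulr0.
Qed.

Lemma glin_kdel : glinear kdel.
Proof.
move=> c u v; apply/ffunP=> x; rewrite [RHS]ffunE gscaleE ![kdel _ _]ffunE.
have -> : slice (gscale c u + v) (ix x) =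
    [ffun T => act c * slice u (ix x) T] + slice v (ix x).
  by apply/ffunP=> T; rewrite !ffunE.
by rewrite /delta mxactD mxactZ ffunE [X in _ * (X + _)]ffunE mulrDr mulrCA.
Qed.

Hypothesis N_odd : gdegree true (@gdiff B N).
Variable U : B.
Hypothesis N_sq : forall u : gel N, gdiff (gdiff u) = gscale U u.
Hypothesis rest_fil : forall p u, gfil deg p u -> gfil deg p (gdiff u - kdel u).

(* [P] need not be free over [B] when the contraction is [B]-linear, and the
   contraction need not be [B]-linear when [P] is free of finite rank. *)
Lemma koszul_lift (P : gfree B) r (E : gel P -> gel N) :
  (forall i c, elim_sub k e y i (act c) = act c) \/
    (exists (J : finType) (pJ : J -> bool) (dJ : J -> J -> B), P = GFree idfun pJ dJ) ->
  gdegree true (@gdiff B P) -> (forall u : gel P, gdiff (gdiff u) = gscale U u) ->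
  glinear E -> gdegree r E ->
  (forall u, gdiff (E u) = gsgn r (E (gdiff u))) ->
  (forall u i, msub g (E u (mk set0 i)) = 0) ->
  exists H : gel P -> gel N, [/\ glinear H, gdegree (~~ r) H,
    forall u i, H u (mk set0 i) = 0 &
    forall u, E u = gdiff (H u) + gsgn r (H (gdiff u))].
Proof.
move=> hP P_odd P_sq E_lin E_deg E_cl E_eps.
have [||||H [H_lin H_deg H_0 H_E]] := @acyclic_lift B P N U deg a kdel keps0
    _ N_odd P_odd N_sq P_sq rest_fil _ _ r E E_lin E_deg E_cl.
- by move=> x; rewrite -[X in (_ <= X)%N]card_ord max_card.
- by move=> p u; exact: kdel_comp.
- move=> p r' F F_lin F_deg F_hom F_del F_eps.
  have kdF u : kdel (kctr (F u)) = F u.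
    by apply: (kdel_kctr (F_hom u)) => // p0; exact: F_eps.
  case: hP => [hact|[J [pJ [dJ eP]]]].
    exists (kctr \o F); split=> [c u v|r'' u hu|u|u] //=.
    + by rewrite F_lin kctrD kctrZ.
    + by rewrite addNb; apply: (kctr_par (F_hom u)); exact: F_deg.
    + exact: kctr_hom.
  (* Here [kctr] need not be linear over the base ring, so it is applied to the images of basis
     vectors only and the result is extended linearly. *)
  subst P; pose bas j : gel (GFree idfun pJ dJ) := [ffun j' => (j' == j)%:R].
  pose H := gext (p := pJ) (d := dJ) (fun j => kctr (F (bas j))).
  exists H; split.
  + exact: glin_gext.
  + apply: gdeg_gext => j; rewrite addNb.
    by apply: (kctr_par (F_hom _)); apply: F_deg; exact: ghomog_basis.
  + move=> u x xp; rewrite sum_ffunE big1 // => j _.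
    by rewrite gscaleE (kctr_hom (F_hom _)) ?mulr0.
  + move=> u; rewrite (glin_sum glin_kdel) (glin_basis u F_lin).
    by apply: eq_bigr => j _; rewrite (glinZ glin_kdel) kdF.
- by move=> u i; rewrite ffunE /deg th_mk cards0 eqxx E_eps.
by exists H; split=> // u i; apply: H_0; rewrite /deg th_mk cards0.
Qed.

End KoszulModule.

Section UnitorInverse.
Variables (k : comNzRingType) (a L M : nat) (e y : 'I_a -> 'I_L) (b : bool).
Hypothesis e_inj : injective e.
Hypothesis ye : forall i j, y i != e j.
Variables (g : 'I_L -> {mpoly k[M]}) (sec : 'I_M -> {mpoly k[L]}).
Hypothesis gsec : forall w, msub g (sec w) = 'X_w.
Hypothesis secX : forall v, (forall i, v != e i) -> msub sec (g v) = 'X_v.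
Hypothesis sece : forall i, msub sec (g (e i)) = 'X_(y i).
Hypothesis sec_fix : forall i w, elim_sub k e y i (sec w) = sec w.
Variables (K I : finType) (par : K -> bool) (dm : K -> K -> {mpoly k[L]}).
Let N : gfree {mpoly k[M]} := GFree (msub sec) par dm.
Variables (th : K -> {set 'I_a}) (ix : K -> I) (mk : {set 'I_a} -> I -> K).
Variables (s q : I -> bool) (dX : I -> I -> {mpoly k[M]}).
Hypothesis th_mk : forall T i, th (mk T i) = T.
Hypothesis ix_mk : forall T i, ix (mk T i) = i.
Hypothesis mk_th : forall x, mk (th x) (ix x) = x.
Hypothesis parE : forall x, par x = odd #|th x| (+) q (ix x).
Let X : gfree {mpoly k[M]} := GFree idfun q dX.
Variable U : {mpoly k[M]}.
Hypothesis N_odd : gdegree true (@gdiff _ N).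
Hypothesis X_odd : gdegree true (@gdiff _ X).
Hypothesis N_sq : forall u : gel N, gdiff (gdiff u) = gscale U u.
Hypothesis X_sq : forall u : gel X, gdiff (gdiff u) = gscale U u.

Let deg (x : gidx N) := #|th x|.
Let kd (u : gel N) : gel N :=
  @kdel k a L e y b {mpoly k[M]} K I (msub sec) par dm th ix mk s u.
Hypothesis rest_fil : forall p u, gfil deg p u -> gfil deg p (gdiff u - kd u).

Definition kunitor (u : gel N) : gel X := [ffun i => msub g (u (mk set0 i))].

Hypothesis unitor_gdiff : forall u, kunitor (gdiff u) = gdiff (kunitor u).

Let msub_gsec c : msub g (msub sec c) = c.
Proof. by rewrite msub_comp msub_id. Qed.

Lemma kunitor_mor : gmor kunitor.
Proof.
split=> [c u v|p u hu i ip|//]; last first.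
  by rewrite ffunE hu ?rmorph0 //= parE th_mk ix_mk cards0.
by apply/ffunP=> i; rewrite !ffunE rmorphD rmorphM msub_gsec.
Qed.

(** Base variables act through [sec], which avoids the eliminated variables; the contraction is
    therefore linear over the base ring. *)
Let sec_elim i c : elim_sub k e y i (msub sec c) = msub sec c.
Proof. by rewrite /elim_sub msub_comp; apply: eq_msub => w; exact: sec_fix. Qed.

Let lift := fun P r E hP => @koszul_lift k a L e y b e_inj ye {mpoly k[M]} K I
  (msub sec) par dm th ix mk q s th_mk ix_mk mk_th parE M g sec secX sece N_odd
  U N_sq rest_fil P r E (or_introl hP).

(** The evident section [L0] is not a chain map, but its failure [E0] dies under the unitor and so
    lifts to a correction [H]. The same lifting, applied to [linv] after the unitor minus the
    identity, gives the second homotopy. *)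
Lemma kunitor_inverse : exists linv : gel X -> gel N, hinverse kunitor linv.
Proof.
have [u_lin u_deg _] := kunitor_mor.
pose L0 (u : gel X) : gel N :=
  [ffun x => if th x == set0 then msub sec (u (ix x)) else 0].
have L0_lin : glinear L0.
  move=> c u v; apply/ffunP=> x; rewrite !ffunE; case: ifP => _.
    by rewrite rmorphD rmorphM.
  by rewrite mulr0 addr0.
have L0_deg : gdegree false L0.
  move=> p u hu x xp; rewrite ffunE; case: eqP => // x0.
  by rewrite hu ?rmorph0 //; rewrite /= parE x0 cards0 in xp.
have uL0 u : kunitor (L0 u) = u.
  by apply/ffunP=> i; rewrite !ffunE th_mk eqxx ix_mk msub_gsec.
pose E0 u := gdiff (L0 u) - L0 (gdiff u).
have [||||||H [H_lin H_deg H_0 H_E]] := lift (P := X) (r := true) (E := E0) sec_elim.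
- exact: X_odd.
- exact: X_sq.
- apply: glin_sub; first by apply: (glin_comp _ L0_lin); exact: glin_gdiff.
  by apply: (glin_comp L0_lin); exact: glin_gdiff.
- apply: gdeg_add; first by have := gdeg_comp N_odd L0_deg.
  by apply: gdeg_opp; have := gdeg_comp L0_deg X_odd.
- move=> u; rewrite /E0 /= (glinB (@glin_gdiff _ _)) N_sq X_sq (glinZ L0_lin).
  by rewrite opprB.
- move=> u i; have : kunitor (E0 u) i = 0.
    by rewrite /E0 (glinB u_lin) unitor_gdiff !uL0 subrr ffunE.
  by rewrite ffunE.
pose linv u := L0 u - H u.
have linv_lin : glinear linv by exact: glin_sub.
have linv_deg : gdegree false linv.
  by apply: gdeg_add => //; exact: gdeg_opp.
have linv_d u : linv (gdiff u) = gdiff (linv u).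
  have := H_E u; rewrite /E0 /linv (glinB (@glin_gdiff _ _)) /= => /eqP.
  rewrite subr_eq => /eqP ->.
  by rewrite (addrC (gdiff (H u))) addrAC addrK addrC.
(* [H] has no component at [set0], so the correction is invisible to the unitor and [linv] is a
   strict right inverse. *)
have uH u : kunitor (H u) = 0.
  by apply/ffunP=> i; rewrite !ffunE H_0 rmorph0.
have ulinv u : kunitor (linv u) = u.
  by rewrite /linv (glinB u_lin) uL0 uH subr0.
have linv_mor : gmor linv by [].
exists linv; split; [exact: kunitor_mor | by [] | |].
  by apply: eq_homotopic => u; exact: ulinv.
pose G u := linv (kunitor u) - u.
have id_lin : glinear (@id (gel N)) by [].
have [||||||H' [H'_lin H'_deg H'_0 H'_E]] := lift (P := N) (r := false) (E := G) sec_elim.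
- exact: N_odd.
- exact: N_sq.
- by apply: glin_sub => //; exact: (glin_comp linv_lin u_lin).
- apply: gdeg_add; first by have := gdeg_comp linv_deg u_deg.
  by apply: gdeg_opp => p' u'; rewrite addFb.
- by move=> u; rewrite /G /= (glinB (@glin_gdiff _ _)) -linv_d unitor_gdiff.
- move=> u i; have : kunitor (G u) i = 0.
    by rewrite /G (glinB u_lin) ulinv subrr ffunE.
  by rewrite ffunE.
by exists H'; split.
Qed.

End UnitorInverse.

(** * Homotopy inverses of the unitors *)

Section Tensor.
Variables (A : comNzRingType) (I J : finType) (p : I -> bool) (q : J -> bool).
Variables (d : I -> I -> A) (d' : J -> J -> A).

Lemma tens_act (u : {ffun I * J -> A}) i j :
  mxact (tens_dmx p d d') u (i, j) =
  \sum_i' d i i' * u (i', j) + (-1) ^+ p i * \sum_j' d' j j' * u (i, j').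
Proof.
rewrite ffunE (eq_bigr (fun x : I * J => (d i x.1 * u (x.1, j)) * (j == x.2)%:R +
    (i == x.1)%:R * ((-1) ^+ p i * (d' j x.2 * u (i, x.2))))); last first.
  case=> i' j' _ /=; rewrite /tens_dmx /= mulrDl; congr (_ + _).
    by rewrite mulrAC; case: eqP => [->|_] //; rewrite !mulr0.
  by case: eqP => [->|_]; rewrite /= ?mulr1 ?mul1r ?mulr0 ?mul0r ?mulrA.
rewrite big_split /=; congr (_ + _).
  rewrite -(pair_bigA _ (fun i' j' => d i i' * u (i', j) * (j == j')%:R)) /=.
  apply: eq_bigr => i' _; rewrite -[RHS](sum_deltal j (fun=> d i i' * u (i', j))).
  by apply: eq_bigr => j' _; rewrite mulrC.
rewrite -(pair_bigA _ (fun i' j' => (i == i')%:R * ((-1) ^+ p i * (d' j j' * u (i, j'))))) /=.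
rewrite exchange_big mulr_sumr; apply: eq_bigr => j' _.
by rewrite (sum_deltal i (fun=> (-1) ^+ p i * (d' j j' * u (i, j')))).
Qed.

Hypothesis d_odd : forall i i', p i = p i' -> d i i' = 0.
Hypothesis d'_odd : forall j j', q j = q j' -> d' j j' = 0.

Lemma tens_odd x x' :
  tens_par p q x = tens_par p q x' -> tens_dmx p d d' x x' = 0.
Proof.
case: x x' => i j [i' j']; rewrite /tens_par /tens_dmx /= => e.
have -> : d i i' * (j == j')%:R = 0.
  by case: (j =P j') e => [->|_]; rewrite ?mulr0 // mulr1 => /addIb /d_odd.
have [ii'|_] := eqVneq i i'; last by rewrite mulr0 mul0r addr0.
by rewrite d'_odd ?mulr0 ?addr0 //; move: e; rewrite ii' => /addbI.
Qed.

Variables (c c' : A).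
Hypothesis d_sq : forall v i, mxact d (mxact d v) i = c * v i.
Hypothesis d'_sq : forall v j, mxact d' (mxact d' v) j = c' * v j.

(** The mixed terms cancel: [d] changes the parity of the first index, so the sign of the second
    differential is reversed between the two orders of composition. *)
Lemma tens_sq u x :
  mxact (tens_dmx p d d') (mxact (tens_dmx p d d') u) x = (c + c') * u x.
Proof.
case: x => i j; rewrite tens_act.
under eq_bigr do rewrite tens_act mulrDr.
under [X in _ + _ * X]eq_bigr do rewrite tens_act mulrDr.
rewrite !big_split /= mulrDr [X in _ + X]addrC addrACA mulrDl.
have -> : \sum_i' d i i' * (\sum_i'' d i' i'' * u (i'', j)) = c * u (i, j).
  have := d_sq [ffun i' => u (i', j)] i; rewrite !ffunE => <-.
  by apply: eq_bigr => i' _; rewrite !ffunE; congr (_ * _); apply: eq_bigr => i'' _; rewrite ffunE.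
have -> : (-1) ^+ p i * (\sum_j' d' j j' * ((-1) ^+ p i *
    \sum_j'' d' j' j'' * u (i, j''))) = c' * u (i, j).
  have := d'_sq [ffun j' => u (i, j')] j; rewrite !ffunE => <-.
  rewrite mulr_sumr; apply: eq_bigr => j' _.
  rewrite mulrCA mulrA mulrA -mulrA -(mulrA (d' j j')) [X in _ * X]mulrA -signr_addb addbb mul1r.
  by rewrite !ffunE; congr (_ * _); apply: eq_bigr => j'' _; rewrite ffunE.
rewrite [X in _ + X](_ : _ = 0) ?addr0 //.
rewrite (eq_bigr (fun i' => \sum_j' - (-1) ^+ p i * (d i i' * (d' j j' * u (i', j'))))).
  rewrite exchange_big [X in _ + X]mulr_sumr -big_split big1 //= => j' _.
  rewrite mulr_sumr mulr_sumr -big_split big1 //= => i' _.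
  by rewrite mulNr (mulrCA (d' j j')) addNr.
move=> i' _; have [e|ne] := eqVneq (p i) (p i').
  by rewrite d_odd // mul0r big1 // => j' _; rewrite mul0r mulr0.
have -> : (-1) ^+ p i' = - (-1) ^+ p i :> A.
  by case: (p i) (p i') ne => [] [] //=; rewrite ?expr1 ?expr0 ?opprK.
rewrite !mulr_sumr; apply: eq_bigr => j' _.
by rewrite mulrCA.
Qed.

End Tensor.
Lemma ffunB (I : finType) (A : zmodType) (u v : {ffun I -> A}) i :
  (u - v) i = u i - v i.
Proof. by rewrite !ffunE. Qed.

Section KoszulFacts.
Variables (A : comNzRingType) (n : nat).

Lemma koszul_odd (a b : 'I_n -> A) (T S : {set 'I_n}) :
  theta_par T = theta_par S -> koszul_mx a b T S = 0.
Proof.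
rewrite /theta_par koszul_mxE => TS; rewrite big1 // => i _; case: eqP => // e.
by move: TS; rewrite e odd_flip; case: (odd _).
Qed.

Lemma rmorph_koszul (A' : comNzRingType) (f : {rmorphism A -> A'}) (a b : 'I_n -> A) T S :
  f (koszul_mx a b T S) = koszul_mx (fun i => f (a i)) (fun i => f (b i)) T S.
Proof.
rewrite !koszul_mxE rmorph_sum; apply: eq_bigr => i _.
case: ifP => _; last exact: rmorph0.
by rewrite rmorphM /sg rmorphXn rmorphN1; case: ifP.
Qed.

Lemma eq_koszul (a b a' b' : 'I_n -> A) T S :
  a =1 a' -> b =1 b' -> koszul_mx a b T S = koszul_mx a' b' T S.
Proof.
by move=> ea eb; rewrite !koszul_mxE; apply: eq_bigr => i _; rewrite ea eb.
Qed.

(** The entries [a i] raise the exterior degree, so below degree [p] they only see components of [v]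
    that vanish. *)
Lemma koszul_rest (a b : 'I_n -> A) (v : {ffun {set 'I_n} -> A}) p (T : {set 'I_n}) :
  (forall S : {set 'I_n}, (#|S| < p)%N -> v S = 0) -> (#|T| < p)%N ->
  mxact (koszul_mx a b) v T - mxact (koszul_mx (fun=> 0) b) v T = 0.
Proof.
move=> hv hT; rewrite !koszul_act -sumrB big1 // => i _.
case: ifP => iT; last by rewrite subrr.
by rewrite hv ?mulr0 ?subrr // card_flip iT (leq_ltn_trans (leq_pred _) hT).
Qed.

End KoszulFacts.

Section UnitFacts.
Variables (k : comNzRingType) (n : nat) (W : {mpoly k[n]}).

Lemma sum_ddiff (a b : nat) (u u' : 'I_a -> {mpoly k[b]}) (f : {mpoly k[a]}) :
  \sum_v ddiff u u' v f * (u v - u' v) = msub u f - msub u' f.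
Proof.
pose F c := msub (mixed u u' c) f.
rewrite (eq_bigr (fun v : 'I_a => F v - F v.+1)) => [|v _]; last first.
  by rewrite mulrC ddiffP.
rewrite -(big_mkord xpredT (fun v => F v - F v.+1)).
under eq_bigr do rewrite -opprB.
rewrite sumrN telescope_sumr // opprB /F; congr (_ - _).
by apply: eq_msub => v; rewrite /mixed ltn_ord.
Qed.

Lemma Delta_odd : gdegree true (@gdiff _ (Delta W)).
Proof.
apply: gdeg_mxact => T S TS; apply: koszul_odd; move: TS => /=.
by case: (theta_par T); case: (theta_par S).
Qed.

Lemma Delta_sq (u : gel (Delta W)) :
  gdiff (gdiff u) = gscale (msub (@fstv k n) W - msub (@sndv k n) W) u.
Proof. by apply/ffunP=> T; rewrite gscaleE [LHS]koszul_sq sum_ddiff. Qed.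

Lemma rmorph_Delta_sq (A : comNzRingType) (f : {rmorphism {mpoly k[n + n]} -> A}) v T :
  mxact (fun T S => f (gdmx (g := Delta W) T S))
    (mxact (fun T S => f (gdmx (g := Delta W) T S)) v) T =
  f (msub (@fstv k n) W - msub (@sndv k n) W) * v T.
Proof.
have fE u : mxact (fun T S => f (gdmx (g := Delta W) T S)) u =
    mxact (koszul_mx (fun i => f (ddiff (@fstv k n) (@sndv k n) i W))
      (fun i => f (@fstv k n i - @sndv k n i))) u.
  by apply: eq_mxact => S S'; exact: rmorph_koszul.
rewrite !fE koszul_sq -sum_ddiff rmorph_sum; congr (_ * _).
by apply: eq_bigr => i _; rewrite rmorphM.
Qed.

End UnitFacts.

Section MfactFacts.
Variables (Q : comNzRingType) (U : Q) (X : mfact U).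

Lemma mfact_odd : gdegree true (@gdiff _ (mfobj X)).
Proof.
apply: gdeg_mxact => i j ij; apply: mfd_odd; move: ij => /=.
by case: (mfpar i); case: (mfpar j).
Qed.

Lemma rmorph_mfact_sq (A : comNzRingType) (f : {rmorphism Q -> A}) v i :
  mxact (fun i j => f (mfd X i j)) (mxact (fun i j => f (mfd X i j)) v) i = f U * v i.
Proof.
rewrite mxact_comp ffunE -[RHS](sum_deltal i (fun j => f U * v j)).
apply: eq_bigr => j _; have := congr1 (fun D : 'M[Q]_(mfrk X) => f (D i j)) (mfd_sq X).
rewrite !mxE rmorph_sum (eq_bigr (fun l => f (mfd X i l) * f (mfd X l j))) => [->|l _].
  by rewrite rmorphMn /= mulrA mulr_natl.
exact: rmorphM.
Qed.

Lemma mfact_sq (u : gel (mfobj X)) : gdiff (gdiff u) = gscale U u.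
Proof. by apply/ffunP=> i; rewrite gscaleE; exact: (rmorph_mfact_sq idfun). Qed.

End MfactFacts.

Section Unitors.
Variables (k : comNzRingType) (n m : nat).
Variables (W : {mpoly k[n]}) (V : {mpoly k[m]}) (X : mfact (inz n V - inx m W)).
Notation par := (@mfpar _ _ X).
Notation d := (mfd X).
Notation lzz := (msub (pt (@lu_z k n m) (@lu_z' k n m))).
Notation lxz := (msub (pt (@lu_x k n m) (@lu_z' k n m))).
Notation rxx := (msub (pt (@ru_x k n m) (@ru_x' k n m))).
Notation rxz := (msub (pt (@ru_x k n m) (@ru_z k n m))).

Lemma lunitor_inverse : exists linv, hinverse (lunitor (X := X)) linv.
Proof.
pose e (j : 'I_m) : 'I_(m + m + n) := lshift n (rshift m j).
pose y (j : 'I_m) : 'I_(m + m + n) := lshift n (lshift m j).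
pose sec := pt (@lu_x k n m) (@lu_z k n m).
pose g : 'I_(m + m + n) -> {mpoly k[n + m]} :=
  pt (pt (fun j => 'X_(rshift n j)) (fun j => 'X_(rshift n j)))
     (fun i' => 'X_(lshift m i')).
pose t := elim_t k e y true.
have tE j : lzz (@fstv k m j - @sndv k m j) = t j.
  rewrite rmorphB !msubX !ptE /t /elim_t expr1 mulN1r opprB.
  by [].
have gt j : msub g (t j) = 0.
  by rewrite /t /elim_t rmorphM rmorphB !msubX /g /e /y !ptE subrr mulr0.
have dE (u : gel (DeltaX X)) T i : gdiff u (T, i) =
    mxact (koszul_mx (fun j => lzz
      (ddiff (@fstv k m) (@sndv k m) j V)) t) [ffun T => u (T, i)] T +
    (-1) ^+ theta_par T * \sum_j lxz (d i j) * u (T, j).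
  rewrite [LHS]tens_act ffunE; congr (_ + _); apply: eq_bigr => S _.
  by rewrite ffunE rmorph_koszul; congr (_ * _); apply: eq_koszul.
apply: (@kunitor_inverse k m (m + m + n) (n + m) e y true _ _ g sec _ _ _ _
  _ _ _ _ fst snd (fun T i => (T, i)) (fun=> false) par d _ _ _ _ (inz n V - inx m W)).
- by move=> i j /lshift_inj /rshift_inj.
- by move=> i j; rewrite /e /y !eq_shift.
- by apply: split_ind => w; rewrite /sec ptE msubX /g !ptE.
- apply: split_ind => [v|v _]; last by rewrite /g /sec ptE msubX ptE.
  move: v; apply: split_ind => v ve; first by rewrite /g /sec !ptE msubX ptE.
  by have := ve v; rewrite /e eqxx.
- by move=> i; rewrite /g /sec !ptE msubX ptE.
- move=> i; apply: split_ind => w; rewrite /sec ptE elim_subX.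
    by rewrite /lu_x /e eq_shift.
  by rewrite /e /lu_z !eq_shift.
- by [].
- by [].
- by case.
- by [].
- apply: gdeg_mxact => [[T i] [S j]] ne; apply: (@tens_odd _ _ _ (@theta_par m) par).
  + by move=> T' S' h; rewrite [gdmx _ _]koszul_odd ?rmorph0.
  + by move=> i' j' h; rewrite mfd_odd ?rmorph0.
  + by move: ne; rewrite /=; case: (tens_par _ _ _); case: (tens_par _ _ _).
- exact: mfact_odd.
- move=> u; apply/ffunP=> x; rewrite gscaleE.
  rewrite [LHS](@tens_sq _ _ _ (@theta_par m) _ _ _
    (lzz (msub (@fstv k m) V - msub (@sndv k m) V))
    (lxz (inz n V - inx m W))) //.
  (* The intermediate potential cancels: V(z) - V(z') from the unit plus V(z') - W(x) from [X] is
     V(z) - W(x). *)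
  + congr (_ * _); transitivity (msub sec (inz n V - inx m W)) => //.
    by rewrite /sec !rmorphB !msub_ptl !msub_ptr addrA subrK.
  + by move=> T S h; rewrite [gdmx _ _]koszul_odd ?rmorph0.
  + move=> v T; exact: rmorph_Delta_sq.
  + move=> v i; exact: rmorph_mfact_sq.
- exact: mfact_sq.
(* The differential of [X] preserves the exterior degree and the divided differences of [V] raise
   it; only z - z' lowers it. *)
- move=> p u hu [T i] hT; rewrite ffunB dE [kdel _ _ _ _ _ _ _ _ _]ffunE mul1r.
  rewrite [X in _ + _ * X - _]big1 ?mulr0 ?addr0 => [|j _]; last by rewrite hu ?mulr0.
  by apply: (@koszul_rest _ _ _ _ _ p) => // S hS; rewrite ffunE hu.
- move=> u; apply/ffunP=> i; rewrite ffunE dE koszul_act (rmorphD (msub g)) (rmorph_sum (msub g)).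
  rewrite big1 ?add0r => [|j _]; last by rewrite !(rmorphM (msub g)) in_set0 gt mulr0 mul0r.
  rewrite /theta_par cards0 mul1r (rmorph_sum (msub g)) [RHS]ffunE; apply: eq_bigr => j _.
  rewrite (rmorphM (msub g)) msub_comp msub_id ?ffunE //.
  by apply: split_ind => w; rewrite ptE msubX /g !ptE.
Qed.

Lemma runitor_inverse : exists rinv, hinverse (runitor (X := X)) rinv.
Proof.
(* The intermediate variables are now the unprimed x. They are eliminated in favour of x', which is
   the x of the base ring; hence the sign [false]. *)
pose e (i : 'I_n) : 'I_(m + n + n) := lshift n (rshift m i).
pose y (i : 'I_n) : 'I_(m + n + n) := rshift (m + n) i.
pose sec := pt (@ru_x' k n m) (@ru_z k n m).
pose g : 'I_(m + n + n) -> {mpoly k[n + m]} :=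
  pt (pt (fun j => 'X_(rshift n j)) (fun i' => 'X_(lshift m i')))
     (fun i' => 'X_(lshift m i')).
pose t := elim_t k e y false.
have tE i : rxx (@fstv k n i - @sndv k n i) = t i.
  by rewrite rmorphB !msubX !ptE /t /elim_t expr0 mul1r.
have gt i : msub g (t i) = 0.
  by rewrite /t /elim_t rmorphM rmorphB !msubX /g /e /y !ptE subrr mulr0.
have dE (u : gel (XDelta X)) T i : gdiff u (i, T) =
    \sum_j rxz (d i j) * u (j, T) +
    (-1) ^+ par i * mxact (koszul_mx (fun j => rxx
      (ddiff (@fstv k n) (@sndv k n) j W)) t) [ffun T => u (i, T)] T.
  rewrite [LHS]tens_act; congr (_ + _ * _); rewrite ffunE; apply: eq_bigr => S _.
  by rewrite ffunE rmorph_koszul; congr (_ * _); apply: eq_koszul.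
apply: (@kunitor_inverse k n (m + n + n) (n + m) e y false _ _ g sec _ _ _ _
  _ _ _ _ snd fst (fun T i => (i, T)) par par d _ _ _ _ (inz n V - inx m W)).
- by move=> i j /lshift_inj /rshift_inj.
- by move=> i j; rewrite /e /y !eq_shift.
- by apply: split_ind => w; rewrite /sec ptE msubX /g !ptE.
- apply: split_ind => [v|v _]; last by rewrite /g /sec ptE msubX ptE.
  move: v; apply: split_ind => v ve; first by rewrite /g /sec !ptE msubX ptE.
  by have := ve v; rewrite /e eqxx.
- by move=> i; rewrite /g /sec !ptE msubX ptE.
- move=> i; apply: split_ind => w; rewrite /sec ptE elim_subX.
    by rewrite /ru_x' /e eq_shift.
  by rewrite /e /ru_z !eq_shift.
- by [].
- by [].
- by case.
- by case=> i T; rewrite /= /tens_par addbC.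
- apply: gdeg_mxact => [[i T] [j S]] ne; apply: (@tens_odd _ _ _ par (@theta_par n)).
  + by move=> i' j' h; rewrite mfd_odd ?rmorph0.
  + by move=> T' S' h; rewrite [gdmx _ _]koszul_odd ?rmorph0.
  + by move: ne; rewrite /=; case: (tens_par _ _ _); case: (tens_par _ _ _).
- exact: mfact_odd.
- move=> u; apply/ffunP=> x; rewrite gscaleE.
  rewrite [LHS](@tens_sq _ _ _ par _ _ _
    (rxz (inz n V - inx m W))
    (rxx (msub (@fstv k n) W - msub (@sndv k n) W))) //.
  + congr (_ * _); transitivity (msub sec (inz n V - inx m W)) => //.
    by rewrite /sec !rmorphB !msub_ptl !msub_ptr addrA subrK.
  + by move=> i j h; rewrite mfd_odd ?rmorph0.
  + move=> v i; exact: rmorph_mfact_sq.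
  + move=> v T; exact: rmorph_Delta_sq.
- exact: mfact_sq.
- move=> p u hu [i T] hT; rewrite ffunB dE [kdel _ _ _ _ _ _ _ _ _]ffunE.
  rewrite big1 ?add0r => [|j _]; last by rewrite hu ?mulr0.
  rewrite -mulrBr (@koszul_rest _ _ _ _ _ p) ?mulr0 // => S hS.
  by rewrite ffunE hu.
- move=> u; apply/ffunP=> i; rewrite ffunE dE koszul_act (rmorphD (msub g)).
  rewrite (rmorphM (msub g)) [X in _ + _ * X](rmorph_sum (msub g)).
  rewrite [X in _ + _ * X]big1 ?mulr0 ?addr0 => [|j _]; last first.
    by rewrite !(rmorphM (msub g)) in_set0 gt mulr0 mul0r.
  rewrite (rmorph_sum (msub g)) [RHS]ffunE; apply: eq_bigr => j _.
  rewrite (rmorphM (msub g)) msub_comp msub_id ?ffunE //.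
  by apply: split_ind => w; rewrite ptE msubX /g !ptE.
Qed.

End Unitors.

(** * Endomorphisms of the unit *)

Section KoszulBoundary.
Variables (k : comNzRingType) (n : nat) (t : 'I_n -> {mpoly k[n]}).
Hypothesis t_exact : koszul_exact t.
Notation delta := (mxact (koszul_mx (fun=> 0) t)).
Implicit Types g h : {ffun {set 'I_n} -> {mpoly k[n]}}.

Lemma koszul_cycle_comp g j : delta g = 0 -> (0 < j)%N ->
  exists2 v : {ffun {set 'I_n} -> {mpoly k[n]}}, (forall S : {set 'I_n}, #|S| != j.+1 -> v S = 0) &
    delta v = [ffun S : {set 'I_n} => if #|S| == j then g S else 0].
Proof.
move=> dg j_gt0; apply: t_exact j_gt0 _ _.
  by move=> S /negbTE hS; rewrite ffunE hS.
apply/ffunP=> T; rewrite [RHS]ffunE koszul_act.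
have [Tj|Tj] := eqVneq #|T|.+1 j.
  have := congr1 (fun v : {ffun {set 'I_n} -> {mpoly k[n]}} => v T) dg.
  rewrite koszul_act [X in _ = X]ffunE => h0; rewrite -[RHS]h0.
  apply: eq_bigr => i _; rewrite ffunE card_flip.
  by case: ifP => iT; rewrite ?mulr0 ?mul0r // Tj eqxx.
rewrite big1 // => i _; rewrite ffunE card_flip.
by case: ifP => iT; rewrite ?mulr0 ?mul0r // (negbTE Tj) mulr0.
Qed.

Lemma koszul_cycle_ideal g (S : {set 'I_n}) :
  delta g = 0 -> S != set0 -> in_ideal t (g S).
Proof.
rewrite -card_gt0 => dg S_gt0.
have [v _ /(congr1 (fun v : {ffun _ -> _} => v S))] := koszul_cycle_comp dg S_gt0.
rewrite koszul_act ffunE eqxx => <-.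
exists (fun i => if i \in S then 0 else sg _ S i * v (flip S i)).
apply: eq_bigr => i _; case: ifP => _; first by rewrite mulr0 !mul0r.
by rewrite mulrAC.
Qed.

(** Components are bounded degree by degree. Odd ones vanish and even positive ones bound by
    exactness; in degree zero, which exactness does not reach, the preimage is the one-form with the
    coefficients [c] of the ideal membership. *)
Lemma koszul_boundary g : delta g = 0 -> in_ideal t (g set0) ->
  (forall S : {set 'I_n}, odd #|S| -> g S = 0) ->
  exists2 h : {ffun {set 'I_n} -> {mpoly k[n]}}, (forall S : {set 'I_n}, ~~ odd #|S| -> h S = 0) & delta h = g.
Proof.
move=> dg [c g0] g_even.
have [v v_odd dv] : exists2 v : 'I_n.+1 -> {ffun {set 'I_n} -> {mpoly k[n]}},
    (forall j (S : {set 'I_n}), ~~ odd #|S| -> v j S = 0) &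
    forall j : 'I_n.+1, delta (v j) = [ffun S : {set 'I_n} => if #|S| == j then g S else 0].
  have /fin_all_exists2 : forall j : 'I_n.+1,
      exists2 v : {ffun {set 'I_n} -> {mpoly k[n]}}, (forall S : {set 'I_n}, ~~ odd #|S| -> v S = 0) &
      delta v = [ffun S : {set 'I_n} => if #|S| == j then g S else 0].
    move=> j; have [odd_j|even_j] := boolP (odd j).
      exists 0 => [S _|]; first by rewrite ffunE.
      rewrite mxact0; apply/ffunP=> S; rewrite !ffunE.
      by case: eqP => // Sj; rewrite g_even // Sj.
    have [j0|] := posnP j; last first.
      case/(koszul_cycle_comp dg) => v hv dv; exists v => // S odd_S; apply: hv.
      by apply: contraNneq odd_S => ->.
    exists [ffun S : {set 'I_n} => \sum_i (if S == [set i] then c i else 0)] => [S odd_S|].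
      rewrite ffunE big1 // => i _; case: eqP => // Si.
      by rewrite Si cards1 in odd_S.
    apply/ffunP=> T; rewrite koszul_act [RHS]ffunE j0.
    case: ifP => [|T0].
      rewrite cards_eq0 => /eqP ->; rewrite g0; apply: eq_bigr => i _.
      rewrite in_set0 ffunE (bigD1 i) //= big1 ?addr0 => [|i' /negbTE ne].
        rewrite /flip in_set0 setU0 eqxx /sg.
        have -> : [set s in (set0 : {set 'I_n}) | (s < i)%N] = set0.
          by apply/setP=> s; rewrite !inE.
        by rewrite cards0 expr0 mul1r mulrC.
      rewrite /flip in_set0 setU0; case: eqP => // /setP /(_ i).
      by rewrite !inE eqxx eq_sym ne.
    rewrite big1 // => i _; case: ifP => iT; first by rewrite mulr0 mul0r.
    rewrite ffunE big1 ?mulr0 // => i' _; case: eqP => // e.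
    by have := card_flip T i; rewrite iT e cards1 => -[/esym/eqP]; rewrite T0.
  by case=> v h1 h2; exists v.
exists (\sum_j v j) => [S odd_S|].
  by rewrite sum_ffunE big1 // => j _; exact: v_odd.
rewrite (big_morph _ (mxactD (koszul_mx (fun=> 0) t)) (mxact0 _)).
apply/ffunP=> S; rewrite sum_ffunE.
have S_le : (#|S| < n.+1)%N by rewrite ltnS -[X in (_ <= X)%N]card_ord max_card.
rewrite (bigD1 (Ordinal S_le)) //= dv ffunE eqxx big1 ?addr0 // => j.
by rewrite dv ffunE -val_eqE /= eq_sym => /negbTE ->.
Qed.

End KoszulBoundary.

Section UnitEndomorphisms.
Variables (k : comNzRingType) (n : nat) (W : {mpoly k[n]}).
Hypothesis W_pot : potential W.
Notation D := (Delta W).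

Definition diag : 'I_(n + n) -> {mpoly k[n]} := pt (fun i => 'X_i) (fun i => 'X_i).

Let bas (S : {set 'I_n}) : gel D := [ffun S' => (S' == S)%:R].

Lemma diag_t i : msub diag (@fstv k n i - @sndv k n i) = 0.
Proof. by rewrite rmorphB !msubX /diag !ptE subrr. Qed.

Lemma diag_ddiff i : msub diag (ddiff (@fstv k n) (@sndv k n) i W) = grad W i.
Proof.
rewrite (msub_ddiff_diag _ (h := fun i => 'X_i)) => [|w|w].
- exact: msub_id.
- by rewrite msubX /diag ptE.
- by rewrite msubX /diag ptE.
Qed.

Lemma diag_gdiff (u : gel D) : msub diag (gdiff u set0) = 0.
Proof.
rewrite [gdiff u set0]koszul_act (rmorph_sum (msub diag)) big1 // => i _.
by rewrite !(rmorphM (msub diag)) in_set0 diag_t mulr0 mul0r.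
Qed.

Variable G : gel D -> gel D.
Hypothesis G_mor : gmor G.

Definition diag_row : {ffun {set 'I_n} -> {mpoly k[n]}} :=
  [ffun S => msub diag (gmx G set0 S)].

(** This is row [set0] of the chain map equation at x' = x. The side d G vanishes there by
    [diag_gdiff]; on the side G d only the wedge part, with entries [grad W], survives, and wedging
    seen from the row side is contraction. *)
Lemma diag_row_cycle : mxact (koszul_mx (fun=> 0) (grad W)) diag_row = 0.
Proof.
have [G_lin _ Gd] := G_mor; apply/ffunP=> S; rewrite koszul_act [RHS]ffunE.
have := diag_gdiff (G (bas S)); rewrite -Gd.
have -> : gdiff (bas S) = [ffun T => gdmx (g := D) T S] by exact: mxact_delta.
rewrite (glin_gmx _ _ G_lin); under eq_bigr do rewrite ffunE.
rewrite [X in msub _ X]koszul_col (rmorph_sum (msub diag)) => h0; rewrite -[RHS]h0.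
apply: eq_bigr => i _; rewrite !(rmorphM (msub diag)) ffunE.
congr (_ * _ * _); last first.
  by case: ifP => _; rewrite ?diag_t ?diag_ddiff.
by rewrite /sg rmorphXn rmorphN1.
Qed.

Lemma diag_row_ideal S : S != set0 -> in_ideal (grad W) (msub diag (gmx G set0 S)).
Proof.
have [_ _ W_exact] := W_pot => S0.
by have := koszul_cycle_ideal W_exact diag_row_cycle S0; rewrite ffunE.
Qed.

(** First [diag_row] is written as a Koszul boundary of [h], which yields an odd map [H0].
    Subtracting its boundary from [G] leaves a map that dies on the diagonal, and such a map
    contracts along x - x'. *)
Lemma Delta_null :
  in_ideal (grad W) (msub diag (gmx G set0 set0)) -> homotopic G (fun=> 0).
Proof.
move=> G0; have [_ _ W_exact] := W_pot; have [G_lin G_deg Gd] := G_mor.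
have [||h h_odd dh] := koszul_boundary W_exact diag_row_cycle.
- by rewrite ffunE.
- move=> S odd_S; rewrite ffunE /gmx.
  have /G_deg -> : ghomog true (bas S) by rewrite -odd_S; exact: ghomog_basis.
    exact: rmorph0.
  by rewrite /= /theta_par cards0.
(* Coefficients on the diagonal are lifted to k[x, x'] by placing them in the unprimed variables. *)
pose h0 S : gel D := [ffun T => if T == set0 then msub (@fstv k n) (h S) else 0].
pose H0 : gel D -> gel D := gext h0.
have H0_lin : glinear H0 by exact: glin_gext.
have H0_deg : gdegree true H0.
  apply: gdeg_gext => S T ST; rewrite ffunE.
  case: (T =P set0) ST => [->|//] /=; rewrite /theta_par cards0 => odd_S.
  rewrite h_odd ?rmorph0 //.
  by move: odd_S; case: (odd #|S|).
pose G' u := G u - (gdiff (H0 u) + H0 (gdiff u)).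
have dH0_lin : glinear (fun u => gdiff (H0 u) + H0 (gdiff u)).
  apply: glin_add; first by apply: (glin_comp _ H0_lin); exact: glin_gdiff.
  by apply: (glin_comp H0_lin); exact: glin_gdiff.
have G'_lin : glinear G' by exact: glin_sub.
have D_odd := @Delta_odd k n W; have D_sq := @Delta_sq k n W.
have diag_G'_bas S : msub diag (G' (bas S) set0) = 0.
  have := congr1 (fun v : {ffun _ -> _} => v S) dh; rewrite koszul_act ffunE.
  rewrite /G' ffunB [X in _ - X]ffunE rmorphB rmorphD diag_gdiff add0r => <-.
  have -> : gdiff (bas S) = [ffun T => gdmx (g := D) T S] by exact: mxact_delta.
  rewrite /H0 /gext sum_ffunE.
  rewrite (eq_bigr (fun T => msub (@fstv k n) (h T) * gdmx (g := D) T S)) => [|T _].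
    rewrite [X in msub _ X]koszul_col (rmorph_sum (msub diag)).
    apply/eqP; rewrite subr_eq0; apply/eqP; apply: eq_bigr => i _.
    rewrite !(rmorphM (msub diag)) msub_ptl msub_id //; congr (_ * _ * _).
      by rewrite /sg rmorphXn rmorphN1.
    by case: ifP => _; rewrite ?diag_t ?diag_ddiff.
  by rewrite gscaleE !ffunE eqxx mulrC.
have [|||||||||||||H [H_lin H_deg _ H_E]] := @koszul_lift k n (n + n) (@rshift n n)
  (@lshift n n) true _ _ {mpoly k[n + n]} {set 'I_n} unit idfun (@theta_par n)
  (gdmx (g := D)) id (fun=> tt) (fun T _ => T) (fun=> false) (fun=> false)
  _ _ _ _ n diag (fun i => 'X_(lshift n i)) _ _ D_odd _ D_sq _ D false G'
  _ D_odd D_sq G'_lin.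
- exact: rshift_inj.
- by move=> i j; rewrite eq_shift.
- by [].
- by move=> T [].
- by [].
- by move=> S; rewrite addbF.
- apply: split_ind => [v _|v]; first by rewrite /diag ptE msubX.
  by move=> /(_ v); rewrite eqxx.
- by move=> i; rewrite /diag ptE msubX.
- move=> p u hu T hT; rewrite ffunB [kdel _ _ _ _ _ _ _ _ _]ffunE mul1r.
  have -> : slice (act := idfun) (par := @theta_par n) (dm := gdmx (g := D))
      (fun T (_ : unit) => T) u tt = u by apply/ffunP=> S; rewrite ffunE.
  rewrite [X in _ - X](_ : _ = mxact (koszul_mx (fun=> 0)
    (fun i => @fstv k n i - @sndv k n i)) u T).
    by apply: (@koszul_rest _ _ _ _ _ p).
  rewrite !ffunE; apply: eq_bigr => S _; congr (_ * _); apply: eq_koszul => // i.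
  by rewrite /elim_t expr1 mulN1r opprB.
(* Eliminating x' does not commute with multiplication by x', so linearity comes from the basis of
   Delta_W over k[x, x']. *)
- by right; exists {set 'I_n}, (@theta_par n), (gdmx (g := D)).
- apply: gdeg_add => //; apply: gdeg_opp; apply: gdeg_add.
    by have := gdeg_comp D_odd H0_deg.
  by have := gdeg_comp H0_deg D_odd.
- move=> u; rewrite /G' /= (glinB (@glin_gdiff _ _)) Gd (glinD (@glin_gdiff _ _)).
  by rewrite !D_sq (glinZ H0_lin) [X in _ - X]addrC.
- move=> u []; rewrite (glin_basis u G'_lin) sum_ffunE (rmorph_sum (msub diag)).
  by rewrite big1 // => S _; rewrite gscaleE rmorphM diag_G'_bas mulr0.
exists (fun u => H0 u + H u); split; [exact: glin_add | exact: gdeg_add | move=> u].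
rewrite subr0; have /eqP := H_E u; rewrite subr_eq => /eqP -> /=.
rewrite (glinD (@glin_gdiff _ _)) addrC addrACA.
by [].
Qed.

End UnitEndomorphisms.

(** * Residues *)

Section Ideals.
Variables (k : comNzRingType) (n : nat) (t : 'I_n -> {mpoly k[n]}).

Lemma in_ideal0 : in_ideal t 0.
Proof. by exists (fun=> 0); rewrite big1 // => i _; rewrite mul0r. Qed.

Lemma in_idealD f g : in_ideal t f -> in_ideal t g -> in_ideal t (f + g).
Proof.
case=> c -> [c' ->]; exists (fun i => c i + c' i).
by rewrite -big_split; apply: eq_bigr => i _; rewrite mulrDl.
Qed.

Lemma in_idealM h f : in_ideal t f -> in_ideal t (h * f).
Proof.
case=> c ->; exists (fun i => h * c i).
by rewrite mulr_sumr; apply: eq_bigr => i _; rewrite mulrA.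
Qed.

Lemma in_idealN f : in_ideal t f -> in_ideal t (- f).
Proof. by move/(in_idealM (-1)); rewrite mulN1r. Qed.

Lemma in_idealB f g : in_ideal t f -> in_ideal t g -> in_ideal t (f - g).
Proof. by move=> hf /in_idealN; exact: in_idealD. Qed.

Lemma in_idealZ c f : in_ideal t f -> in_ideal t (c *: f).
Proof. by move/(in_idealM c%:MP); rewrite mul_mpolyC. Qed.

Lemma in_ideal_gen i : in_ideal t (t i).
Proof.
exists (fun j => (i == j)%:R); rewrite (bigD1 i) //= eqxx mul1r big1 ?addr0 // => j.
by rewrite eq_sym => /negbTE ->; rewrite mul0r.
Qed.

Lemma in_ideal_pow2 f : in_ideal_pow t 2 f -> in_ideal t f.
Proof.
case=> F /dhomogP F_hom <-; rewrite /meval /mmap big_seq_cond.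
elim/big_rec: _ => [|mon f' /andP[/F_hom mon2 _] hf']; first exact: in_ideal0.
apply: in_idealD hf'; apply: in_idealM.
have [/existsP[i mon_i]|/existsPn mon0] := boolP [exists i, (0 < mon i)%N]; last first.
  have : mdeg mon = 0%N.
    by rewrite mdegE big1 // => i _; apply/eqP; rewrite -leqn0 leqNgt mon0.
  by rewrite [LHS]mon2.
rewrite /mmap1 (bigD1 i) //= -(prednK mon_i) exprSr mulrAC.
by apply: in_idealM; exact: in_ideal_gen.
Qed.

End Ideals.

Section Residues.
Variables (k : comNzRingType) (n : nat) (t : 'I_n -> {mpoly k[n]}).

Lemma basis_mod_eq0 N (b : 'I_N -> {mpoly k[n]}) (c : 'I_N -> k) :
  basis_mod t b -> in_ideal t (\sum_i c i *: b i) -> forall i, c i = 0.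
Proof.
move=> /(_ 0) [c0 [_ c0_uniq]] hc i.
have e1 : c0 = 0.
  apply: c0_uniq; rewrite big1 ?subr0; first exact: in_ideal0.
  by move=> j _; rewrite ffunE scale0r.
have e2 : c0 = [ffun j => - c j].
  apply: c0_uniq; rewrite sub0r -sumrN (eq_bigr (fun j => c j *: b j)) // => j _.
  by rewrite ffunE scaleNr opprK.
by have := congr1 (fun f : {ffun 'I_N -> k} => - f i) e2; rewrite e1 !ffunE opprK oppr0.
Qed.

(** Division by the basis is done twice: the coefficients [c] of the t-part of [r * b j] are divided
    again, and the new remainders meet a second factor [t l], so the error is quadratic. The choice
    principle then fixes matrices for all [r]. *)
Lemma is_residue_ex N (b : 'I_N -> {mpoly k[n]}) :
  basis_mod t b -> exists rho, is_residue t rho.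
Proof.
move=> hb.
have coord f : exists c : {ffun 'I_N -> k}, in_ideal t (f - \sum_i c i *: b i).
  by have [c [hc _]] := hb f; exists c.
have step (rj : {mpoly k[n]} * 'I_N) :
    exists e : {ffun 'I_N -> k} * ('I_n -> {ffun 'I_N -> k}),
    in_ideal_pow t 2 (rj.1 * b rj.2 - \sum_i e.1 i *: b i
      - \sum_l t l * \sum_i e.2 l i *: b i).
  have [e0 [c hc]] := coord (rj.1 * b rj.2).
  have [e1 he1] := fin_all_exists (fun l => coord (c l)).
  have [c' hc'] := fin_all_exists he1.
  exists (e0, e1); exists (\sum_l \sum_l' c' l l' *: ('X_l * 'X_l')).
    apply: rpred_sum => l _; apply: rpred_sum => l' _; apply: rpredZ.
    rewrite -mpolyXD; apply/dhomogP => mon; rewrite msuppX inE => /eqP ->.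
    by rewrite [LHS]mdegD !mdeg1.
  rewrite /= hc -sumrB rmorph_sum; apply: eq_bigr => l _.
  rewrite rmorph_sum mulrC -mulrBr hc' mulr_sumr; apply: eq_bigr => l' _.
  by rewrite [LHS]mevalZ mevalM !mevalXU mulrCA.
have choose rj := constructive_indefinite_description _ (step rj).
pose E0 r : 'M[k]_N := \matrix_(i, j) (proj1_sig (choose (r, j))).1 i.
pose E1 l r : 'M[k]_N := \matrix_(i, j) (proj1_sig (choose (r, j))).2 l i.
exists (fun f => \sum_(s : 'S_n) (-1) ^+ s *
             \tr (E0 f * \prod_(l < n) E1 l 'X_(s l))).
exists N, b, E0, E1; split=> // r j.
have := proj2_sig (choose (r, j)); rewrite /=; congr (in_ideal_pow _ _ (_ - _ - _)).
  by apply: eq_bigr => i _; rewrite mxE.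
by apply: eq_bigr => l _; congr (_ * _); apply: eq_bigr => i _; rewrite mxE.
Qed.

Lemma residueP N (b : 'I_N -> {mpoly k[n]}) :
  basis_mod t b -> is_residue t (residue t).
Proof. by move/is_residue_ex => ex; exact: epsilon_spec. Qed.

Section ResidueProperties.
Variable rho : {mpoly k[n]} -> k.
Hypothesis rhoP : is_residue t rho.

(** [f] enters only through [E0 f], which is the matrix of multiplication by [f] modulo the ideal
    and is linear by uniqueness of coordinates. *)
Lemma residue_linear c f g : rho (c *: f + g) = c * rho f + rho g.
Proof.
have [N [b [E0 [E1 [hb hE hrho]]]]] := rhoP.
have E0P r j : in_ideal t (r * b j - \sum_i E0 r i j *: b i).
  have := in_ideal_pow2 (hE r j); move/in_idealD.
  move/(_ (\sum_l t l * \sum_i E1 l r i j *: b i)); rewrite subrK; apply.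
  by exists (fun l => \sum_i E1 l r i j *: b i); apply: eq_bigr => l _; rewrite mulrC.
have -> : rho (c *: f + g) = \sum_(s : 'S_n) (-1) ^+ s *
    \tr ((c *: E0 f + E0 g) * \prod_(l < n) E1 l 'X_(s l)).
  rewrite hrho; suff -> : E0 (c *: f + g) = c *: E0 f + E0 g by [].
  apply/matrixP=> i j; rewrite !mxE; apply/eqP; rewrite -subr_eq0; apply/eqP.
  move: i; apply: (basis_mod_eq0 (c := fun i => E0 (c *: f + g) i j - (c * E0 f i j + E0 g i j)) hb).
  rewrite (eq_bigr (fun i => E0 (c *: f + g) i j *: b i -
    (c *: (E0 f i j *: b i) + E0 g i j *: b i))) => [|i _]; last first.
    by rewrite scalerBl scalerDl scalerA.
  rewrite sumrB big_split /= -scaler_sumr.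
  have := in_idealB (in_idealD (in_idealZ c (E0P f j)) (E0P g j)) (E0P (c *: f + g) j).
  congr in_ideal; rewrite scalerBr mulrDl scalerAl.
  move: (c *: f * b j) (g * b j) (c *: \sum_i _) => p q x.
  by move: (\sum_i _) (\sum_i _) => y z; ring.
rewrite !hrho mulr_sumr -big_split; apply: eq_bigr => s _.
rewrite mulrDl linearD [X in \tr X + _](esym (scalemxAl _ _ _)) linearZ /=.
by rewrite mulrDr mulrCA.
Qed.

Lemma residue_ideal f : in_ideal t f -> rho f = 0.
Proof.
have [N [b [E0 [E1 [hb hE hrho]]]]] := rhoP => hf.
rewrite hrho big1 // => s _; suff -> : E0 f = 0 by rewrite mul0r linear0 mulr0.
apply/matrixP=> i j; rewrite [RHS]mxE; move: i.
apply: (basis_mod_eq0 (c := fun i => E0 f i j) hb).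
have h1 := in_ideal_pow2 (hE f j).
have h2 : in_ideal t (\sum_l t l * \sum_i E1 l f i j *: b i).
  by exists (fun l => \sum_i E1 l f i j *: b i); apply: eq_bigr => l _; rewrite mulrC.
have := in_idealB (in_idealM (b j) hf) (in_idealD h1 h2).
by rewrite subrK mulrC opprB addrC subrK.
Qed.

End ResidueProperties.
End Residues.

Section CoefExt.
Variables (k : comNzRingType) (m : nat) (rho : {mpoly k[m]} -> k).
Hypothesis rho_lin : forall (c : k) (f g : {mpoly k[m]}), rho (c *: f + g) = c * rho f + rho g.

Let rho_add : zmod_morphism rho.
Proof. by move=> f g; rewrite addrC -scaleN1r rho_lin mulN1r addrC. Qed.

Lemma mcoeff_map_linear p (F : {mpoly {mpoly k[m]}[p]}) mon :
  (map_mpoly rho F)@_mon = rho F@_mon.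
Proof.
pose rhoA : {additive _ -> _} := HB.pack rho (GRing.isZmodMorphism.Build _ _ rho rho_add).
exact: (mcoeff_map_mpoly rhoA).
Qed.

Let rho0 : rho 0 = 0.
Proof. by have := rho_add 0 0; rewrite !subrr. Qed.

Let rhoZ c f : rho (c *: f) = c * rho f.
Proof. by rewrite -[c *: f]addr0 rho_lin rho0 addr0. Qed.

Let rhoD f g : rho (f + g) = rho f + rho g.
Proof. by rewrite -{1}[f]scale1r rho_lin mul1r. Qed.

Lemma map_linearD p (F G : {mpoly {mpoly k[m]}[p]}) :
  map_mpoly rho (F + G) = map_mpoly rho F + map_mpoly rho G.
Proof. by apply/mpolyP=> mon; rewrite !mcoeff_map_linear !mcoeffD !mcoeff_map_linear rhoD. Qed.

Lemma map_linear0 p : map_mpoly rho (0 : {mpoly {mpoly k[m]}[p]}) = 0.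
Proof. by apply/mpolyP=> mon; rewrite mcoeff_map_linear !mcoeff0 rho0. Qed.

Lemma map_linear_sum p (I : Type) (s : seq I) (F : I -> {mpoly {mpoly k[m]}[p]}) :
  map_mpoly rho (\sum_(i <- s) F i) = \sum_(i <- s) map_mpoly rho (F i).
Proof. exact: (big_morph _ (@map_linearD p) (map_linear0 p)). Qed.

Lemma map_linearX p c mon :
  map_mpoly rho (c *: 'X_[mon] : {mpoly {mpoly k[m]}[p]}) = rho c *: 'X_[mon].
Proof.
apply/mpolyP=> mon'; rewrite mcoeff_map_linear !mcoeffZ !mcoeffX.
by case: eqP => _; rewrite ?mulr1 ?mulr0 ?rho0.
Qed.

Definition const_coef p : {rmorphism {mpoly k[p]} -> {mpoly {mpoly k[m]}[p]}} :=
  map_mpoly (@mpolyC m k).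

Lemma map_linear_const p q (F : {mpoly {mpoly k[m]}[p]}) :
  map_mpoly rho (const_coef p q * F) = q * map_mpoly rho F.
Proof.
rewrite {1}[q]mpolyE {1}[F]mpolyE [q in RHS]mpolyE [F in RHS]mpolyE.
rewrite (rmorph_sum (const_coef p)) !mulr_suml map_linear_sum; apply: eq_bigr => a _.
rewrite map_linear_sum mulr_sumr map_linear_sum mulr_sumr; apply: eq_bigr => b _.
have -> : const_coef p (q@_a *: 'X_[a]) = (q@_a)%:MP *: 'X_[a].
  by rewrite [LHS]map_mpolyZ map_mpolyX.
rewrite -scalerAl -scalerAr -mpolyXD scalerA !map_linearX mul_mpolyC rhoZ.
by rewrite -scalerAl -scalerAr -mpolyXD scalerA.
Qed.

Lemma map_linear_natural p p' (c : 'I_p -> {mpoly k[p']}) (F : {mpoly {mpoly k[m]}[p]}) :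
  msub c (map_mpoly rho F) =
  map_mpoly rho (mmap (@mpolyC p' _) (fun i => const_coef p' (c i)) F).
Proof.
pose L : {rmorphism {mpoly {mpoly k[m]}[p]} -> {mpoly {mpoly k[m]}[p']}} :=
  mmap (@mpolyC p' _) (fun i => const_coef p' (c i)).
rewrite -[mmap _ _ F]/(L F) [F]mpolyE map_linear_sum !rmorph_sum map_linear_sum.
apply: eq_bigr => a _; rewrite map_linearX msubZ.
have -> : L (F@_a *: 'X_[a]) = const_coef p' (msub c 'X_[a]) * (F@_a)%:MP.
  rewrite /L [LHS]mmapZ mulrC; congr (_ * _).
  rewrite mmapX [msub c _]mmapX /mmap1 (rmorph_prod (const_coef p')).
  by apply: eq_bigr => i _; rewrite rmorphXn.
rewrite map_linear_const -[(F@_a)%:MP]mulr1 mul_mpolyC -mpolyX0 map_linearX mpolyX0.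
by rewrite -[RHS]scalerAr mulr1.
Qed.

Section Points.
Variables (a p : nat) (g : 'I_a -> {mpoly {mpoly k[m]}[p]}).
Let Psi : {rmorphism {mpoly k[a]} -> {mpoly {mpoly k[m]}[p]}} :=
  mmap (@mpolyC p _ \o @mpolyC m k) g.

Let PsiC c : Psi c%:MP = c%:MP%:MP.
Proof. exact: mmapC. Qed.

Lemma coef_extD f h : coef_ext rho g (f + h) = coef_ext rho g f + coef_ext rho g h.
Proof. by rewrite /coef_ext -/(Psi _) rmorphD map_linearD. Qed.

Lemma coef_ext0 : coef_ext rho g 0 = 0.
Proof. by rewrite /coef_ext -/(Psi _) rmorph0 map_linear0. Qed.

Lemma coef_ext_sum (I : Type) (s : seq I) (P : pred I) (F : I -> {mpoly k[a]}) :
  coef_ext rho g (\sum_(i <- s | P i) F i) = \sum_(i <- s | P i) coef_ext rho g (F i).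
Proof. exact: (big_morph _ coef_extD coef_ext0). Qed.

Lemma coef_extM (s : 'I_p -> {mpoly k[a]}) q f :
  (forall i, mmap (@mpolyC p _ \o @mpolyC m k) g (s i) = 'X_i) ->
  coef_ext rho g (msub s q * f) = q * coef_ext rho g f.
Proof.
move=> gs; rewrite /coef_ext -/(Psi _) rmorphM -map_linear_const.
congr (map_mpoly _ (_ * _)); pose Ps : {rmorphism _ -> _} := Psi \o msub s.
apply: (mpoly_rmorph_eq (f := Ps)) => [c|i]; rewrite /Ps /=.
  by rewrite [mmap _ s _]msubC [LHS]PsiC [RHS]map_mpolyC.
by rewrite [mmap _ s _]msubX [LHS]gs [RHS]map_mpolyX.
Qed.

Lemma coef_ext_ideal (s : 'I_m -> {mpoly k[a]}) t f :
  (forall i, mmap (@mpolyC p _ \o @mpolyC m k) g (s i) = ('X_i)%:MP) ->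
  (forall h, rho (t * h) = 0) -> coef_ext rho g (msub s t * f) = 0.
Proof.
move=> gs t0; rewrite /coef_ext -/(Psi _) rmorphM.
have -> : Psi (msub s t) = t%:MP.
  pose Ps : {rmorphism _ -> _} := Psi \o msub s.
  pose C : {rmorphism _ -> {mpoly {mpoly k[m]}[p]}} := @mpolyC p {mpoly k[m]}.
  apply: (mpoly_rmorph_eq (f := Ps) (g := C)) => [c|i]; rewrite /Ps /=.
    by rewrite [mmap _ s _]msubC [LHS]PsiC.
  by rewrite [mmap _ s _]msubX [LHS]gs.
by apply/mpolyP=> mon; rewrite mcoeff_map_linear mcoeff0 mcoeffCM t0.
Qed.

End Points.

(** A residue commutes with substitutions in the variables that are kept. This lets the restriction
    to the diagonal pass inside the residue. *)
Lemma coef_ext_natural a a' p p' (g : 'I_a -> {mpoly {mpoly k[m]}[p]})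
    (g' : 'I_a' -> {mpoly {mpoly k[m]}[p']}) (c : 'I_p -> {mpoly k[p']})
    (D : 'I_a -> {mpoly k[a']}) f :
  (forall i, mmap (@mpolyC p' _) (fun j => const_coef p' (c j)) (g i) =
     mmap (@mpolyC p' _ \o @mpolyC m k) g' (D i)) ->
  msub c (coef_ext rho g f) = coef_ext rho g' (msub D f).
Proof.
move=> gD; rewrite /coef_ext map_linear_natural; congr (map_mpoly _ _).
pose L : {rmorphism {mpoly {mpoly k[m]}[p]} -> {mpoly {mpoly k[m]}[p']}} :=
  mmap (@mpolyC p' _) (fun i => const_coef p' (c i)).
pose Psi : {rmorphism {mpoly k[a]} -> {mpoly {mpoly k[m]}[p]}} :=
  mmap (@mpolyC p _ \o @mpolyC m k) g.
pose Psi' : {rmorphism {mpoly k[a']} -> {mpoly {mpoly k[m]}[p']}} :=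
  mmap (@mpolyC p' _ \o @mpolyC m k) g'.
pose F1 : {rmorphism _ -> _} := L \o Psi; pose F2 : {rmorphism _ -> _} := Psi' \o msub D.
apply: (mpoly_rmorph_eq (f := F1) (g := F2)) => [e|i]; rewrite /F1 /F2 /=.
  by rewrite [mmap _ g _]mmapC [mmap _ D _]mmapC [RHS]mmapC [LHS]mmapC.
by rewrite [mmap _ g _]mmapX mmap1U [mmap _ D _]mmapX mmap1U [LHS]gD.
Qed.

End CoefExt.

(** * Words of divided differences *)

Section OrderedWords.
Variable S : pzRingType.

Section Nat.
Variables (d D a w : nat -> S).
Hypothesis a_comm : forall i x, a i * x = x * a i.
Hypothesis w_comm : forall i x, w i * x = x * w i.

(** Words are indexed by predicates on [nat] rather than by sets of ordinals so that the length can
    vary in the induction below. *)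
Definition nword n (s : nat -> bool) : S := \prod_(b < n) (if s b then D b else 1).
Definition nflip (s : nat -> bool) i b := (b == i) (+) s b.
Definition ncount n (s : nat -> bool) := (\sum_(b < n) s b)%N.

(** [d i] travels to the right, becoming [d i.+1] at each position. Passing a letter that is present
    costs the central [w i] and deletes it; passing a gap costs the central [a i] and inserts the
    letter. Both costs produce the word flipped at [i], with the sign of the letters already
    passed. *)
Lemma nword_comm n s :
  (forall i, (i < n)%N -> d i = d i.+1 + a i * D i) ->
  (forall i, (i < n)%N -> d i * D i + D i * d i.+1 = w i) ->
  d 0%N * nword n s = (-1) ^+ ncount n s * nword n s * d n +
    \sum_(i < n) (-1) ^+ ncount i s * (if s i then w i else a i) * nword n (nflip s i).
Proof.
elim: n => [|n IHn] hstep hanti.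
  by rewrite /nword /ncount !big_ord0 !mulr1 mul1r addr0.
have wordS s' : nword n.+1 s' = nword n s' * (if s' n then D n else 1).
  by rewrite /nword big_ord_recr.
have flip_n : nword n (nflip s n) = nword n s.
  by apply: eq_bigr => b _; rewrite /nflip ltn_eqF.
rewrite wordS mulrA IHn; last 2 first.
- by move=> i lt_in; apply: hstep; exact: leqW.
- by move=> i lt_in; apply: hanti; exact: leqW.
rewrite mulrDl mulr_suml big_ord_recr /= !wordS flip_n.
have -> : nflip s n n = ~~ s n by rewrite /nflip eqxx.
rewrite [ncount n.+1 s]big_ord_recr -/(ncount n s) /=.
rewrite [X in _ = _ + (X + _)](eq_bigr (fun i : 'I_n =>
    (-1) ^+ ncount i s * (if s i then w i else a i) * nword n (nflip s i) *
    (if s n then D n else 1))) => [|i _]; last first.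
  by rewrite wordS mulrA /nflip gtn_eqF.
rewrite [RHS]addrA [RHS]addrAC; congr (_ + _).
case: (s n) => /=; rewrite ?mulr1 ?addn1 ?addn0.
  rewrite -(mulrA _ (d n)); have -> : d n * D n = w n - D n * d n.+1.
    by rewrite -hanti // addrK.
  rewrite mulrBr exprS mulN1r !mulNr addrC !mulrA; congr (_ + _).
  by rewrite -[LHS]mulrA -w_comm mulrA.
rewrite {1}(hstep n) // mulrDr; congr (_ + _).
by rewrite mulrA -[X in X * _ = _]mulrA -a_comm !mulrA.
Qed.

End Nat.

Section Ord.
Variables (n : nat) (d : nat -> S) (D a w : 'I_n -> S).
Hypothesis a_comm : forall i x, a i * x = x * a i.
Hypothesis w_comm : forall i x, w i * x = x * w i.
Hypothesis d_step : forall i : 'I_n, d i = d i.+1 + a i * D i.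
Hypothesis d_anti : forall i : 'I_n, d i * D i + D i * d i.+1 = w i.

Lemma word_comm (T : {set 'I_n}) :
  d 0%N * (\prod_(b <- enum T) D b) =
  (-1) ^+ #|T| * (\prod_(b <- enum T) D b) * d n +
  \sum_(i < n) (-1) ^+ #|[set s in T | (s < i)%N]| * (if i \in T then w i else a i) *
    \prod_(b <- enum (flip T i)) D b.
Proof.
pose ext (f : 'I_n -> S) (x : nat) : S := if insub x is Some i then f i else 0.
have extE f (i : 'I_n) : ext f i = f i by rewrite /ext valK.
pose mem_of (T : {set 'I_n}) (x : nat) := if insub x is Some i then i \in T else false.
have memE (T' : {set 'I_n}) (i : 'I_n) : mem_of T' i = (i \in T') by rewrite /mem_of valK.
have wordE (T' : {set 'I_n}) : \prod_(b <- enum T') D b = nword (ext D) n (mem_of T').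
  rewrite /enum_mem big_filter big_mkcond; apply: eq_bigr => b _.
  by rewrite memE extE.
have countE (i : nat) : (i <= n)%N ->
    ncount i (mem_of T) = #|[set s in T | (s < i)%N]|.
  move=> le_in; rewrite /ncount (big_ord_widen n (fun x => mem_of T x : nat)) //.
  rewrite -sum1_card big_mkcond [RHS]big_mkcond; apply: eq_bigr => b _.
  by rewrite memE inE; case: (b \in T); case: (b < i)%N.
have := @nword_comm d (ext D) (ext a) (ext w) _ _ n (mem_of T).
rewrite -wordE countE // => ->; last first.
- by move=> i lt_in; rewrite -[i]/(nat_of_ord (Ordinal lt_in)) !extE.
- by move=> i lt_in; rewrite -[i]/(nat_of_ord (Ordinal lt_in)) !extE.
- by move=> i x; rewrite /ext; case: insub => // ; rewrite mul0r mulr0.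
- by move=> i x; rewrite /ext; case: insub => // ; rewrite mul0r mulr0.
congr (_ * _ * _ + _).
  congr (_ ^+ _); apply: eq_card => b; by rewrite inE ltn_ord andbT.
apply: eq_bigr => i _; rewrite countE ?memE ?extE; last exact: ltnW.
congr (_ * _); rewrite wordE; apply: eq_bigr => b _.
by rewrite memE in_flip /nflip memE val_eqE.
Qed.

Lemma sgn_if c (x : S) : (-1) ^+ c * x = if odd c then - x else x.
Proof. by rewrite -signr_odd; case: (odd c); rewrite ?mulN1r ?mul1r. Qed.

(** The formula is meant for the opposite ring of matrices. Signs as conditionals involve no
    product, so they transfer between the two ring structures. *)
Lemma word_comm_if (T : {set 'I_n}) :
  d 0%N * (\prod_(b <- enum T) D b) =
  (let x := (\prod_(b <- enum T) D b) * d n in if odd #|T| then - x else x) +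
  \sum_(i < n) (let x := (if i \in T then w i else a i) *
      \prod_(b <- enum (flip T i)) D b in
    if odd #|[set s in T | (s < i)%N]| then - x else x).
Proof.
rewrite word_comm -mulrA sgn_if; congr (_ + _); apply: eq_bigr => i _.
by rewrite -mulrA sgn_if.
Qed.

End Ord.
End OrderedWords.

Section Interpolation.
Variables (k : comNzRingType) (N L a : nat) (U : {mpoly k[N]}) (X : mfact U).
Variables (e : 'I_a -> 'I_N) (o : nat) (u u' : 'I_N -> {mpoly k[L]}).
Hypothesis eE : forall i, e i = (o + i)%N :> nat.
Hypothesis uu' : forall v, (forall i, v != e i) -> u v = u' v.
Hypothesis u_reg : forall i, GRing.lreg (u (e i) - u' (e i)).
Notation A := {mpoly k[L]}.
Notation r := (mfrk X).
Notation p := (@mfpar _ _ X).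

(** d_X along a path from [u] to [u'] that moves one variable of the block at a time. [mixed] counts
    from the first variable of all, whence the offset [o]. *)
Definition dint (c : nat) : 'M[A]_r := map_mx (msub (mixed u u' (o + c))) (mfd X).
Definition ddm (b : 'I_a) : 'M[A]_r := map_mx (ddiff u u' (e b)) (mfd X).
Definition inc (b : 'I_a) : A := u (e b) - u' (e b).
Definition ddU (b : 'I_a) : A := ddiff u u' (e b) U.
Variable w : 'I_a -> A.
Hypothesis ddUE : forall b, ddU b = w b.

Lemma dint_first : dint 0 = map_mx (msub u) (mfd X).
Proof.
apply/matrixP=> i j; rewrite !mxE; apply: eq_msub => v; rewrite /mixed addn0.
case: ifP => // vo; rewrite uu' // => l; rewrite -val_eqE /= eE.
by rewrite ltn_eqF // (leq_trans vo) ?leq_addr.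
Qed.

Lemma dint_last : dint a = map_mx (msub u') (mfd X).
Proof.
apply/matrixP=> i j; rewrite !mxE; apply: eq_msub => v; rewrite /mixed.
case: ifP => // vo; rewrite uu' // => l; rewrite -val_eqE /= eE.
by apply: contraFneq vo => ->; rewrite ltn_add2l.
Qed.

Lemma dint_sq c : dint c * dint c = (msub (mixed u u' (o + c)) U)%:M.
Proof.
by rewrite -[LHS]/(_ *m _) -map_mxM mfd_sq map_scalar_mx.
Qed.

Lemma dint_step (b : 'I_a) : inc b *: ddm b = dint b - dint b.+1.
Proof.
by apply/matrixP=> i j; rewrite !mxE ddiffP eE addnS.
Qed.

Lemma scale_reg (b : 'I_a) (M M' : 'M[A]_r) : inc b *: M = inc b *: M' -> M = M'.
Proof.
move=> h; apply/matrixP=> i j; apply: (u_reg (i := b)).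
by have := congr1 (fun M : 'M[A]_r => M i j) h; rewrite !mxE.
Qed.

Lemma scale_mull (c : A) (M M' : 'M[A]_r) : c *: (M * M') = (c *: M) * M'.
Proof. exact: scalemxAl. Qed.

Lemma scale_mulr (c : A) (M M' : 'M[A]_r) : c *: (M * M') = M * (c *: M').
Proof. exact: scalemxAr. Qed.

Lemma dint_sq_step (b : 'I_a) : dint b * dint b - dint b.+1 * dint b.+1 = inc b *: (ddU b)%:M.
Proof.
rewrite !dint_sq -raddfB scale_scalar_mx; congr (_%:M).
by rewrite /inc /ddU ddiffP eE addnS.
Qed.

(** After multiplication by the regular [inc b] the left side telescopes to a difference of squares
    of d_X at consecutive points, that is, of values of [U]. *)
Lemma dint_anti (b : 'I_a) : dint b * ddm b + ddm b * dint b.+1 = (ddU b)%:M.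
Proof.
apply: (@scale_reg b); rewrite scalerDr scale_mulr scale_mull dint_step.
by rewrite -dint_sq_step mulrBr mulrBl addrA subrK.
Qed.

Lemma dint_anti' (b : 'I_a) : ddm b * dint b + dint b.+1 * ddm b = (ddU b)%:M.
Proof.
apply: (@scale_reg b); rewrite scalerDr scale_mull scale_mulr dint_step.
by rewrite -dint_sq_step mulrBr mulrBl addrA subrK.
Qed.

Definition fword (T : {set 'I_a}) : 'M[A]_r := \prod_(b <- enum T) ddm b.
Definition bword (T : {set 'I_a}) : 'M[A]_r := \prod_(b <- rev (enum T)) ddm b.

Let scal_comm (c : A) (M : 'M[A]_r) : c%:M * M = M * c%:M.
Proof. by apply: esym; exact: scalar_mxC. Qed.

Let scalE (c : A) (M : 'M[A]_r) : c%:M * M = c *: M.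
Proof. exact: mul_scalar_mx. Qed.

Let sgn_scal c (M : 'M[A]_r) : (-1) ^+ c * M = (-1) ^+ c *: M.
Proof.
elim: c => [|c IHc]; first by rewrite mul1r scale1r.
by rewrite !exprS -mulrA IHc mulN1r -scaleNr mulN1r.
Qed.

Lemma fword_comm (T : {set 'I_a}) :
  map_mx (msub u) (mfd X) * fword T =
  (-1) ^+ #|T| *: (fword T * map_mx (msub u') (mfd X)) +
  \sum_i (sg A T i * (if i \in T then w i else inc i)) *: fword (flip T i).
Proof.
rewrite -dint_first -dint_last.
have := @word_comm _ a dint ddm (fun i => (inc i)%:M) (fun i => (ddU i)%:M).
move=> ->; rewrite ?scal_comm //.
- rewrite -mulrA sgn_scal; congr (_ + _); apply: eq_bigr => i _.
  rewrite -mulrA sgn_scal -scalerA; congr (_ *: _).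
  by case: ifP => _; rewrite scalE ?ddUE.
- by move=> i; rewrite scalE dint_step addrC subrK.
- exact: dint_anti.
Qed.

(** A reversed word is an increasing word of the opposite ring, where [dint_anti'] takes the place
    of [dint_anti]. *)
Lemma bword_comm (T : {set 'I_a}) :
  bword T * map_mx (msub u) (mfd X) =
  (-1) ^+ #|T| *: (map_mx (msub u') (mfd X) * bword T) +
  \sum_i (sg A T i * (if i \in T then w i else inc i)) *: bword (flip T i).
Proof.
rewrite -dint_first -dint_last.
have := @word_comm_if ('M[A]_r)^c a dint ddm (fun i => (inc i)%:M) (fun i => (ddU i)%:M).
have revE (s : {set 'I_a}) : \prod_(b <- enum s) (ddm b : ('M[A]_r)^c) = bword s.
  exact: rev_prodr.
have c1 (i : 'I_a) (x : 'M[A]_r) : x * (inc i)%:M = (inc i)%:M * x by rewrite scal_comm.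
have c2 (i : 'I_a) (x : 'M[A]_r) : x * (ddU i)%:M = (ddU i)%:M * x by rewrite scal_comm.
have c3 (i : 'I_a) : dint i = dint i.+1 + ddm i * (inc i)%:M.
  by rewrite -scal_comm scalE dint_step addrC subrK.
move=> /(_ c1 c2 c3 dint_anti' T); rewrite !revE => h.
have {h} : bword T * dint 0 =
    (let x := dint a * bword T in if odd #|T| then - x else x) +
    \sum_(i < a) (let x := bword (flip T i) * (if i \in T then (ddU i)%:M else (inc i)%:M) in
      if odd #|[set s in T | (s < i)%N]| then - x else x).
  rewrite [LHS]h; congr (_ + _); apply: eq_bigr => i _.
  by rewrite revE.
move=> ->; congr (_ + _).
  by rewrite -signr_odd; case: (odd _); rewrite ?expr1 ?expr0 ?scaleN1r ?scale1r.
apply: eq_bigr => i _; rewrite -scalerA /sg -signr_odd -ddUE.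
have -> : bword (flip T i) * (if i \in T then (ddU i)%:M else (inc i)%:M) =
    (if i \in T then ddU i else inc i) *: bword (flip T i).
  by case: ifP => _; rewrite -scal_comm scalE.
by case: (odd _); rewrite ?expr1 ?expr0 ?scaleN1r ?scale1r.
Qed.

End Interpolation.

(** * Signs, matrix maps and matrix ideals for the chain map computations *)

Section Shuffle.
Variables (A : comNzRingType) (n : nat).
Implicit Types S : {set 'I_n}.

Lemma sgn_card (T : finType) (P : pred T) :
  (-1) ^+ #|[set x | P x]| = \prod_x (if P x then -1 else 1) :> A.
Proof.
rewrite -big_mkcond /= -prodr_const; apply: eq_bigl => x.
by rewrite inE.
Qed.

(** Pairs that avoid [i] contribute equally to both shuffles and cancel, so only inversions with [i]
    remain. Both sides are symmetric under the flip, which allows [i] outside [S]. *)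
Lemma sgn_shuffle_flip S i :
  (-1) ^+ shuffle S * (-1) ^+ shuffle (flip S i) =
  (-1) ^+ (#|S| + (i \in S)) * (sg A S i * sg A (~: S) i).
Proof.
wlog iS : S / i \notin S => [hwlog|].
  have [iS|iS] := boolP (i \in S); last by have := hwlog _ iS; rewrite (negbTE iS).
  have := hwlog (flip S i); rewrite in_flip eqxx iS /= flipK => /(_ isT).
  rewrite mulrC => ->; rewrite card_flip iS addn0 -flip_setC !sg_flipxx.
  by rewrite (cardsD1 i S) iS add1n addn1 /= !exprS !mulN1r opprK.
pose h S s t : A := if [&& s \in S, t \notin S & (t < s)%N] then -1 else 1.
pose common S := \prod_(s | s != i) \prod_(t | t != i) h S s t.
have shE S' : (-1) ^+ shuffle S' =
    (\prod_t h S' i t) * (\prod_(s | s != i) h S' s i) * common S'.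
  rewrite /shuffle sgn_card -(pair_bigA _ (fun s t => h S' s t)) /= (bigD1 i) //=.
  rewrite -mulrA -big_split /=; congr (_ * _); apply: eq_bigr => s _.
  by rewrite (bigD1 i).
have commonE : common (flip S i) = common S.
  apply: eq_bigr => s si; apply: eq_bigr => t ti.
  by rewrite /h !in_flip (negbTE si) (negbTE ti).
have common_sq : common S * common S = 1.
  rewrite -big_split big1 //= => s _; rewrite -big_split big1 //= => t _.
  by rewrite /h; case: ifP => _; rewrite ?mulrNN mulr1.
rewrite !shE commonE mulrACA common_sq mulr1.
have -> : \prod_t h S i t = 1 by apply: big1 => t _; rewrite /h (negbTE iS).
have -> : \prod_(s | s != i) h (flip S i) s i = 1.
  by apply: big1 => s _; rewrite /h [i \in _]in_flip eqxx (negbTE iS) andbF.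
rewrite mul1r mulr1 (negbTE iS) addn0 mulrC.
have -> : \prod_t h (flip S i) i t = sg A (~: S) i.
  rewrite sgE; apply: eq_bigr => t _; rewrite /h !in_flip eqxx (negbTE iS) inE /=.
  by case: (t =P i) => [->|//]; rewrite ltnn !andbF.
rewrite [in RHS]mulrA mulrC; congr (_ * _).
have -> : (-1) ^+ #|S| = \prod_(s | s != i) (if s \in S then -1 else 1) :> A.
  rewrite -prodr_const big_mkcond (bigD1 i) //= (negbTE iS) mul1r.
  by [].
have -> : sg A S i = \prod_(s | s != i) (if (s \in S) && (s < i)%N then -1 else 1).
  by rewrite sgE (bigD1 i) //= (negbTE iS) mul1r.
rewrite -big_split; apply: eq_bigr => s si; rewrite /h iS.
case: (s \in S); rewrite /= ?mulr1 //.
by move: si; rewrite -val_eqE /=; case: ltngtP; rewrite ?mulrNN ?mulr1.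
Qed.

End Shuffle.

Section MatrixMaps.
Variables (B : comNzRingType) (I : finType) (p : I -> bool) (d : I -> I -> B).
Let M : gfree B := GFree idfun p d.
Variable N : gfree B.

Lemma gmatrix_mor (K : gidx N -> I -> gring N) :
  (forall x S, gpar x != p S -> K x S = 0) ->
  (forall x S, \sum_T K x T * Defs.gact N (d T S) = \sum_y gdmx x y * K y S) ->
  gmor ((fun u => [ffun x => \sum_S K x S * Defs.gact N (u S)]) : gel M -> gel N).
Proof.
move=> K_par K_comm; split=> [b u v|q u hu x xq|u].
- apply/ffunP=> x; rewrite !ffunE mulr_sumr -big_split; apply: eq_bigr => S _.
  by rewrite !ffunE rmorphD rmorphM mulrDr mulrCA.
- rewrite ffunE big1 // => S _; have [Sq|Sq] := eqVneq (p S) q.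
    by rewrite K_par ?mul0r // Sq.
  by rewrite hu ?rmorph0 ?mulr0.
- apply/ffunP=> x; rewrite !ffunE.
  under eq_bigr do rewrite ffunE rmorph_sum mulr_sumr.
  under [RHS]eq_bigr do rewrite ffunE mulr_sumr.
  rewrite exchange_big [RHS]exchange_big; apply: eq_bigr => S _ /=.
  under eq_bigr do rewrite rmorphM mulrA.
  under [RHS]eq_bigr do rewrite mulrA.
  by rewrite -!mulr_suml K_comm.
Qed.

Variable res : gring N -> B.
Hypothesis resD : forall f g, res (f + g) = res f + res g.
Hypothesis resM : forall b f, res (Defs.gact N b * f) = b * res f.

(** An evaluation commutes with differentials only modulo the partial derivatives; the commutation
    is therefore required after [res], against an arbitrary factor [h]. *)
Lemma gresidue_mor (K : I -> gidx N -> gring N) :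
  (forall S x, gpar x != p S -> K S x = 0) ->
  (forall S y h, res ((\sum_x K S x * gdmx x y -
     \sum_T Defs.gact N (d S T) * K T y) * h) = 0) ->
  gmor ((fun u => [ffun S => \sum_x res (K S x * u x)]) : gel N -> gel M).
Proof.
have res0 : res 0 = 0 by rewrite -[0](mulr0 (Defs.gact N 0)) resM mul0r.
have res_sum (J : finType) (F : J -> gring N) : res (\sum_j F j) = \sum_j res (F j).
  exact: (big_morph _ resD res0).
move=> K_par K_comm; split=> [b u v|q u hu S Sq|u].
- apply/ffunP=> S; rewrite !ffunE mulr_sumr -big_split; apply: eq_bigr => x _.
  by rewrite /= !ffunE -resM -resD mulrDr mulrCA.
- rewrite ffunE big1 // => x _; have [xq|xq] := eqVneq (gpar x) q.
    by rewrite K_par ?mul0r // xq eq_sym.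
  by rewrite hu ?mulr0.
- apply/ffunP=> S; rewrite !ffunE.
  have -> : \sum_x res (K S x * gdiff u x) =
      \sum_y res ((\sum_x K S x * gdmx x y) * u y).
    rewrite -!res_sum; congr res.
    under eq_bigr do rewrite ffunE mulr_sumr.
    rewrite exchange_big; apply: eq_bigr => y _; rewrite mulr_suml.
    by apply: eq_bigr => x _; rewrite mulrA.
  under [RHS]eq_bigr do rewrite ffunE mulr_sumr.
  rewrite exchange_big; apply: eq_bigr => y _ /=.
  have -> : \sum_T d S T * res (K T y * u y) =
      res ((\sum_T Defs.gact N (d S T) * K T y) * u y).
    rewrite mulr_suml res_sum; apply: eq_bigr => T _.
    by rewrite -mulrA resM.
  have := K_comm S y (u y); rewrite mulrBl => /(congr1 (+%R^~ (res
    ((\sum_T Defs.gact N (d S T) * K T y) * u y)))).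
  by rewrite -resD subrK add0r.
Qed.

End MatrixMaps.

Section Derivations.
Variable k : comNzRingType.

Lemma mpoly_alg_ind (a : nat) (P : {mpoly k[a]} -> Prop) :
  (forall c, P c%:MP) -> (forall i, P 'X_i) ->
  (forall p q, P p -> P q -> P (p + q)) -> (forall p q, P p -> P q -> P (p * q)) ->
  forall p, P p.
Proof.
move=> PC PX PD PM p; rewrite [p]mpolyE.
elim/big_rec: _ => [|mon q _ Pq]; first by rewrite -mpolyC0; exact: PC.
apply: (PD _ _ _ Pq); rewrite -mul_mpolyC; apply: (PM); first exact: PC.
rewrite mpolyXE_id; elim/big_rec: _ => [|i q' _ Pq']; first exact: (PC 1).
apply: (PM _ _ _ Pq'); elim: (mon i) => [|e Pe]; first exact: (PC 1).
by rewrite exprS; apply: (PM).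
Qed.

Lemma mderiv_msubX a b (e : 'I_a -> 'I_b) (p : {mpoly k[a]}) j :
  injective e ->
  mderiv (e j) (msub (fun i => 'X_(e i)) p) = msub (fun i => 'X_(e i)) (mderiv j p).
Proof.
move=> e_inj; elim/mpoly_alg_ind: p => [c|i|p q ep eq|p q ep eq].
- by rewrite msubC !mderivC rmorph0.
- rewrite msubX !mderivX !mnm1E (inj_eq e_inj) msubZ.
  case: (i =P j) => [->|_]; last by rewrite !scale0r.
  have U0 c (l : 'I_c) : (U_(l) - U_(l))%MM = 0%MM.
    by apply/mnmP=> l'; rewrite mnmBE mnm0E subnn.
  by rewrite !U0 !mpolyX0 ?rmorph1.
- by rewrite rmorphD !mderivD rmorphD ep eq.
- by rewrite rmorphM !mderivM rmorphD !rmorphM ep eq.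
Qed.

Lemma mderiv_msubX0 a b (e : 'I_a -> 'I_b) (p : {mpoly k[a]}) v :
  (forall i, v != e i) -> mderiv v (msub (fun i => 'X_(e i)) p) = 0.
Proof.
move=> ve; elim/mpoly_alg_ind: p => [c|i|p q ep eq|p q ep eq].
- by rewrite msubC mderivC.
- by rewrite msubX mderivX mnm1E eq_sym (negbTE (ve i)) scale0r.
- by rewrite rmorphD mderivD ep eq addr0.
- by rewrite rmorphM mderivM ep eq mul0r mulr0 addr0.
Qed.

End Derivations.

Section TensorSums.
Variables (A : comNzRingType) (I J : finType) (p : I -> bool).
Variables (d : I -> I -> A) (d' : J -> J -> A) (F : I * J -> A).

Lemma tens_row i j :
  \sum_y tens_dmx p d d' (i, j) y * F y =
  \sum_i' d i i' * F (i', j) + (-1) ^+ p i * \sum_j' d' j j' * F (i, j').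
Proof.
have := tens_act p d d' (finfun F) i j; rewrite ffunE.
under eq_bigr do rewrite ffunE; move=> ->.
by congr (_ + _ * _); apply: eq_bigr => l _; rewrite ffunE.
Qed.

Lemma tens_col i' j' :
  \sum_x F x * tens_dmx p d d' x (i', j') =
  \sum_i F (i, j') * d i i' + (-1) ^+ p i' * \sum_j F (i', j) * d' j j'.
Proof.
rewrite (eq_bigr (fun x : I * J => (F (x.1, j') * d x.1 i') * (x.2 == j')%:R +
    (x.1 == i')%:R * ((-1) ^+ p i' * (F (i', x.2) * d' x.2 j')))); last first.
  case=> i j _ /=; rewrite /tens_dmx /= mulrDr; congr (_ + _).
    by rewrite mulrA; case: (j =P j') => [->|_] //; rewrite !mulr0.
  case: (i =P i') => [->|_] /=; last by rewrite mulr0 !mul0r mulr0.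
  by rewrite mulr1 mul1r mulrCA.
rewrite big_split /=; congr (_ + _).
  rewrite -(pair_bigA _ (fun i j => F (i, j') * d i i' * (j == j')%:R)) /=.
  apply: eq_bigr => i _.
  by rewrite (sum_deltar j' (fun=> F (i, j') * d i i')).
rewrite -(pair_bigA _ (fun i j => (i == i')%:R * ((-1) ^+ p i' * (F (i', j) * d' j j')))) /=.
rewrite exchange_big mulr_sumr; apply: eq_bigr => j _ /=.
rewrite -[RHS](sum_deltal i' (fun=> (-1) ^+ p i' * (F (i', j) * d' j j'))).
by apply: eq_bigr => i _; rewrite eq_sym.
Qed.

End TensorSums.

Section MatrixIdeal.
Variables (A : comNzRingType) (r : nat) (J : finType) (v : J -> A).
Implicit Types M : 'M[A]_r.

Definition mxideal M := exists Z : J -> 'M[A]_r, M = \sum_j v j *: Z j.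

Lemma mxideal0 : mxideal 0.
Proof. by exists (fun=> 0); rewrite big1 // => j _; rewrite scaler0. Qed.

Lemma mxidealD M M' : mxideal M -> mxideal M' -> mxideal (M + M').
Proof.
case=> Z -> [Z' ->]; exists (fun j => Z j + Z' j).
by rewrite -big_split; apply: eq_bigr => j _; rewrite scalerDr.
Qed.

Lemma mxidealN M : mxideal M -> mxideal (- M).
Proof.
case=> Z ->; exists (fun j => - Z j).
by rewrite -sumrN; apply: eq_bigr => j _; rewrite scalerN.
Qed.

Lemma mxidealMl M' M : mxideal M -> mxideal (M' * M).
Proof.
case=> Z ->; exists (fun j => M' * Z j); rewrite mulr_sumr.
by apply: eq_bigr => j _; rewrite [RHS]scalemxAr.
Qed.

Lemma mxidealMr M' M : mxideal M -> mxideal (M * M').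
Proof.
case=> Z ->; exists (fun j => Z j * M'); rewrite mulr_suml.
by apply: eq_bigr => j _; rewrite [RHS]scalemxAl.
Qed.

Lemma mxideal_gen j : mxideal (v j)%:M.
Proof.
exists (fun j' => (j' == j)%:R%:M); rewrite (bigD1 j) //= eqxx big1 => [|j' /negbTE ->].
  by rewrite addr0 scale_scalar_mx mulr1.
by rewrite scale_scalar_mx mulr0 raddf0.
Qed.

Lemma mxideal_anticomm (T : Type) (D : 'M[A]_r) (mu : T -> 'M[A]_r) (s : seq T) :
  (forall t, mxideal (D * mu t + mu t * D)) ->
  mxideal (D * (\prod_(t <- s) mu t) - (-1) ^+ size s * (\prod_(t <- s) mu t) * D).
Proof.
move=> hmu; elim: s => [|t s IHs] /=.
  by rewrite big_nil mulr1 !mul1r subrr; exact: mxideal0.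
rewrite big_cons; set P := \prod_(t <- s) mu t in IHs *.
have -> : D * (mu t * P) - (-1) ^+ (size s).+1 * (mu t * P) * D =
    (D * mu t + mu t * D) * P - mu t * (D * P - (-1) ^+ size s * P * D).
  rewrite exprS mulN1r !mulNr opprK mulrBr mulrDl opprB !mulrA.
  rewrite (_ : (-1) ^+ size s * mu t = mu t * (-1) ^+ size s); last first.
    by apply/commr_sym/commrX/commrN1.
  by rewrite addrACA subrr addr0.
apply: mxidealD; first exact: mxidealMr.
by apply: mxidealN; exact: mxidealMl.
Qed.

End MatrixIdeal.

Section MatrixParity.
Variables (A : comNzRingType) (r : nat) (p : 'I_r -> bool).
Implicit Types M : 'M[A]_r.

Definition mxpar q M := forall i j, p i (+) p j != q -> M i j = 0.

Lemma mxpar_mul q q' M M' : mxpar q M -> mxpar q' M' -> mxpar (q (+) q') (M * M').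
Proof.
move=> hM hM' i j ij; rewrite mxE big1 // => l _.
have [il|il] := eqVneq (p i (+) p l) q; last by rewrite hM ?mul0r.
rewrite hM' ?mulr0 //; apply: contraNneq ij => <-; rewrite -il.
by case: (p i) (p l) (p j) => [] [] [].
Qed.

Lemma mxpar_prod (T : Type) (mu : T -> 'M[A]_r) (s : seq T) :
  (forall t, mxpar true (mu t)) -> mxpar (odd (size s)) (\prod_(t <- s) mu t).
Proof.
move=> hmu; elim: s => [|t s IHs] /=.
  rewrite big_nil => i j ij; rewrite mxE; case: (i =P j) ij => // ->.
  by rewrite addbb.
by rewrite big_cons -addTb; exact: mxpar_mul.
Qed.

End MatrixParity.

Lemma mxpar_mfact (Q A : comNzRingType) (U : Q) (X : mfact U) (f : Q -> A) :
  f 0 = 0 -> mxpar (@mfpar _ _ X) true (map_mx f (mfd X)).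
Proof.
move=> f0 i j ij; rewrite mxE mfd_odd //.
by move: ij; case: (mfpar i); case: (mfpar j).
Qed.

Lemma ddiff0 (k : comNzRingType) a b (u u' : 'I_a -> {mpoly k[b]}) v : ddiff u u' v 0 = 0.
Proof. by rewrite /ddiff msupp0 big_nil. Qed.

Section WordParity.
Variables (k : comNzRingType) (N L a : nat) (U : {mpoly k[N]}) (X : mfact U).
Variables (e : 'I_a -> 'I_N) (u u' : 'I_N -> {mpoly k[L]}).

Let ddm_par b : mxpar (@mfpar _ _ X) true (ddm X e u u' b).
Proof. by apply: mxpar_mfact; exact: ddiff0. Qed.

Lemma fword_par (T : {set 'I_a}) : mxpar (@mfpar _ _ X) (odd #|T|) (fword X e u u' T).
Proof. by rewrite cardE; apply: mxpar_prod; exact: ddm_par. Qed.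

Lemma bword_par (T : {set 'I_a}) : mxpar (@mfpar _ _ X) (odd #|T|) (bword X e u u' T).
Proof. by rewrite cardE -size_rev; apply: mxpar_prod; exact: ddm_par. Qed.

End WordParity.

Section MfactDerivatives.
Variables (k : comNzRingType) (N : nat) (U : {mpoly k[N]}) (X : mfact U).
Definition mfderiv v : 'M[{mpoly k[N]}]_(mfrk X) := map_mx (mderiv v) (mfd X).

(** The derivative of d_X squared = U. *)
Lemma mfderiv_anti v : mfd X * mfderiv v + mfderiv v * mfd X = (mderiv v U)%:M.
Proof.
have := congr1 (fun D : 'M[{mpoly k[N]}]_(mfrk X) => map_mx (mderiv v) D) (mfd_sq X).
move=> h; transitivity (map_mx (mderiv v) (U%:M : 'M[{mpoly k[N]}]_(mfrk X))); last first.
  by apply/matrixP=> i j; rewrite !mxE raddfMn.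
rewrite -h; apply/matrixP=> i j; rewrite !mxE raddf_sum -big_split.
apply: eq_bigr => l _; rewrite !mxE [RHS]mderivM addrC.
by [].
Qed.

End MfactDerivatives.

Section PotentialDerivatives.
Variables (k : comNzRingType) (n m : nat) (W : {mpoly k[n]}) (V : {mpoly k[m]}).

Lemma mderivz_U j : mderiv (rshift n j) (inz n V - inx m W) = inz n (grad V j).
Proof.
rewrite mderivB [X in X - _]mderiv_msubX; last exact: rshift_inj.
by rewrite [X in _ - X]mderiv_msubX0 ?subr0 // => i; rewrite eq_shift.
Qed.

Lemma mderivx_U i : mderiv (lshift m i) (inz n V - inx m W) = - inx m (grad W i).
Proof.
rewrite mderivB [X in _ - X]mderiv_msubX; last exact: lshift_inj.
by rewrite [X in X - _]mderiv_msubX0 ?sub0r // => j; rewrite eq_shift.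
Qed.

End PotentialDerivatives.

Section PotentialResidue.
Variables (k : comNzRingType) (n : nat) (W : {mpoly k[n]}).
Hypothesis W_pot : potential W.

Lemma res_linear c f g :
  residue (grad W) (c *: f + g) = c * residue (grad W) f + residue (grad W) g.
Proof. by have [_ [N [b /residueP hb]] _] := W_pot; exact: (residue_linear hb). Qed.

Lemma res_grad i h : residue (grad W) (grad W i * h) = 0.
Proof.
have [_ [N [b /residueP hb]] _] := W_pot; apply: (residue_ideal hb).
by rewrite mulrC; apply: in_idealM; exact: in_ideal_gen.
Qed.

End PotentialResidue.

Lemma odd_setC (n : nat) (S : {set 'I_n}) : ~~ odd n -> odd #|~: S| = odd #|S|.
Proof.
move=> n_even; have := cardsC S; rewrite card_ord => /(congr1 odd).
by rewrite oddD (negbTE n_even); case: (odd _); case: (odd _).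
Qed.

Lemma size_index_ord n : size (index_enum 'I_n) = n.
Proof. by rewrite -sum1_size sum1_card card_ord. Qed.

(** * Evaluations and coevaluations are chain maps *)

Section ChainMaps.
Variables (k : comNzRingType) (n m : nat).
Hypothesis n_even : ~~ odd n.
Hypothesis m_even : ~~ odd m.
Variables (W : {mpoly k[n]}) (V : {mpoly k[m]}) (X : mfact (inz n V - inx m W)).
Notation r := (mfrk X).
Notation d := (mfd X).
Notation par := (@mfpar _ _ X).

Section LeftChainMaps.
Notation A := {mpoly k[n + m + n]}.
Notation P := (@lp k n m).
Notation P' := (@lp' k n m).
Let e : 'I_n -> 'I_(n + m) := @lshift n m.
Let act : {rmorphism _ -> A} := msub (pt (@l_x k n m) (@l_x' k n m)).
Let wl (i : 'I_n) : A := act (ddiff (@fstv k n) (@sndv k n) i W).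
Let dl : 'M[A]_r := map_mx (msub P) d.
Let dr : 'M[A]_r := map_mx (msub P') d.

Let eE i : e i = (0 + i)%N :> nat. Proof. by []. Qed.

Let lp_eq v : (forall i, v != e i) -> P v = P' v.
Proof.
rewrite /lp /lp'; move: v; apply: split_ind => [i /(_ i)|j _]; last by rewrite !ptE.
by rewrite eqxx.
Qed.

Let lp_reg i : GRing.lreg (P (e i) - P' (e i)).
Proof. by rewrite /lp /lp' !ptE; apply: lreg_subX; rewrite eq_shift. Qed.

Let act_inc i : act (@fstv k n i - @sndv k n i) = inc e P P' i.
Proof. by rewrite rmorphB !msubX !ptE /inc /lp /lp' !ptE. Qed.

(** The points differ in x only, so V contributes equal values, and W enters the potential with a
    minus sign. *)
Let ddU_l i : ddU (inz n V - inx m W) e P P' i = - wl i.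
Proof.
apply: (lp_reg (i := i)); rewrite mulrN /ddU ddiffP.
have -> : P (e i) - P' (e i) = act (@fstv k n i - @sndv k n i) by rewrite act_inc.
rewrite /wl -rmorphM ddiffP !rmorphB.
have Vc c : (c <= n)%N -> msub (mixed P P' c) (inz n V) = msub (@l_z k n m) V.
  move=> le_cn; rewrite msub_comp; apply: eq_msub => j; rewrite msubX /mixed /=.
  by rewrite ltnNge (leq_trans le_cn) ?leq_addr //= /lp ptE.
have Wc c : msub (mixed P P' c) (inx m W) =
    act (msub (mixed (@fstv k n) (@sndv k n) c) W).
  rewrite !msub_comp; apply: eq_msub => j; rewrite msubX /mixed /=.
  by case: ifP => _; rewrite /lp /lp' ptE [RHS]msubX ptE.
rewrite [nat_of_ord (e i)]/(nat_of_ord i) (Vc i (ltnW (ltn_ord i))) (Vc i.+1 (ltn_ord i)) !Wc.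
by rewrite !opprB addrC addrA subrK.
Qed.

Let fw : {set 'I_n} -> 'M[A]_r := fword X e P P'.
Let bw : {set 'I_n} -> 'M[A]_r := bword X e P P'.

Let fw_comm := fword_comm X eE lp_eq lp_reg ddU_l.
Let bw_comm := bword_comm X eE lp_eq lp_reg ddU_l.
Let fw_par := @fword_par _ _ _ _ _ X e P P'.
Let bw_par := @bword_par _ _ _ _ _ X e P P'.
Let dl_par : mxpar par true dl. Proof. by apply: mxpar_mfact; exact: rmorph0. Qed.
Let dr_par : mxpar par true dr. Proof. by apply: mxpar_mfact; exact: rmorph0. Qed.

Let coevtE ij S : @coevt_mx k n m W V X ij S =
  (-1) ^+ ((~~ odd #|S|) && par ij.2) * (-1) ^+ shuffle S * bw (~: S) ij.2 ij.1.
Proof.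
by rewrite /coevt_mx exprD -[in LHS]signr_odd oddM /= odd_setC // oddb.
Qed.

(** The two tensor differentials place d_X on the left and on the right of the word of the
    complement of [S], and [bword_comm] compares the two placements. Its correction terms flip one
    index of the complement, hence one of [S], and match the Koszul differential once the shuffle
    signs are compared. *)
Lemma coevt_mor : gmor (@coevt k n m W V X).
Proof.
apply: (@gmatrix_mor _ _ _ _ (XdualX X) (@coevt_mx k n m W V X)) => [[i j] S|[i j] S].
  rewrite /= /tens_par /= coevtE => ij; rewrite bw_par ?mulr0 //=.
  by rewrite addbC odd_setC.
have -> : \sum_T @coevt_mx k n m W V X (i, j) T * Defs.gact (XdualX X) (gdmx (g := Delta W) T S) =
    \sum_b sg A S b * (if b \in S then inc e P P' b else wl b) * @coevt_mx k n m W V X (i, j) (flip S b).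
  under eq_bigr => T _ do rewrite [Defs.gact _ _]rmorph_koszul.
  by rewrite koszul_col; apply: eq_bigr => b _; rewrite act_inc.
rewrite [RHS]tens_row.
set L := odd #|S|.
have -> : \sum_i' dual_dmx par (fun i j => msub P (d i j)) i i' * @coevt_mx k n m W V X (i', j) S =
   - (-1) ^+ (par j (+) L) * (-1) ^+ (~~ L && par j) * (-1) ^+ shuffle S * (bw (~: S) * dl) j i.
  rewrite mxE mulr_sumr; apply: eq_bigr => i' _; rewrite coevtE /dual_dmx ![(_, _).2]/= ![(_, _).1]/=.
  rewrite [dl i' i]mxE.
  (* An entry of a word vanishes unless its parity is that of the word. The sign of the summation
     index is thus constant on the nonzero terms and leaves the sum. *)
  have [ji'|ji'] := eqVneq (par j (+) par i') L; last first.
    by rewrite bw_par ?odd_setC //; rewrite !(mulr0, mul0r).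
  have -> : par i' = par j (+) L by rewrite -ji' addKb.
  by ring.
have -> : \sum_j' msub P' (d j j') * @coevt_mx k n m W V X (i, j') S =
   (-1) ^+ (par i) * (-1) ^+ (par j) * (-1) ^+ (~~ L && par j) * (-1) ^+ shuffle S * (dr * bw (~: S)) j i.
  rewrite mxE mulr_sumr; apply: eq_bigr => j' _; rewrite coevtE ![(_, _).2]/= ![(_, _).1]/=.
  rewrite [dr j j']mxE.
  have [jj'|jj'] := eqVneq (par j (+) par j') true; last first.
    by have := dr_par jj'; rewrite mxE => ->; rewrite !(mulr0, mul0r).
  have [ij'|ij'] := eqVneq (par j' (+) par i) L; last first.
    by rewrite bw_par ?odd_setC //; rewrite !(mulr0, mul0r).
  have -> : par j' = ~~ par j by move: jj'; case: (par j); case: (par j').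
  have -> : par i = ~~ par j (+) L.
    by move: jj'; rewrite -ij'; case: (par i); case: (par j); case: (par j').
  move: (bw _ _ _) (msub _ _) ((-1) ^+ shuffle S) => x y z.
  by rewrite -/L; case: (par j); case: (L); rewrite /= ?expr0 ?expr1; ring.
have -> : (bw (~: S) * dl) j i = (-1) ^+ L * (dr * bw (~: S)) j i +
    \sum_b sg A (~: S) b * (if b \in S then inc e P P' b else - wl b) *
      bw (~: flip S b) j i.
  rewrite bw_comm mxE summxE [X in X + _]mxE -signr_odd odd_setC //; congr (_ + _).
  apply: eq_bigr => b _; rewrite mxE flip_setC in_setC.
  by case: (b \in S).
rewrite mulrDr -addrA addrC -addrA [X in _ = _ + X](_ : _ = 0) ?addr0; last first.
  move: ((dr * _) j i) ((-1) ^+ shuffle S) => x y.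
  by case: (par i); case: (par j); case: (L); rewrite /= ?expr0 ?expr1; ring.
rewrite mulr_sumr; apply: eq_bigr => b _; rewrite coevtE ![(_, _).2]/= ![(_, _).1]/=.
rewrite odd_flip negbK -/L.
have sh_flip : (-1) ^+ shuffle (flip S b) =
    (-1) ^+ shuffle S * ((-1) ^+ L * (-1) ^+ (b \in S)) * (sg A S b * sg A (~: S) b) :> A.
  have := sgn_shuffle_flip A S b => /(congr1 ( *%R ((-1) ^+ shuffle S))).
  by rewrite mulrA -expr2 sqrr_sign mul1r exprD signr_odd mulrA.
rewrite sh_flip.
have := sgK A S b.
move: (sg A S b) (sg A (~: S) b) ((-1) ^+ shuffle S) (bw _ _ _) (wl b) (inc e P P' b).
move=> x y z t w v xx.
transitivity ((x * x) * (y * z * t * ((-1) ^+ (L && par j) * ((-1) ^+ L * (-1) ^+ (b \in S))) *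
  (if b \in S then v else w))); first by move: (if _ then _ else _) => c; ring.
by rewrite xx mul1r; case: (b \in S); case: (par j); case: (L); rewrite /= ?expr0 ?expr1; ring.
Qed.

Let Lam : 'M[A]_r := \prod_(j < m) map_mx (msub P) (dz X j).
Let vl (j : 'I_m) : A := msub (@l_z k n m) (grad V j).

Let Lam_par : mxpar par false Lam.
Proof.
have := @mxpar_prod A r par 'I_m (fun j => map_mx (msub P) (dz X j)) (index_enum 'I_m).
rewrite size_index_ord (negbTE m_even); apply=> j.
rewrite -map_mx_comp; apply: mxpar_mfact => /=.
by rewrite mderiv0 [LHS]mmap0.
Qed.

(** Each factor anticommutes with d_X up to a derivative of V, and the number [m] of factors is
    even. *)
Let Lam_comm : mxideal vl (dl * Lam - Lam * dl).
Proof.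
have := @mxideal_anticomm A r 'I_m vl 'I_m dl (fun j => map_mx (msub P) (dz X j)) (index_enum 'I_m).
rewrite size_index_ord -signr_odd (negbTE m_even) mul1r.
apply=> j; have -> : dl * map_mx (msub P) (dz X j) + map_mx (msub P) (dz X j) * dl =
    map_mx (msub P) (d *m dz X j + dz X j *m d).
  by rewrite map_mxD !map_mxM.
have -> : d *m dz X j + dz X j *m d = (inz n (grad V j))%:M.
  by rewrite -(mderivz_U W) -mfderiv_anti.
rewrite map_scalar_mx; have -> : msub P (inz n (grad V j)) = vl j by exact: msub_ptr.
exact: mxideal_gen.
Qed.

Let evE S ij : @ev_mx k n m W V X S ij =
  (-1) ^+ 'C(#|S|, 2) * (-1) ^+ (odd #|S| && par ij.2) * (Lam * fw S) ij.1 ij.2.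
Proof.
rewrite /ev_mx 2!exprD -[(-1) ^+ m]signr_odd (negbTE m_even) mulr1.
by rewrite -[X in _ * X * _]signr_odd oddM oddb.
Qed.

Let M_par (S : {set 'I_n}) : mxpar par (odd #|S|) (Lam * fw S).
Proof. by have := mxpar_mul Lam_par (@fw_par S); rewrite addFb. Qed.

Hypothesis V_pot : potential V.

Lemma res_lD f h : @res_l k n m V (f + h) = res_l V f + res_l V h.
Proof. exact: (coef_extD (res_linear V_pot)). Qed.

Lemma res_lM c f : @res_l k n m V (act c * f) = c * res_l V f.
Proof.
apply: (coef_extM (res_linear V_pot)).
by apply: split_ind => i; rewrite ptE [LHS]mmapX mmap1U !ptE.
Qed.

Lemma res_l_grad j f : @res_l k n m V (msub (@l_z k n m) (grad V j) * f) = 0.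
Proof.
apply: (coef_ext_ideal (res_linear V_pot)); last exact: res_grad.
by move=> i; rewrite [LHS]mmapX mmap1U !ptE.
Qed.

Lemma ev_mor : gmor (@ev k n m W V X).
Proof.
apply: (gresidue_mor (p := @theta_par n) (N := XdualX X)).
- exact: res_lD.
- exact: res_lM.
- move=> S [i j]; rewrite /= /tens_par /= evE => ij; rewrite M_par ?mulr0 //.
move=> S [i j] h; rewrite [X in X - _]tens_col.
set L := odd #|S|; set ep : A := (-1) ^+ 'C(#|S|, 2).
have -> : \sum_i' @ev_mx k n m W V X S (i', j) * dual_dmx par (fun i j => msub P (d i j)) i' i =
   - (-1) ^+ (par i) * ep * (-1) ^+ (L && par j) * (dl * (Lam * fw S)) i j.
  rewrite mxE mulr_sumr; apply: eq_bigr => i' _.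
  rewrite evE /dual_dmx ![(_, _).2]/= ![(_, _).1]/= [dl _ _]mxE.
  rewrite -/L -/ep; move: ((Lam * fw S) i' j) (msub P (d i' i)) => x z.
  by move: (par i) (_ && _) => b1 b2; ring.
have -> : \sum_j' @ev_mx k n m W V X S (i, j') * msub P' (d j' j) =
   ep * (-1) ^+ (L && ~~ par j) * ((Lam * fw S) * dr) i j.
  rewrite mxE mulr_sumr; apply: eq_bigr => j' _.
  rewrite evE ![(_, _).2]/= ![(_, _).1]/= [dr _ _]mxE.
  have [jj'|jj'] := eqVneq (par j' (+) par j) true; last first.
    by have := dr_par jj'; rewrite mxE => ->; rewrite !(mulr0, mul0r).
  have -> : par j' = ~~ par j by move: jj'; case: (par j); case: (par j').
  by rewrite !mulrA.
have -> : \sum_T Defs.gact (XdualX X) (gdmx (g := Delta W) S T) * @ev_mx k n m W V X T (i, j) =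
    \sum_b sg A S b * (if b \in S then wl b else inc e P P' b) * @ev_mx k n m W V X (flip S b) (i, j).
  under eq_bigr => T _ do rewrite [Defs.gact _ _]rmorph_koszul.
  by rewrite koszul_row; apply: eq_bigr => b _; rewrite act_inc.
(* The cost of carrying d_X past Lambda. It lies in the ideal of the derivatives of V, so the
   residue kills it at the end; everything else cancels exactly. *)
set Z := (dl * Lam - Lam * dl) * fw S.
have -> : (dl * (Lam * fw S)) i j = Z i j + ((-1) ^+ L * ((Lam * fw S) * dr) i j +
    \sum_b sg A S b * (if b \in S then - wl b else inc e P P' b) * (Lam * fw (flip S b)) i j).
  have -> : dl * (Lam * fw S) = Z + Lam * (dl * fw S) by rewrite /Z mulrBl !mulrA subrK.
  have addE (M N : 'M[A]_r) : (M + N) i j = M i j + N i j by rewrite mxE.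
  have scaleE c (M : 'M[A]_r) : (c *: M) i j = c * M i j by rewrite mxE.
  rewrite addE fw_comm mulrDr mulr_sumr addE summxE; congr (_ + (_ + _)).
    by rewrite -[Lam * _]scalemxAr scaleE signr_odd -[Lam *m _]/(Lam * (fw S * dr)) mulrA.
  by apply: eq_bigr => b _; rewrite -[Lam * _]scalemxAr scaleE.
set y := ((Lam * fw S) * dr) i j; set s1 := \sum_b _; set s2 := \sum_b _.
set c := - (-1) ^+ par i * ep * (-1) ^+ (L && par j).
have c_y : c * ((-1) ^+ L * y) + (-1) ^+ par i * (ep * (-1) ^+ (L && ~~ par j) * y) = 0.
  rewrite /c; move: (y) (ep) (par i) => x z b0.
  by case: (par j); case: (L); rewrite /= ?expr0 ?expr1; ring.
have c_s : c * s1 = s2.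
  rewrite /s1 /s2 mulr_sumr; apply: eq_bigr => b _; rewrite evE ![(_, _).2]/= ![(_, _).1]/=.
  have [ij|ij] := eqVneq (par i (+) par j) (~~ L); last first.
    by rewrite M_par ?odd_flip // !mulr0.
  (* Adding a letter to a word of length l changes the binomial by l, removing one changes it by l -
     1. *)
  have -> : (-1) ^+ 'C(#|flip S b|, 2) = ep * (-1) ^+ (L (+) (b \in S)) :> A.
    rewrite /ep card_flip; case: ifP => bS; last first.
      by rewrite addbF /L signr_odd binS bin1 exprD.
    have [l Sl] : exists l, #|S| = l.+1 by exists #|S :\ b|; rewrite (cardsD1 b S) bS.
    rewrite /L Sl /= binS bin1 exprD -mulrA -[(-1) ^+ l]signr_odd addbT negbK.
    by rewrite -signr_addb addbb mulr1.
  rewrite odd_flip -/L /c; have -> : par i = ~~ L (+) par j by rewrite -ij addbK.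
  move: (sg _ _ _) ((Lam * _) i j) (ep) (wl b) (inc _ _ _ _) => x1 x2 x3 x4 x5.
  by case: (b \in S); case: (par j); case: (L); rewrite /= ?expr0 ?expr1; ring.
have -> : c * (Z i j + ((-1) ^+ L * y + s1)) +
    (-1) ^+ par i * (ep * (-1) ^+ (L && ~~ par j) * y) - s2 = c * Z i j.
  move/eqP: c_y; rewrite addr_eq0 !mulrDr c_s => /eqP ->.
  by move: (c * Z i j) (s2) ((-1) ^+ par i * _) => x1 x2 x3; ring.
have [z ->] : mxideal vl Z := mxidealMr (fw S) Lam_comm.
rewrite summxE mulr_sumr mulr_suml.
have res_sum (F : 'I_m -> A) : @res_l k n m V (\sum_j F j) = \sum_j res_l V (F j).
  exact: (big_morph _ res_lD (coef_ext0 (res_linear V_pot) _)).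
rewrite res_sum big1 // => l _; rewrite mxE mulrCA -mulrA; exact: res_l_grad.
Qed.

End LeftChainMaps.

Section RightChainMaps.
Notation A := {mpoly k[m + n + m]}.
Notation P := (@rp k n m).
Notation P' := (@rp' k n m).
Let e : 'I_m -> 'I_(n + m) := @rshift n m.
Let act : {rmorphism _ -> A} := msub (pt (@r_z k n m) (@r_z' k n m)).
Let wl (i : 'I_m) : A := act (ddiff (@fstv k m) (@sndv k m) i V).
Let dl : 'M[A]_r := map_mx (msub P) d.
Let dr : 'M[A]_r := map_mx (msub P') d.

Let eE i : e i = (n + i)%N :> nat. Proof. by []. Qed.

Let rp_eq v : (forall i, v != e i) -> P v = P' v.
Proof.
rewrite /rp /rp'; move: v; apply: split_ind => [j _|i /(_ i)]; first by rewrite !ptE.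
by rewrite eqxx.
Qed.

Let rp_reg i : GRing.lreg (P (e i) - P' (e i)).
Proof. by rewrite /rp /rp' !ptE; apply: lreg_subX; rewrite eq_shift. Qed.

Let act_inc i : act (@fstv k m i - @sndv k m i) = inc e P P' i.
Proof. by rewrite rmorphB !msubX !ptE /inc /rp /rp' !ptE. Qed.

Let ddU_r i : ddU (inz n V - inx m W) e P P' i = wl i.
Proof.
apply: (rp_reg (i := i)); rewrite /ddU ddiffP.
have -> : P (e i) - P' (e i) = act (@fstv k m i - @sndv k m i) by rewrite act_inc.
rewrite /wl -rmorphM ddiffP !rmorphB.
have Wc c : (n <= c)%N -> msub (mixed P P' c) (inx m W) = msub (@r_x k n m) W.
  move=> le_nc; rewrite msub_comp; apply: eq_msub => j; rewrite msubX /mixed /=.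
  by rewrite (leq_trans (ltn_ord j)) //= /rp' ptE.
have Vc c : msub (mixed P P' (n + c)) (inz n V) =
    act (msub (mixed (@fstv k m) (@sndv k m) c) V).
  rewrite !msub_comp; apply: eq_msub => j; rewrite msubX /mixed /= ltn_add2l.
  by case: ifP => _; rewrite /rp /rp' ptE [RHS]msubX ptE.
rewrite [nat_of_ord (e i)]/(n + i)%N -addnS !Vc !Wc ?leq_addr //.
by rewrite opprB addrA subrK.
Qed.

Let fw : {set 'I_m} -> 'M[A]_r := fword X e P P'.
Let bw : {set 'I_m} -> 'M[A]_r := bword X e P P'.

Let fw_comm := fword_comm X eE rp_eq rp_reg ddU_r.
Let bw_comm := bword_comm X eE rp_eq rp_reg ddU_r.
Let fw_par := @fword_par _ _ _ _ _ X e P P'.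
Let bw_par := @bword_par _ _ _ _ _ X e P P'.
Let dl_par : mxpar par true dl. Proof. by apply: mxpar_mfact; exact: rmorph0. Qed.
Let dr_par : mxpar par true dr. Proof. by apply: mxpar_mfact; exact: rmorph0. Qed.

Let coevE ij S : @coev_mx k n m W V X ij S =
  (-1) ^+ 'C(#|~: S|.+1, 2) * (-1) ^+ shuffle S * fw (~: S) ij.1 ij.2.
Proof.
rewrite /coev_mx 3!exprD -[(-1) ^+ m]signr_odd -[(-1) ^+ (m * _)]signr_odd oddM.
by rewrite (negbTE m_even) !mulr1.
Qed.

Lemma coev_mor : gmor (@coev k n m W V X).
Proof.
apply: (@gmatrix_mor _ _ _ _ (XXdual X) (@coev_mx k n m W V X)) => [[i j] S|[i j] S].
  rewrite /= /tens_par /= coevE => ij; rewrite fw_par ?mulr0 //=.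
  by rewrite odd_setC.
have -> : \sum_T @coev_mx k n m W V X (i, j) T * Defs.gact (XXdual X) (gdmx (g := Delta V) T S) =
    \sum_b sg A S b * (if b \in S then inc e P P' b else wl b) * @coev_mx k n m W V X (i, j) (flip S b).
  under eq_bigr => T _ do rewrite [Defs.gact _ _]rmorph_koszul.
  by rewrite koszul_col; apply: eq_bigr => b _; rewrite act_inc.
rewrite [RHS]tens_row.
set L := odd #|S|; set eta : A := (-1) ^+ 'C(#|~: S|.+1, 2) * (-1) ^+ shuffle S.
have -> : \sum_i' msub P (d i i') * @coev_mx k n m W V X (i', j) S =
   eta * (dl * fw (~: S)) i j.
  rewrite mxE mulr_sumr; apply: eq_bigr => i' _.
  rewrite coevE ![(_, _).2]/= ![(_, _).1]/= [dl _ _]mxE -/eta.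
  by rewrite mulrCA.
have -> : \sum_j' dual_dmx par (fun i j => msub P' (d i j)) j j' * @coev_mx k n m W V X (i, j') S =
   - (-1) ^+ (par i (+) L) * eta * (fw (~: S) * dr) i j.
  rewrite mxE mulr_sumr; apply: eq_bigr => j' _.
  rewrite coevE /dual_dmx ![(_, _).2]/= ![(_, _).1]/= [dr _ _]mxE -/eta.
  have [ij'|ij'] := eqVneq (par i (+) par j') L; last first.
    by rewrite fw_par ?odd_setC //; rewrite !(mulr0, mul0r).
  have -> : par j' = par i (+) L by rewrite -ij' addKb.
  move: (fw _ _ _) (msub _ _) (eta) (_ (+) _) => x y z b.
  by ring.
have -> : (dl * fw (~: S)) i j = (-1) ^+ L * (fw (~: S) * dr) i j +
    \sum_b sg A (~: S) b * (if b \in S then inc e P P' b else wl b) *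
      fw (~: flip S b) i j.
  rewrite fw_comm mxE summxE [X in X + _]mxE -signr_odd odd_setC //; congr (_ + _).
  apply: eq_bigr => b _; rewrite mxE flip_setC in_setC.
  by case: (b \in S).
rewrite mulrDr addrAC [X in _ = X + _](_ : _ = 0) ?add0r; last first.
  move: ((fw _ * dr) i j) (eta) => x y.
  by case: (par i); case: (L); rewrite /= ?expr0 ?expr1; ring.
rewrite mulr_sumr; apply: eq_bigr => b _; rewrite coevE ![(_, _).2]/= ![(_, _).1]/=.
have sh_flip : (-1) ^+ shuffle (flip S b) =
    (-1) ^+ shuffle S * ((-1) ^+ L * (-1) ^+ (b \in S)) * (sg A S b * sg A (~: S) b) :> A.
  have := sgn_shuffle_flip A S b => /(congr1 ( *%R ((-1) ^+ shuffle S))).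
  by rewrite mulrA -expr2 sqrr_sign mul1r exprD signr_odd mulrA.
(* The change of this binomial sign equals the extra sign in [sh_flip], so the two cancel and only
   the Koszul sign is left. *)
have bin_flip : (-1) ^+ 'C(#|~: flip S b|.+1, 2) =
    (-1) ^+ 'C(#|~: S|.+1, 2) * ((-1) ^+ L * (-1) ^+ (b \in S)) :> A.
  rewrite /L -(odd_setC S m_even) -flip_setC card_flip in_setC.
  case: (boolP (b \in S)) => bS /=.
    by rewrite binS bin1 exprD signr_odd exprSr.
  have [l Sl] : exists l, #|~: S| = l.+1.
    by exists #|~: S :\ b|; rewrite (cardsD1 b (~: S)) in_setC bS.
  rewrite Sl signr_odd [in RHS]binS bin1 exprD mulr1 -mulrA.
  by rewrite -expr2 sqrr_sign mulr1.
rewrite sh_flip bin_flip /eta.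
have := sgK A S b.
move: (sg A S b) (sg A (~: S) b) ((-1) ^+ shuffle S) (fw _ _ _) (if _ then _ else _)
  ((-1) ^+ 'C(_, 2)).
move=> x y z t c u xx.
have sq : ((-1) ^+ L * (-1) ^+ (b \in S)) * ((-1) ^+ L * (-1) ^+ (b \in S)) = 1 :> A.
  by rewrite -signr_addb -expr2 sqrr_sign.
transitivity ((x * x) * (((-1) ^+ L * (-1) ^+ (b \in S)) * ((-1) ^+ L * (-1) ^+ (b \in S))) *
  (u * z * (y * c * t))); last by rewrite xx sq !mul1r.
by move: (_ * (-1) ^+ (b \in S)) => s; ring.
Qed.

Let Lam : 'M[A]_r := \prod_(i < n) map_mx (msub P) (- dx X i).
Let vl (i : 'I_n) : A := msub (@r_x k n m) (grad W i).

Let Lam_par : mxpar par false Lam.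
Proof.
have := @mxpar_prod A r par 'I_n (fun i => map_mx (msub P) (- dx X i)) (index_enum 'I_n).
rewrite size_index_ord (negbTE n_even); apply=> i.
have f0 : msub P (- mderiv (lshift m i) 0) = 0 by rewrite mderiv0 oppr0 rmorph0.
move=> i' j ij; rewrite !mxE.
have := @mxpar_mfact _ _ _ X (fun p => msub P (- mderiv (lshift m i) p)) f0 i' j ij.
by rewrite mxE.
Qed.

Let Lam_comm : mxideal vl (dl * Lam - Lam * dl).
Proof.
have := @mxideal_anticomm A r 'I_n vl 'I_n dl (fun i => map_mx (msub P) (- dx X i)) (index_enum 'I_n).
rewrite size_index_ord -signr_odd (negbTE n_even) mul1r.
apply=> i; have -> : dl * map_mx (msub P) (- dx X i) + map_mx (msub P) (- dx X i) * dl =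
    map_mx (msub P) (- (d *m dx X i + dx X i *m d)).
  by rewrite !map_mxN map_mxD !map_mxM mulrN mulNr opprD.
have -> : d *m dx X i + dx X i *m d = (- inx m (grad W i))%:M.
  transitivity ((mderiv (lshift m i) (inz n V - inx m W))%:M : 'M_r).
    exact: (mfderiv_anti X).
  by rewrite mderivx_U.
have -> : - (- inx m (grad W i))%:M = (inx m (grad W i))%:M :> 'M_r.
  by apply/matrixP=> a b; rewrite !mxE mulNrn opprK.
rewrite map_scalar_mx; have -> : msub P (inx m (grad W i)) = vl i by exact: msub_ptl.
exact: mxideal_gen.
Qed.

Let evtE S ij : @evt_mx k n m W V X S ij =
  (-1) ^+ odd #|S| * (-1) ^+ par ij.1 * (bw S * Lam) ij.2 ij.1.
Proof.
rewrite /evt_mx exprD -[X in X * _ * _]signr_odd -[X in _ * X * _]signr_odd.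
by rewrite oddM /= n_even /= oddb.
Qed.

Let M_par (S : {set 'I_m}) : mxpar par (odd #|S|) (bw S * Lam).
Proof. by have := mxpar_mul (@bw_par S) Lam_par; rewrite addbF. Qed.

Hypothesis W_pot : potential W.

Lemma res_rD f h : @res_r k n m W (f + h) = res_r W f + res_r W h.
Proof. exact: (coef_extD (res_linear W_pot)). Qed.

Lemma res_rM c f : @res_r k n m W (act c * f) = c * res_r W f.
Proof.
apply: (coef_extM (res_linear W_pot)).
by apply: split_ind => i; rewrite ptE [LHS]mmapX mmap1U !ptE.
Qed.

Lemma res_r_grad j f : @res_r k n m W (msub (@r_x k n m) (grad W j) * f) = 0.
Proof.
apply: (coef_ext_ideal (res_linear W_pot)); last exact: res_grad.
by move=> i; rewrite [LHS]mmapX mmap1U !ptE.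
Qed.

(** The mirror image of [ev_mor]: Lambda now stands to the right of the word, so d_X comes in from
    the right, crosses Lambda at the cost of [Z], and then crosses the word by [bword_comm]. *)
Lemma evt_mor : gmor (@evt k n m W V X).
Proof.
apply: (gresidue_mor (p := @theta_par m) (N := XXdual X)).
- exact: res_rD.
- exact: res_rM.
- by move=> S [i j]; rewrite /= /tens_par /= evtE => ij; rewrite M_par ?mulr0 // addbC.
move=> S [i j] h; rewrite [X in X - _]tens_col.
set L := odd #|S|.
have -> : \sum_a @evt_mx k n m W V X S (a, j) * msub P (d a i) =
   - (-1) ^+ L * (-1) ^+ (par i) * ((bw S * Lam) * dl) j i.
  rewrite mxE mulr_sumr; apply: eq_bigr => a _.
  rewrite evtE ![(_, _).2]/= ![(_, _).1]/= [dl _ _]mxE.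
  have [ai|ai] := eqVneq (par a (+) par i) true; last first.
    by have := dl_par ai; rewrite mxE => ->; rewrite !(mulr0, mul0r).
  have -> : par a = ~~ par i by move: ai; case: (par a); case: (par i).
  rewrite -/L signrN.
  by move: ((bw S * Lam) j a) (msub P (d a i)) => x z; ring.
have -> : \sum_b @evt_mx k n m W V X S (i, b) * dual_dmx par (fun i j => msub P' (d i j)) b j =
   - (-1) ^+ L * (-1) ^+ par i * (-1) ^+ par j * (dr * (bw S * Lam)) j i.
  rewrite mxE mulr_sumr; apply: eq_bigr => b _.
  rewrite evtE /dual_dmx ![(_, _).2]/= ![(_, _).1]/= [dr _ _]mxE -/L.
  by move: ((bw S * Lam) b i) (msub P' (d j b)) => x z; ring.
have -> : \sum_T Defs.gact (XXdual X) (gdmx (g := Delta V) S T) * @evt_mx k n m W V X T (i, j) =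
    \sum_b sg A S b * (if b \in S then wl b else inc e P P' b) * @evt_mx k n m W V X (flip S b) (i, j).
  under eq_bigr => T _ do rewrite [Defs.gact _ _]rmorph_koszul.
  by rewrite koszul_row; apply: eq_bigr => b _; rewrite act_inc.
set Z := bw S * (dl * Lam - Lam * dl).
have -> : ((bw S * Lam) * dl) j i = - Z j i + ((-1) ^+ L * (dr * (bw S * Lam)) j i +
    \sum_b sg A S b * (if b \in S then wl b else inc e P P' b) * (bw (flip S b) * Lam) j i).
  have addE (M N : 'M[A]_r) : (M + N) j i = M j i + N j i by rewrite mxE.
  have oppE (M : 'M[A]_r) : (- M) j i = - M j i by rewrite mxE.
  have scaleE c (M : 'M[A]_r) : (c *: M) j i = c * M j i by rewrite mxE.
  have -> : bw S * Lam * dl = - Z + (bw S * dl) * Lam.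
    by rewrite /Z mulrBr !mulrA opprB subrK.
  rewrite addE oppE bw_comm mulrDl mulr_suml addE summxE; congr (_ + (_ + _)).
    by rewrite -[_ * Lam]scalemxAl scaleE signr_odd -[_ *m Lam]/(dr * bw S * Lam) mulrA.
  by apply: eq_bigr => b _; rewrite -[_ * Lam]scalemxAl scaleE.
set y := (dr * (bw S * Lam)) j i; set s1 := \sum_b _; set s2 := \sum_b _.
set c := - (-1) ^+ L * (-1) ^+ par i.
have c_y : c * ((-1) ^+ L * y) + (-1) ^+ par i *
    (- (-1) ^+ L * (-1) ^+ par i * (-1) ^+ par j * y) = 0.
  have [ji|ji] := eqVneq (par j (+) par i) (~~ L); last first.
    rewrite /y; have hp := mxpar_mul dr_par (@M_par S).
    by rewrite hp ?mulr0 ?addr0 // addTb.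
  rewrite /c; have -> : par j = ~~ L (+) par i by rewrite -ji addbK.
  move: (y) => x.
  by case: (par i); case: (L); rewrite /= ?expr0 ?expr1; ring.
have c_s : c * s1 = s2.
  rewrite /s1 /s2 mulr_sumr; apply: eq_bigr => b _; rewrite evtE ![(_, _).2]/= ![(_, _).1]/=.
  rewrite odd_flip -/L /c signrN.
  by move: (sg _ _ _) ((_ * Lam) _ _) (if _ then _ else _) => x1 x2 x3; ring.
have -> : c * (- Z j i + ((-1) ^+ L * y + s1)) +
    (-1) ^+ par i * (- (-1) ^+ L * (-1) ^+ par i * (-1) ^+ par j * y) - s2 = - c * Z j i.
  move/eqP: c_y; rewrite addr_eq0 !mulrDr c_s => /eqP ->.
  by move: (Z j i) (s2) ((-1) ^+ par i * _) (c) => x1 x2 x3 x4; ring.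
have [z ->] : mxideal vl Z := mxidealMl (bw S) Lam_comm.
rewrite summxE mulr_sumr mulr_suml.
have res_sum (F : 'I_n -> A) : @res_r k n m W (\sum_j F j) = \sum_j res_r W (F j).
  exact: (big_morph _ res_rD (coef_ext0 (res_linear W_pot) _)).
rewrite res_sum big1 // => l _; rewrite mxE mulrCA -mulrA; exact: res_r_grad.
Qed.

End RightChainMaps.
End ChainMaps.

(** * Reordering words up to homotopy *)

Section TensorHomotopy.
Variables (A : comNzRingType) (I J : finType) (p : I -> bool).
Implicit Types (f : I -> I -> A) (g : J -> J -> A).

Definition mcomp (K : finType) (f f' : K -> K -> A) : K -> K -> A :=
  fun i j => \sum_l f i l * f' l j.

Lemma tens_mx_comp f f' g g' u :
  mxact (tens_mx f g) (mxact (tens_mx f' g') u) =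
  mxact (tens_mx (mcomp f f') (mcomp g g')) u.
Proof.
rewrite mxact_comp; apply: eq_mxact => [[i j] [i' j']]; rewrite /tens_mx /mcomp /=.
rewrite -(pair_bigA _ (fun l l' => f i l * g j l' * (f' l i' * g' l' j'))) /=.
rewrite big_distrlr /=; apply: eq_bigr => l _; apply: eq_bigr => l' _.
by rewrite mulrACA.
Qed.

(** The grading operator. With it a tensor differential is a sum of two plain tensor products of
    matrices, and only compositions of such products have to be compared. *)
Definition sgn_mx : I -> I -> A := fun i i' => (-1) ^+ p i' * (i == i')%:R.

Lemma tens_dmxE f g u :
  mxact (tens_dmx p f g) u =
  mxact (tens_mx f (@id_mx A J)) u + mxact (tens_mx sgn_mx g) u.
Proof. by rewrite -mxact_add; apply: eq_mxact. Qed.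

Lemma mcomp_idl (K : finType) (f : K -> K -> A) i j : mcomp (@id_mx A K) f i j = f i j.
Proof. exact: (sum_deltal i (fun l => f l j)). Qed.

Lemma mcomp_idr (K : finType) (f : K -> K -> A) i j : mcomp f (@id_mx A K) i j = f i j.
Proof. exact: (sum_deltar j (fun l => f i l)). Qed.

Lemma mcomp_sgnl f i j : mcomp sgn_mx f i j = (-1) ^+ p i * f i j.
Proof.
rewrite -[RHS](sum_deltal i (fun l => (-1) ^+ p l * f l j)); apply: eq_bigr => l _.
by rewrite /sgn_mx mulrCA mulrA.
Qed.

Lemma mcomp_sgnr f i j : mcomp f sgn_mx i j = (-1) ^+ p j * f i j.
Proof.
rewrite -[RHS](sum_deltar j (fun l => (-1) ^+ p j * f i l)); apply: eq_bigr => l _.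
by rewrite /sgn_mx mulrCA mulrA.
Qed.

Lemma eq_tens_mx f f' g g' u :
  (forall i j, f i j = f' i j) -> (forall i j, g i j = g' i j) ->
  mxact (tens_mx f g) u = mxact (tens_mx f' g') u.
Proof. by move=> ef eg; apply: eq_mxact => x y; rewrite /tens_mx ef eg. Qed.

Lemma tens_mxN f f' g u : (forall i j, f i j = - f' i j) ->
  mxact (tens_mx f g) u = - mxact (tens_mx f' g) u.
Proof.
move=> ef; apply/ffunP=> x; rewrite !ffunE -sumrN; apply: eq_bigr => y _.
by rewrite /tens_mx ef !mulNr.
Qed.

Lemma tens_mxDl f f' f'' g u : (forall i j, f i j = f' i j + f'' i j) ->
  mxact (tens_mx f g) u = mxact (tens_mx f' g) u + mxact (tens_mx f'' g) u.
Proof.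
move=> ef; rewrite -mxact_add; apply: eq_mxact => x y.
by rewrite /tens_mx ef mulrDl.
Qed.

Lemma tens_mxDr f g g' g'' u : (forall i j, g i j = g' i j + g'' i j) ->
  mxact (tens_mx f g) u = mxact (tens_mx f g') u + mxact (tens_mx f g'') u.
Proof.
move=> eg; rewrite -mxact_add; apply: eq_mxact => x y.
by rewrite /tens_mx eg mulrDr.
Qed.

Variables (d : I -> I -> A) (d' : J -> J -> A).
Notation T := (mxact (tens_dmx p d d')).

Lemma tens_homl (h : I -> I -> A) (g : J -> J -> A) u :
  (forall i j, p i = p j -> h i j = 0) ->
  (forall i j, mcomp d' g i j = mcomp g d' i j) ->
  T (mxact (tens_mx h g) u) + mxact (tens_mx h g) (T u) =
  mxact (tens_mx (fun i j => mcomp d h i j + mcomp h d i j) g) u.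
Proof.
move=> h_odd g_comm; rewrite !tens_dmxE mxactD !tens_mx_comp.
rewrite [RHS](tens_mxDl (f' := mcomp d h) (f'' := mcomp h d)) //.
have e1 : mxact (tens_mx (mcomp d h) (mcomp (@id_mx A J) g)) u =
    mxact (tens_mx (mcomp d h) g) u by apply: eq_tens_mx => //; exact: mcomp_idl.
have e2 : mxact (tens_mx (mcomp h d) (mcomp g (@id_mx A J))) u =
    mxact (tens_mx (mcomp h d) g) u by apply: eq_tens_mx => //; exact: mcomp_idr.
have e3 : mxact (tens_mx (mcomp sgn_mx h) (mcomp d' g)) u =
    - mxact (tens_mx (mcomp h sgn_mx) (mcomp g d')) u.
  rewrite (eq_tens_mx (f' := mcomp sgn_mx h) (g' := mcomp g d')) //.
  apply: tens_mxN => i j; rewrite mcomp_sgnl mcomp_sgnr.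
  have [e|ne] := eqVneq (p i) (p j); first by rewrite h_odd // !mulr0 oppr0.
  by move: ne; case: (p i); case: (p j) => //= _; rewrite expr0 expr1 mul1r mulN1r ?opprK.
by rewrite addrACA e1 e2 e3 addNr addr0.
Qed.

(** An odd map in the second factor must pass the first one, which is why the homotopy carries
    [sgn_mx]. *)
Lemma tens_homr (f : I -> I -> A) (h : J -> J -> A) u :
  (forall i j, p i = p j -> d i j = 0) ->
  (forall i j, p i != p j -> f i j = 0) ->
  (forall i j, mcomp d f i j = mcomp f d i j) ->
  T (mxact (tens_mx (mcomp sgn_mx f) h) u) + mxact (tens_mx (mcomp sgn_mx f) h) (T u) =
  mxact (tens_mx f (fun i j => mcomp d' h i j + mcomp h d' i j)) u.
Proof.
move=> d_odd f_even f_comm; rewrite !tens_dmxE mxactD !tens_mx_comp.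
rewrite [RHS](tens_mxDr (g' := mcomp d' h) (g'' := mcomp h d') f) //.
have e1 : mxact (tens_mx (mcomp d (mcomp sgn_mx f)) (mcomp (@id_mx A J) h)) u =
    - mxact (tens_mx (mcomp (mcomp sgn_mx f) d) h) u.
  rewrite (eq_tens_mx (f' := mcomp d (mcomp sgn_mx f)) (g' := h)) //; last exact: mcomp_idl.
  apply: tens_mxN => i j.
  transitivity (\sum_l - (-1) ^+ p i * (d i l * f l j)).
    apply: eq_bigr => l _; rewrite mcomp_sgnl.
    have [e|ne] := eqVneq (p i) (p l); first by rewrite d_odd // !(mul0r, mulr0).
    rewrite mulrCA; congr (_ * _).
    by move: ne; case: (p i); case: (p l) => //= _; rewrite expr0 expr1 ?opprK.
  rewrite -mulr_sumr -[\sum_l _]/(mcomp d f i j) f_comm mulNr; congr (- _).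
  by rewrite mulr_sumr; apply: eq_bigr => l _; rewrite mcomp_sgnl mulrA.
have e2 : mxact (tens_mx (mcomp (mcomp sgn_mx f) d) (mcomp h (@id_mx A J))) u =
    mxact (tens_mx (mcomp (mcomp sgn_mx f) d) h) u.
  by apply: eq_tens_mx => //; exact: mcomp_idr.
rewrite addrACA e1 e2 addNr add0r; congr (_ + _).
  apply: eq_tens_mx => // i j; rewrite mcomp_sgnl mcomp_sgnl mulrA.
  by rewrite -signr_addb addbb mul1r.
apply: eq_tens_mx => // i j; rewrite mcomp_sgnr mcomp_sgnl.
have [e|ne] := eqVneq (p i) (p j); last by rewrite f_even // !mulr0.
by rewrite e mulrA -signr_addb addbb mul1r.
Qed.

End TensorHomotopy.

Section WordsModulo.
Variables (B : comNzRingType) (r : nat) (L : finType).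
Variables (d : 'M[B]_r) (D : L -> 'M[B]_r) (v : L -> B).
Variables (c : L -> L -> B) (h : L -> L -> 'M[B]_r).
Hypothesis D_anti : forall a, d * D a + D a * d = (v a)%:M.
Hypothesis D_swap : forall a b,
  D a * D b + D b * D a = (c a b)%:M - (d * h a b + h a b * d).
Variable P : 'M[B]_r -> Prop.
Hypothesis PD : forall M N, P M -> P N -> P (M + N).
Hypothesis PN : forall M, P M -> P (- M).
Hypothesis P_anticomm : forall M, P (d * M + M * d).
Hypothesis P_gen : forall a M, P (v a *: M).
Implicit Types w u t : seq L.

Definition mword w : 'M[B]_r := \prod_(a <- w) D a.

Lemma mword_cat u w : mword (u ++ w) = mword u * mword w.
Proof. exact: big_cat. Qed.

Lemma mword_cons a w : mword (a :: w) = D a * mword w.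
Proof. exact: big_cons. Qed.

Lemma P_zero : P 0.
Proof. by have := P_anticomm 0; rewrite mulr0 mul0r addr0. Qed.

Lemma P_sub M N : P M -> P N -> P (M - N).
Proof. by move=> hM /PN; exact: PD. Qed.

Lemma P_sign n M : P M -> P ((-1) ^+ n * M).
Proof.
move=> hM; rewrite -signr_odd; case: (odd n); rewrite ?expr0 ?expr1 ?mul1r //.
by rewrite mulN1r; exact: PN.
Qed.

Lemma P_mxideal M : mxideal v M -> P M.
Proof.
by case=> Z ->; elim/big_rec: _ => [|a N _]; [exact: P_zero | exact: PD].
Qed.

Lemma sgn_commr n (M : 'M[B]_r) : (-1) ^+ n * M = M * (-1) ^+ n.
Proof. by apply/commr_sym/commrX/commrN1. Qed.

(** [D_swap] leaves a central term and an anticommutator of [d] with [h a b]. In the latter [d] is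
    pushed out to both ends of the word; as [u] and [t] have lengths of equal parity, the two signs
    agree and an anticommutator of [d] with the whole word results. *)
Lemma mword_swap u a b t :
  ~~ odd (size u + size t) -> P (c a b *: (mword u * mword t)) ->
  P (mword (u ++ a :: b :: t) + mword (u ++ b :: a :: t)).
Proof.
move=> even_ut Pc.
have -> : mword (u ++ a :: b :: t) + mword (u ++ b :: a :: t) =
    mword u * (D a * D b + D b * D a) * mword t.
  by rewrite !mword_cat !mword_cons mulrDr mulrDl !mulrA.
rewrite D_swap mulrBr mulrBl; apply: P_sub.
  have -> : mword u * (c a b)%:M * mword t = c a b *: (mword u * mword t).
    by rewrite [mword u * _]scalar_mxC mul_scalar_mx [RHS]scalemxAl.
  by [].
set N := mword u * h a b * mword t.
have Iu : mxideal v (d * mword u - (-1) ^+ size u * mword u * d).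
  by apply: mxideal_anticomm => l; rewrite D_anti; exact: mxideal_gen.
have It : mxideal v (d * mword t - (-1) ^+ size t * mword t * d).
  by apply: mxideal_anticomm => l; rewrite D_anti; exact: mxideal_gen.
pose s : 'M[B]_r := (-1) ^+ size u.
have st : (-1) ^+ size t = s.
  rewrite /s -signr_odd -[RHS]signr_odd; congr (_ ^+ nat_of_bool _).
  by move: even_ut; rewrite oddD; case: (odd _); case: (odd _).
have ss : s * s = 1 by rewrite /s -expr2 sqrr_sign.
have sC M : s * M = M * s by exact: sgn_commr.
(* An exact identity: the first term is the outer anticommutator, the other two are the costs of
   crossing [u] and [t], both in the ideal of the [v]. *)
have -> : mword u * (d * h a b + h a b * d) * mword t =
    s * (d * N + N * d) - s * (d * mword u - (-1) ^+ size u * mword u * d) * h a b * mword t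
    + mword u * h a b * (d * mword t - (-1) ^+ size t * mword t * d).
  rewrite st -/s; set U := mword u; set H := h a b; set T := mword t.
  have -> : s * (d * U - s * U * d) * H * T = s * (d * N) - U * d * H * T.
    by rewrite mulrBr !mulrBl /N !mulrA ss mul1r.
  have -> : U * H * (d * T - s * T * d) = U * H * d * T - s * (N * d).
    by rewrite mulrBr /N !mulrA -(sC (U * H)) !mulrA.
  have -> : U * (d * H + H * d) * T = U * d * H * T + U * H * d * T.
    by rewrite mulrDr mulrDl !mulrA.
  rewrite [s * (_ + _)]mulrDr opprB.
  move: (s * (d * N)) (s * (N * d)) (U * d * H * T) (U * H * d * T) => x y z w.
  by rewrite [x + y]addrC [y + x + _]addrA [y + x + z]addrAC addrK [y + z]addrC -addrA [y + _]addrC subrK.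
apply: PD; last by apply: P_mxideal; exact: mxidealMl.
apply: P_sub; first exact: P_sign.
by apply: P_mxideal; do 2 apply: mxidealMr; exact: mxidealMl.
Qed.

Lemma mword_move u a w t :
  (forall w1 b w2, w = w1 ++ b :: w2 ->
     P (mword (u ++ w1 ++ a :: b :: w2 ++ t) + mword (u ++ w1 ++ b :: a :: w2 ++ t))) ->
  P (mword (u ++ a :: w ++ t) - (-1) ^+ size w * mword (u ++ w ++ a :: t)).
Proof.
elim: w u => [|b w IHw] u hw.
  by rewrite mul1r subrr; exact: P_zero.
have h1 : P (mword (u ++ b :: a :: w ++ t) -
    (-1) ^+ size w * mword (u ++ b :: w ++ a :: t)).
  have := IHw (u ++ [:: b]); rewrite -!catA; apply=> w1 b' w2 ew.
  by have := hw (b :: w1) b' w2; rewrite /= ew -!catA; exact.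
have h2 := hw [::] b w erefl.
have := P_sub h2 h1; rewrite opprB exprS mulN1r mulNr opprK.
by rewrite addrA addrAC addrK.
Qed.

Lemma mword_block u w w' t :
  (forall a b u' t', a \in w -> b \in w' ->
     (size u' + size t').+2 = size (u ++ w ++ w' ++ t) ->
     P (mword (u' ++ a :: b :: t') + mword (u' ++ b :: a :: t'))) ->
  P (mword (u ++ w ++ w' ++ t) - (-1) ^+ (size w * size w') * mword (u ++ w' ++ w ++ t)).
Proof.
elim: w u => [|a w IHw] u hw.
  by rewrite mul1r subrr; exact: P_zero.
have h1 : P (mword (u ++ a :: w ++ w' ++ t) -
    (-1) ^+ (size w * size w') * mword (u ++ a :: w' ++ w ++ t)).
  have := IHw (u ++ [:: a]); rewrite -!catA; apply=> a' b u' t' a'w bw' e.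
  by apply: hw => //; rewrite inE a'w orbT.
have h2 : P (mword (u ++ a :: w' ++ w ++ t) -
    (-1) ^+ size w' * mword (u ++ w' ++ a :: w ++ t)).
  apply: mword_move => w1 b w2 ew; rewrite !catA; apply: hw.
  - by rewrite inE eqxx.
  - by rewrite ew mem_cat inE eqxx orbT.
  - by rewrite ew /= !size_cat /= !size_cat /=; lia.
have := PD h1 (P_sign (size w * size w') h2).
by rewrite mulrBr addrA subrK mulrA -exprD mulSn addnC.
Qed.

(** The first letter is moved behind the rest after the rest has been reversed; [size w]
    transpositions are added to ['C(size w, 2)]. *)
Lemma mword_rev u w t :
  (forall a b u' t', perm_eq (u' ++ a :: b :: t') w ->
     P (mword (u ++ u' ++ a :: b :: t' ++ t) + mword (u ++ u' ++ b :: a :: t' ++ t))) ->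
  P (mword (u ++ rev w ++ t) - (-1) ^+ 'C(size w, 2) * mword (u ++ w ++ t)).
Proof.
elim: w t => [|a w IHw] t hw.
  by rewrite mul1r subrr; exact: P_zero.
have h1 : P (mword (u ++ rev w ++ a :: t) - (-1) ^+ 'C(size w, 2) * mword (u ++ w ++ a :: t)).
  apply: IHw => a' b u' t' e; have := hw a' b u' (rcons t' a).
  rewrite cat_rcons; apply; rewrite -!rcons_cons -rcons_cat perm_rcons perm_cons; exact: e.
have h2 : P (mword (u ++ a :: w ++ t) - (-1) ^+ size w * mword (u ++ w ++ a :: t)).
  apply: mword_move => w1 b w2 ew; apply: hw.
  by apply/seq.permP=> p; rewrite ew /= !count_cat /=; lia.
have := P_sub h1 (P_sign ('C(size w, 2) + size w) h2).
have -> : (-1) ^+ ('C(size w, 2) + size w) *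
      (mword (u ++ a :: w ++ t) - (-1) ^+ size w * mword (u ++ w ++ a :: t)) =
    (-1) ^+ 'C(size w, 2).+1.-1 * ((-1) ^+ size w * mword (u ++ a :: w ++ t)) -
    (-1) ^+ 'C(size w, 2) * mword (u ++ w ++ a :: t).
  rewrite mulrBr exprD -!mulrA; congr (_ - _ * _).
  by rewrite mulrA -expr2 sqrr_sign mul1r.
by rewrite opprB addrA subrK rev_cons -cats1 -catA /= binS bin1 exprD mulrA.
Qed.

Lemma mword_perm u w w' t : perm_eq w w' ->
  (forall a b u' t', perm_eq (u' ++ a :: b :: t') w ->
     P (mword (u ++ u' ++ a :: b :: t' ++ t) + mword (u ++ u' ++ b :: a :: t' ++ t))) ->
  P (mword (u ++ w' ++ t)) -> P (mword (u ++ w ++ t)).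
Proof.
elim: w' u w => [|b w' IHw] u w pw hw hP.
  by rewrite (perm_nilP pw).
have bw : b \in w by rewrite (perm_mem pw) inE eqxx.
have [w1 [w2 ew]] : exists w1 w2, w = w1 ++ b :: w2.
  by case/splitPr: bw => w1 w2; exists w1, w2.
have pw' : perm_eq (w1 ++ w2) w'.
  apply/seq.permP=> p; move/seq.permP/(_ p): pw; rewrite ew !count_cat /=; lia.
have h1 : P (mword (u ++ b :: w1 ++ w2 ++ t) - (-1) ^+ size w1 * mword (u ++ w1 ++ b :: w2 ++ t)).
  apply: mword_move => v1 a v2 ev; have := hw b a v1 (v2 ++ w2); rewrite -!catA; apply.
  by apply/seq.permP=> p; rewrite ew ev !(count_cat, cat_cons) /= ?count_cat /=; lia.
have h2 : P (mword (u ++ b :: w1 ++ w2 ++ t)).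
  have := IHw (u ++ [:: b]) (w1 ++ w2) pw'; rewrite -!catA; apply=> // a a' u' t' e.
  rewrite -!catA; apply: (hw a a' (b :: u') t').
  by apply/seq.permP=> p; move/seq.permP/(_ p): e; rewrite ew !count_cat /= ?count_cat /=; lia.
have := P_sign (size w1) (P_sub h2 h1).
by rewrite opprB addrC subrK mulrA -expr2 sqrr_sign mul1r ew -catA.
Qed.

End WordsModulo.

(** * Homotopy invariance *)

Section MatrixOfMaps.
Variables (B : comNzRingType) (I : finType) (p : I -> bool) (d : I -> I -> B).
Let M : gfree B := GFree idfun p d.
Let bas j : gel M := [ffun j' => (j' == j)%:R].

Lemma gmx_degree s (f : gel M -> gel M) i j :
  gdegree s f -> p i != s (+) p j -> gmx f i j = 0.
Proof. by move=> f_deg; apply: f_deg; exact: ghomog_basis. Qed.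

Lemma gmx_gdiffl (f : gel M -> gel M) i j :
  gdiff (f (bas j)) i = mcomp d (gmx f) i j.
Proof. by rewrite ffunE. Qed.

Lemma gmx_gdiffr (f : gel M -> gel M) i j : glinear f ->
  f (gdiff (bas j)) i = mcomp (gmx f) d i j.
Proof.
move=> f_lin; have -> : gdiff (bas j) = [ffun l => d l j] by exact: mxact_delta.
by rewrite (glin_gmx _ _ f_lin); apply: eq_bigr => l _; rewrite ffunE.
Qed.

Lemma gmx_comm (f : gel M -> gel M) i j : gmor f ->
  mcomp d (gmx f) i j = mcomp (gmx f) d i j.
Proof. by move=> [f_lin _ fd]; rewrite -gmx_gdiffl -gmx_gdiffr // fd. Qed.

Lemma gmx_homotopic (f g : gel M -> gel M) : homotopic f g ->
  exists h : I -> I -> B, (forall i j, p i = p j -> h i j = 0) /\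
    forall i j, gmx f i j = gmx g i j + (mcomp d h i j + mcomp h d i j).
Proof.
case=> h [h_lin h_deg hd]; exists (gmx h); split=> i j.
  by move=> e; apply: (gmx_degree h_deg); rewrite e; case: (p j).
have := hd (bas j) => /(congr1 (fun v : gel M => v i)).
by rewrite ffunB ffunE gmx_gdiffl gmx_gdiffr // => <-; rewrite addrC subrK.
Qed.

End MatrixOfMaps.

Section TensorMorphisms.
Variables (A : comNzRingType) (I J : finType) (p : I -> bool).
Variables (d : I -> I -> A) (d' : J -> J -> A).
Notation T := (mxact (tens_dmx p d d')).

Lemma rmorph_mcomp (B : comNzRingType) (phi : {rmorphism B -> A}) (K : finType)
    (f g : K -> K -> B) i j :
  phi (mcomp f g i j) = mcomp (fun i j => phi (f i j)) (fun i j => phi (g i j)) i j.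
Proof. by rewrite rmorph_sum; apply: eq_bigr => l _; rewrite rmorphM. Qed.

Lemma tens_commr (g : J -> J -> A) u :
  (forall i j, mcomp d' g i j = mcomp g d' i j) ->
  mxact (tens_mx (@id_mx A I) g) (T u) = T (mxact (tens_mx (@id_mx A I) g) u).
Proof.
move=> g_comm; rewrite !tens_dmxE mxactD !tens_mx_comp; congr (_ + _).
  by apply: eq_tens_mx => i j; rewrite mcomp_idl mcomp_idr.
by apply: eq_tens_mx => i j; rewrite ?g_comm // mcomp_idl mcomp_idr.
Qed.

Lemma tens_comml (f : I -> I -> A) u :
  (forall i j, p i != p j -> f i j = 0) ->
  (forall i j, mcomp d f i j = mcomp f d i j) ->
  mxact (tens_mx f (@id_mx A J)) (T u) = T (mxact (tens_mx f (@id_mx A J)) u).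
Proof.
move=> f_even f_comm; rewrite !tens_dmxE mxactD !tens_mx_comp; congr (_ + _).
  by apply: eq_tens_mx => i j; rewrite ?f_comm // mcomp_idl mcomp_idr.
apply: eq_tens_mx => i j; last by rewrite mcomp_idl mcomp_idr.
rewrite mcomp_sgnl mcomp_sgnr; have [->|ne] := eqVneq (p i) (p j); first by [].
by rewrite f_even // !mulr0.
Qed.

End TensorMorphisms.

Section DeltaMultiplication.
Variables (k : comNzRingType) (n : nat) (W : {mpoly k[n]}).

Lemma Delta_mul_mor (q : {mpoly k[n]}) : gmor (@Delta_mul k n W q).
Proof.
split=> [|s u hu i is_|u]; first exact: glin_gscale.
  by rewrite gscaleE hu ?mulr0.
by rewrite (glinZ (@glin_gdiff _ _)).
Qed.

Lemma gmx_Delta_mul q T S : gmx (@Delta_mul k n W q) T S = msub (@fstv k n) q * (T == S)%:R.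
Proof. by rewrite /gmx gscaleE ffunE. Qed.

Lemma Delta_homotopic_mul (F : gel (Delta W) -> gel (Delta W)) q :
  potential W -> gmor F ->
  in_ideal (grad W) (msub (@diag k n) (gmx F set0 set0) - q) ->
  homotopic F (@Delta_mul k n W q).
Proof.
move=> W_pot F_mor Fq; have [F_lin F_deg Fd] := F_mor.
have [m_lin m_deg md] := Delta_mul_mor q.
have G_mor : gmor (fun u => F u - @Delta_mul k n W q u).
  split; first exact: glin_sub.
    by apply: gdeg_add => //; exact: gdeg_opp.
  by move=> u; rewrite (glinB (@glin_gdiff _ _)) Fd md.
case: (Delta_null W_pot G_mor) => [|h [h_lin h_deg hd]].
  rewrite /gmx ffunB rmorphB -/(gmx F set0 set0) -/(gmx (Delta_mul q) set0 set0).
  rewrite gmx_Delta_mul eqxx mulr1.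
  suff -> : msub (@diag k n) (msub (@fstv k n) q) = q by [].
  by rewrite msub_ptl msub_id.
by exists h; split=> // u; rewrite -hd subr0.
Qed.

End DeltaMultiplication.

Section Factorisation.
Variables (k : comNzRingType) (n m : nat).
Variables (W : {mpoly k[n]}) (V : {mpoly k[m]}) (X : mfact (inz n V - inx m W)).
Notation r := (mfrk X).
Notation d := (mfd X).
Notation par := (@mfpar _ _ X).
Variable Phi : gel (mfobj X) -> gel (mfobj X).
Hypothesis Phi_mor : gmor Phi.

Definition scaled (q : {mpoly k[n + m]}) (u : gel (mfobj X)) : gel (mfobj X) :=
  gscale q (Phi u).

Lemma scaled_mor q : gmor (scaled q).
Proof.
have [P_lin P_deg Pd] := Phi_mor; split.
- exact: (glin_comp (glin_gscale q) P_lin).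
- by move=> s u /P_deg hu i is_; rewrite gscaleE hu ?mulr0.
- by move=> u; rewrite /scaled Pd (glinZ (@glin_gdiff _ _)).
Qed.

Lemma gmx_scaled q i j : gmx (scaled q) i j = q * gmx Phi i j.
Proof. by rewrite /gmx gscaleE. Qed.

Lemma gmx_mfact_even (f : gel (mfobj X) -> gel (mfobj X)) i j :
  gmor f -> par i != par j -> gmx f i j = 0.
Proof. by move=> [_ f_deg _] ij; apply: (gmx_degree f_deg). Qed.

Notation lam := (@lunitor k n m W V X).
Notation lamr := (@runitor k n m W V X).

Section Left.
Variables (phi : {mpoly k[m]}) (phi_map : gel (Delta V) -> gel (Delta V)).
Hypothesis phi_rep : homotopic phi_map (Delta_mul phi).

Let zz : {rmorphism _ -> {mpoly k[m + m + n]}} := msub (pt (@lu_z k n m) (@lu_z' k n m)).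
Let xz : {rmorphism _ -> {mpoly k[m + m + n]}} := msub (pt (@lu_x k n m) (@lu_z' k n m)).

Lemma DeltaX_tens_homotopic :
  homotopic (@DeltaX_tens k n m W V X phi_map Phi) (DeltaX_tens (Delta_mul phi) Phi).
Proof.
have [h [h_odd h_eq]] := gmx_homotopic phi_rep.
exists (mxact (tens_mx (fun T S => zz (h T S)) (fun i j => xz (gmx Phi i j)))).
split.
- exact: glin_mxact.
- apply: gdeg_mxact => -[T i] [S j]; rewrite /= /tens_par /tens_mx /= => ne.
  have [e|ne'] := eqVneq (theta_par T) (theta_par S); first by rewrite h_odd // rmorph0 mul0r.
  rewrite (gmx_mfact_even Phi_mor) ?rmorph0 ?mulr0 //.
  apply: contraNneq ne => ->; move: ne'; case: (theta_par T); case: (theta_par S) => // _;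
    by case: (par j).
move=> u; rewrite [RHS](tens_homl (p := @theta_par m)).
- rewrite /DeltaX_tens; apply/eqP; rewrite subr_eq; apply/eqP; rewrite [RHS]addrC.
  apply: tens_mxDl => T S; rewrite h_eq !rmorphD.
  by rewrite -!rmorph_mcomp.
- by move=> T S e; rewrite h_odd // rmorph0.
- by move=> i j; rewrite -!rmorph_mcomp -(gmx_comm _ _ Phi_mor).
Qed.

(** This holds strictly: multiplication by phi(z) preserves each exterior monomial, and the unitor
    reads off the component at [set0] with z' = z. *)
Lemma lunitor_tens u :
  lam (@DeltaX_tens k n m W V X (Delta_mul phi) Phi u) = scaled (inz n phi) (lam u).
Proof.
apply/ffunP=> i; rewrite ffunE gscaleE.
have [P_lin _ _] := Phi_mor; rewrite (glin_gmx _ _ P_lin).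
set g := pt _ _.
rewrite ffunE (eq_bigr (fun x : {set 'I_m} * 'I_r =>
  zz (gmx (@Delta_mul k m V phi) set0 x.1) * xz (gmx Phi i x.2) * u (x.1, x.2))); last by case.
rewrite -(pair_bigA _ (fun (T : {set 'I_m}) (j : 'I_r) =>
  zz (gmx (@Delta_mul k m V phi) set0 T) * xz (gmx Phi i j) * u (T, j))).
rewrite (bigD1 set0) //= [X in _ + X]big1 ?addr0 => [|T T0]; last first.
  rewrite big1 // => j _.
  by rewrite gmx_Delta_mul eq_sym (negbTE T0) mulr0 rmorph0 !mul0r.
rewrite (rmorph_sum (msub g)) mulr_sumr; apply: eq_bigr => j _.
rewrite gmx_Delta_mul eqxx mulr1 !(rmorphM (msub g)) ffunE mulrA; congr (_ * _ * _).
  rewrite /zz msub_ptl msub_comp; apply: eq_msub => l.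
  by rewrite msubX /g !ptE.
rewrite /xz msub_comp msub_id //.
by apply: split_ind => l; rewrite ptE msubX /g !ptE.
Qed.

(** The scaled endomorphism slides past the unitor, where [linv] cancels up to homotopy. The result
    is the same for every homotopy inverse. *)
Lemma left_map_homotopic linv : hinverse (lam) linv ->
  homotopic (lam \o DeltaX_tens phi_map Phi \o linv) (scaled (inz n phi)).
Proof.
case=> u_mor l_mor ul _.
apply: (homotopic_trans (g := lam \o DeltaX_tens (Delta_mul phi) Phi \o linv)).
  apply: (homotopic_compr l_mor); apply: (homotopic_compl u_mor).
  exact: DeltaX_tens_homotopic.
apply: (homotopic_trans (g := scaled (inz n phi) \o (lam \o linv))).
  by apply: eq_homotopic => u; rewrite /= lunitor_tens.
exact: (homotopic_compl (scaled_mor _) ul).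
Qed.

End Left.

Section Right.
Variables (psi : {mpoly k[n]}) (psi_map : gel (Delta W) -> gel (Delta W)).
Hypothesis psi_rep : homotopic psi_map (Delta_mul psi).

Let xx : {rmorphism _ -> {mpoly k[m + n + n]}} := msub (pt (@ru_x k n m) (@ru_x' k n m)).
Let xz : {rmorphism _ -> {mpoly k[m + n + n]}} := msub (pt (@ru_x k n m) (@ru_z k n m)).

Lemma XDelta_tens_homotopic :
  homotopic (@XDelta_tens k n m W V X Phi psi_map) (XDelta_tens Phi (Delta_mul psi)).
Proof.
have [h [h_odd h_eq]] := gmx_homotopic psi_rep.
exists (mxact (tens_mx (mcomp (sgn_mx _ par) (fun i j => xz (gmx Phi i j)))
  (fun T S => xx (h T S)))).
split.
- exact: glin_mxact.
- apply: gdeg_mxact => -[i T] [j S]; rewrite /= /tens_par /tens_mx mcomp_sgnl /= => ne.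
  have [e|ne'] := eqVneq (theta_par T) (theta_par S); first by rewrite h_odd // rmorph0 mulr0.
  rewrite (gmx_mfact_even Phi_mor) ?rmorph0 ?mulr0 ?mul0r //.
  apply: contraNneq ne => ->; move: ne'; case: (theta_par T); case: (theta_par S) => // _;
    by case: (par j).
move=> u; rewrite [RHS](tens_homr (p := par)).
- rewrite /XDelta_tens; apply/eqP; rewrite subr_eq; apply/eqP; rewrite [RHS]addrC.
  apply: tens_mxDr => T S; rewrite h_eq !rmorphD.
  by rewrite -!rmorph_mcomp.
- by move=> i j e; rewrite mfd_odd // rmorph0.
- by move=> i j e; rewrite (gmx_mfact_even Phi_mor) // rmorph0.
- by move=> i j; rewrite -!rmorph_mcomp -(gmx_comm _ _ Phi_mor).
Qed.

Lemma runitor_tens u :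
  lamr (@XDelta_tens k n m W V X Phi (Delta_mul psi) u) = scaled (inx m psi) (lamr u).
Proof.
apply/ffunP=> i; rewrite ffunE gscaleE.
have [P_lin _ _] := Phi_mor; rewrite (glin_gmx _ _ P_lin).
set g := pt _ _.
rewrite ffunE (eq_bigr (fun x : 'I_r * {set 'I_n} =>
  xz (gmx Phi i x.1) * xx (gmx (@Delta_mul k n W psi) set0 x.2) * u (x.1, x.2))); last by case.
rewrite -(pair_bigA _ (fun (j : 'I_r) (T : {set 'I_n}) =>
  xz (gmx Phi i j) * xx (gmx (@Delta_mul k n W psi) set0 T) * u (j, T))).
rewrite (rmorph_sum (msub g)) mulr_sumr; apply: eq_bigr => j _.
rewrite (bigD1 set0) //= [X in _ + X]big1 ?addr0 => [|T T0]; last first.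
  by rewrite gmx_Delta_mul eq_sym (negbTE T0) mulr0 rmorph0 mulr0 mul0r.
rewrite gmx_Delta_mul eqxx mulr1 !(rmorphM (msub g)) ffunE mulrA mulrC [RHS]mulrC.
congr (_ * _); rewrite mulrC; congr (_ * _).
  rewrite /xx msub_ptl msub_comp; apply: eq_msub => l.
  by rewrite msubX /g !ptE.
rewrite /xz msub_comp msub_id //.
by apply: split_ind => l; rewrite ptE msubX /g !ptE.
Qed.

Lemma right_map_homotopic rinv : hinverse lamr rinv ->
  homotopic (lamr \o XDelta_tens Phi psi_map \o rinv) (scaled (inx m psi)).
Proof.
case=> u_mor l_mor ul _.
apply: (homotopic_trans (g := lamr \o XDelta_tens Phi (Delta_mul psi) \o rinv)).
  apply: (homotopic_compr l_mor); apply: (homotopic_compl u_mor).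
  exact: XDelta_tens_homotopic.
apply: (homotopic_trans (g := scaled (inx m psi) \o (lamr \o rinv))).
  by apply: eq_homotopic => u; rewrite /= runitor_tens.
exact: (homotopic_compl (scaled_mor _) ul).
Qed.

End Right.

Section DualTensors.
Variables f g : gel (mfobj X) -> gel (mfobj X).

Let lp2 : {rmorphism _ -> {mpoly k[n + m + n]}} := msub (@lp' k n m).
Let rp1 : {rmorphism _ -> {mpoly k[m + n + m]}} := msub (@rp k n m).

Lemma XdualX_map_homotopic : homotopic f g ->
  homotopic (@XdualX_map k n m W V X f) (XdualX_map g).
Proof.
move=> fg; have [h [h_odd h_eq]] := gmx_homotopic fg.
exists (mxact (tens_mx (mcomp (sgn_mx _ par) (@id_mx _ 'I_r)) (fun i j => lp2 (h i j)))).
split.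
- exact: glin_mxact.
- apply: gdeg_mxact => -[i j] [i' j']; rewrite /= /tens_par /tens_mx mcomp_sgnl /= => ne.
  rewrite /id_mx; case: (i =P i') ne => [->|_] ne; last by rewrite mulr0 mul0r.
  have [e|ne'] := eqVneq (par j) (par j'); first by rewrite h_odd // rmorph0 mulr0.
  by move: ne ne'; case: (par i'); case: (par j); case: (par j').
move=> u; rewrite [RHS](tens_homr (p := par)).
- rewrite /XdualX_map; apply/eqP; rewrite subr_eq; apply/eqP; rewrite [RHS]addrC.
  apply: tens_mxDr => i j; rewrite h_eq !rmorphD.
  by rewrite -!rmorph_mcomp.
- by move=> i j e; rewrite /dual_dmx mfd_odd // rmorph0 mulr0.
- by move=> i j; rewrite /id_mx; case: (i =P j) => // ->; rewrite eqxx.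
- by move=> i j; rewrite mcomp_idl mcomp_idr.
Qed.

Lemma XdualX_map_mor : gmor g -> gmor (@XdualX_map k n m W V X g).
Proof.
move=> g_mor; split.
- exact: glin_mxact.
- apply: gdeg_mxact => -[i j] [i' j']; rewrite /= /tens_par /tens_mx /id_mx /= => ne.
  case: (i =P i') ne => [->|_] ne; last by rewrite mul0r.
  rewrite (gmx_mfact_even g_mor) ?rmorph0 ?mulr0 //.
  by move: ne; case: (par i'); case: (par j); case: (par j').
- move=> u; apply: tens_commr => i j.
  by rewrite -!rmorph_mcomp -(gmx_comm _ _ g_mor).
Qed.

Lemma XXdual_map_homotopic : homotopic f g ->
  homotopic (@XXdual_map k n m W V X f) (XXdual_map g).
Proof.
move=> fg; have [h [h_odd h_eq]] := gmx_homotopic fg.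
exists (mxact (tens_mx (fun i j => rp1 (h i j)) (@id_mx _ 'I_r))).
split.
- exact: glin_mxact.
- apply: gdeg_mxact => -[i j] [i' j']; rewrite /= /tens_par /tens_mx /= => ne.
  rewrite /id_mx; case: (j =P j') ne => [->|_] ne; last by rewrite mulr0.
  have [e|ne'] := eqVneq (par i) (par i'); first by rewrite h_odd // rmorph0 mul0r.
  by move: ne ne'; case: (par i'); case: (par i); case: (par j').
move=> u; rewrite [RHS](tens_homl (p := par)).
- rewrite /XXdual_map; apply/eqP; rewrite subr_eq; apply/eqP; rewrite [RHS]addrC.
  apply: tens_mxDl => i j; rewrite h_eq !rmorphD.
  by rewrite -!rmorph_mcomp.
- by move=> i j e; rewrite h_odd // rmorph0.
- by move=> i j; rewrite mcomp_idl mcomp_idr.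
Qed.

Lemma XXdual_map_mor : gmor g -> gmor (@XXdual_map k n m W V X g).
Proof.
move=> g_mor; split.
- exact: glin_mxact.
- apply: gdeg_mxact => -[i j] [i' j']; rewrite /= /tens_par /tens_mx /id_mx /= => ne.
  case: (j =P j') ne => [->|_] ne; last by rewrite mulr0.
  rewrite (gmx_mfact_even g_mor) ?rmorph0 ?mul0r //.
  by move: ne; case: (par i'); case: (par i); case: (par j').
- move=> u; apply: tens_comml => i j.
    by move=> e; rewrite (gmx_mfact_even g_mor) // rmorph0.
  by rewrite -!rmorph_mcomp -(gmx_comm _ _ g_mor).
Qed.

End DualTensors.
End Factorisation.

(** * Supertraces and the defect operators *)

Section Supertrace.
Variables (B : comNzRingType) (r : nat) (p : 'I_r -> bool).
Implicit Types M N F D : 'M[B]_r.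

Lemma strD M N : str p (M + N) = str p M + str p N.
Proof. by rewrite -big_split; apply: eq_bigr => i _; rewrite mxE mulrDr. Qed.

Lemma strZ c M : str p (c *: M) = c * str p M.
Proof. by rewrite mulr_sumr; apply: eq_bigr => i _; rewrite mxE mulrCA. Qed.

Lemma str_mul M N : str p (M * N) = \sum_i \sum_j (-1) ^+ p i * (M i j * N j i).
Proof. by apply: eq_bigr => i _; rewrite mxE mulr_sumr. Qed.

(** Supercyclicity for an odd factor: in each nonzero product the row and column indices have
    opposite parities, so the sign of the trace changes. *)
Lemma str_anticomm D N : mxpar p true D -> str p (N * D) = - str p (D * N).
Proof.
move=> D_odd; rewrite !str_mul exchange_big -sumrN; apply: eq_bigr => i _.
rewrite -sumrN; apply: eq_bigr => j _.
have [ij|ij] := eqVneq (p i (+) p j) true; last by rewrite D_odd // !(mulr0, mul0r) oppr0.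
have -> : p j = ~~ p i by move: ij; case: (p i); case: (p j).
by rewrite signrN mulNr [N _ _ * _]mulrC.
Qed.

Lemma str_comm F N : mxpar p false F -> str p (N * F) = str p (F * N).
Proof.
move=> F_even; rewrite !str_mul exchange_big; apply: eq_bigr => i _.
apply: eq_bigr => j _.
have [ij|ij] := eqVneq (p i (+) p j) false; last by rewrite F_even // !(mulr0, mul0r).
have -> : p j = p i by move: ij; case: (p i); case: (p j).
by rewrite [N _ _ * _]mulrC.
Qed.

Lemma map_mx_prod (B' : comNzRingType) (f : {rmorphism B -> B'}) (I : Type)
    (s : seq I) (F : I -> 'M[B]_r) :
  map_mx f (\prod_(i <- s) F i) = \prod_(i <- s) map_mx f (F i).
Proof.
elim: s => [|i s IHs]; first by rewrite !big_nil map_mx1.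
by rewrite !big_cons [LHS]map_mxM IHs.
Qed.

End Supertrace.

Section MfactWords.
Variables (k : comNzRingType) (N : nat) (U : {mpoly k[N]}) (X : mfact U).
Notation D := (mfderiv X).

Definition mfderiv2 a b : 'M[{mpoly k[N]}]_(mfrk X) := map_mx (mderiv a) (D b).

(** Obtained by differentiating [mfderiv_anti] once more; the matrix of second derivatives serves as
    the homotopy. *)
Lemma mfderiv_swap a b :
  D a * D b + D b * D a = (mderiv a (mderiv b U))%:M -
    (mfd X * mfderiv2 a b + mfderiv2 a b * mfd X).
Proof.
have derM (M M' : 'M[{mpoly k[N]}]_(mfrk X)) : map_mx (mderiv a) (M * M') =
    map_mx (mderiv a) M * M' + M * map_mx (mderiv a) M'.
  apply/matrixP=> i j; rewrite !mxE raddf_sum -big_split; apply: eq_bigr => l _.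
  by rewrite !mxE [LHS]mderivM.
have derD (M M' : 'M[{mpoly k[N]}]_(mfrk X)) : map_mx (mderiv a) (M + M') =
    map_mx (mderiv a) M + map_mx (mderiv a) M'.
  by apply/matrixP=> i j; rewrite !mxE mderivD.
have derC c : map_mx (mderiv a) (c%:M : 'M[{mpoly k[N]}]_(mfrk X)) = (mderiv a c)%:M.
  by apply/matrixP=> i j; rewrite !mxE raddfMn.
have := congr1 (map_mx (mderiv a)) (mfderiv_anti X b).
rewrite derC derD !derM -/(D a) -/(mfderiv2 a b) => <-.
set x := D a * D b; set y := D b * D a; set z := mfd X * _; set w := _ * mfd X.
rewrite [w + y]addrC [x + z + _]addrACA.
by rewrite addrK.
Qed.

End MfactWords.

Lemma sub_map_eq (T T' : eqType) (f : T -> T') w s :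
  {subset s <= map f w} -> exists w', s = map f w'.
Proof.
elim: s => [|x s IHs] sub_s; first by exists [::].
have [w' ->] : exists w', s = map f w'.
  by apply: IHs => y ys; apply: sub_s; rewrite inE ys orbT.
by have /mapP[i _ ->] := sub_s x (mem_head _ _); exists (i :: w').
Qed.

Lemma perm_map_split (T T' : eqType) (f : T -> T') a b u t w : injective f ->
  perm_eq (u ++ a :: b :: t) (map f w) ->
  exists i j u1 t1, [/\ u = map f u1, a = f i, b = f j, t = map f t1 &
    perm_eq (u1 ++ i :: j :: t1) w].
Proof.
move=> f_inj e.
have sub_w c : c \in u ++ a :: b :: t -> c \in map f w by rewrite (perm_mem e).
have [u1 eu] : exists u1, u = map f u1.
  by apply: (@sub_map_eq _ _ _ w) => c hc; apply: sub_w; rewrite mem_cat hc.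
have [t1 et] : exists t1, t = map f t1.
  by apply: (@sub_map_eq _ _ _ w) => c hc; apply: sub_w; rewrite mem_cat !inE hc !orbT.
have /mapP[i _ ea] : a \in map f w by apply: sub_w; rewrite mem_cat !inE eqxx orbT.
have /mapP[j _ eb] : b \in map f w by apply: sub_w; rewrite mem_cat !inE eqxx !orbT.
exists i, j, u1, t1; split=> //.
by apply: (perm_map_inj f_inj); rewrite map_cat /= -ea -eb -eu -et.
Qed.

Section TraceForm.
Variables (k : comNzRingType) (n m c : nat).
Variables (W : {mpoly k[n]}) (V : {mpoly k[m]}).
Variable X : mfact (inz n V - inx m W).
Notation d := (mfd X).
Notation par := (@mfpar _ _ X).
Notation Q := {mpoly k[n + m]}.
Notation D := (mfderiv X).
Variable Phi : gel (mfobj X) -> gel (mfobj X).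
Hypothesis Phi_mor : gmor Phi.
Variables (t : 'I_c -> {mpoly k[c]}) (rho : Q -> {mpoly k[c]}) (q : Q).
Hypothesis rhoD : forall f g, rho (f + g) = rho f + rho g.
Hypothesis rho_gen : forall a f,
  in_ideal t (rho (mderiv a (inz n V - inx m W) * f)).

Definition entry_mx : 'M[Q]_(mfrk X) := \matrix_(i, j) gmx Phi i j.
(** [rho] and [t] stand for the residue in z with the derivatives of W, or the residue in x with
    those of V, so that both defect operators share the reordering argument. *)
Definition trform (M : 'M[Q]_(mfrk X)) := rho (q * str par (entry_mx * M)).
Definition trideal M := in_ideal t (trform M).

Lemma trformD M N : trform (M + N) = trform M + trform N.
Proof. by rewrite /trform mulrDr strD mulrDr rhoD. Qed.

Lemma trformZ a M : trform (a *: M) = rho (a * (q * str par (entry_mx * M))).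
Proof. by rewrite /trform -[entry_mx * (a *: M)]scalemxAr strZ mulrCA. Qed.

Lemma trform0 : trform 0 = 0.
Proof. by apply: (addrI (trform 0)); rewrite -trformD !addr0. Qed.

Lemma trformN M : trform (- M) = - trform M.
Proof. by apply/eqP; rewrite -subr_eq0 opprK -trformD addNr trform0. Qed.

Lemma trformS s M : trform ((-1) ^+ s * M) = (-1) ^+ s * trform M.
Proof.
by rewrite -signr_odd -[in RHS]signr_odd; case: (odd s);
  rewrite ?mul1r ?mulN1r ?trformN.
Qed.

Lemma tridealD M N : trideal M -> trideal N -> trideal (M + N).
Proof. by rewrite /trideal trformD; exact: in_idealD. Qed.

Lemma tridealN M : trideal M -> trideal (- M).
Proof. by rewrite /trideal trformN; exact: in_idealN. Qed.

Lemma mfd_par : mxpar par true d.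
Proof. by move=> i j ij; rewrite mfd_odd //; move: ij; case: (par i); case: (par j). Qed.

Lemma entry_mx_par : mxpar par false entry_mx.
Proof.
move=> i j ij; rewrite mxE (gmx_mfact_even Phi_mor) //.
by move: ij; case: (par i); case: (par j).
Qed.

Lemma entry_mx_comm : entry_mx * d = d * entry_mx.
Proof.
apply/matrixP=> i j; rewrite !mxE; have := gmx_comm i j Phi_mor.
rewrite /mcomp => h; transitivity (\sum_l gmx Phi i l * d l j).
  by apply: eq_bigr => l _; rewrite mxE.
by rewrite -h; apply: eq_bigr => l _; rewrite mxE.
Qed.

(** The supertrace itself vanishes: [Phi] commutes with d_X, and d_X is odd. *)
Lemma trideal_anticomm M : trideal (d * M + M * d).
Proof.
rewrite /trideal /trform mulrDr strD mulrA entry_mx_comm [entry_mx * (M * d)]mulrA.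
rewrite (str_anticomm _ mfd_par) mulrA subrr mulr0.
have -> : rho 0 = 0 by apply: (addrI (rho 0)); rewrite -rhoD !addr0.
exact: in_ideal0.
Qed.

Lemma trideal_gen a M : trideal (mderiv a (inz n V - inx m W) *: M).
Proof. by rewrite /trideal trformZ. Qed.

Lemma trideal_swap a b u w : ~~ odd (size u + size w) ->
  trideal (mderiv a (mderiv b (inz n V - inx m W)) *: (mword D u * mword D w)) ->
  trideal (mword D (u ++ a :: b :: w) + mword D (u ++ b :: a :: w)).
Proof.
exact: (@mword_swap _ _ _ d D (fun a => mderiv a (inz n V - inx m W)) _
  (mfderiv2 X) (mfderiv_anti X) (mfderiv_swap X) trideal tridealD tridealN
  trideal_anticomm trideal_gen).
Qed.

End TraceForm.

(** * Values of the two defect operators *)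

Section DefectTraces.
Variables (k : comNzRingType) (n m : nat).
Hypothesis n_even : ~~ odd n.
Hypothesis m_even : ~~ odd m.
Variables (W : {mpoly k[n]}) (V : {mpoly k[m]}).
Hypothesis W_pot : potential W.
Hypothesis V_pot : potential V.
Variable X : mfact (inz n V - inx m W).
Notation r := (mfrk X).
Notation d := (mfd X).
Notation par := (@mfpar _ _ X).
Variable Phi : gel (mfobj X) -> gel (mfobj X).
Hypothesis Phi_mor : gmor Phi.
Notation Q := {mpoly k[n + m]}.

Let PhiM := entry_mx Phi.
Notation D := (mfderiv X).
Notation mw := (mword D).

Let zs : seq 'I_(n + m) := [seq rshift n j | j <- enum 'I_m].
Let size_zs : size zs = m. Proof. by rewrite size_map size_enum_ord. Qed.
Let Lz : 'M[Q]_r := \prod_(j < m) dz X j.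

Section LeftTrace.
Variable phi : {mpoly k[m]}.
Let f0 := scaled Phi (inz n phi).
Let F : gel (Delta W) -> gel (Delta W) :=
  @ev k n m W V X \o XdualX_map f0 \o @coevt k n m W V X.

Lemma left_mor : gmor F.
Proof.
have h1 := ev_mor m_even X V_pot.
have h2 := XdualX_map_mor (scaled_mor Phi_mor (inz n phi)).
have h3 := coevt_mor n_even X.
exact: (gmor_comp (gmor_comp h1 h2) h3).
Qed.

Let res_zD f h : @res_z k n m V (f + h) = res_z V f + res_z V h.
Proof. exact: (coef_extD (res_linear V_pot)). Qed.

Let res_zM q f : @res_z k n m V (inx m q * f) = q * res_z V f.
Proof.
by apply: (coef_extM (res_linear V_pot)) => i; rewrite [LHS]mmapX mmap1U ptE.
Qed.

Let res_z_grad j f : @res_z k n m V (inz n (grad V j) * f) = 0.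
Proof.
apply: (coef_ext_ideal (res_linear V_pot)); last exact: res_grad.
by move=> i; rewrite [LHS]mmapX mmap1U ptE.
Qed.

Let res_zS s f : @res_z k n m V ((-1) ^+ s * f) = (-1) ^+ s * res_z V f.
Proof. by rewrite -(rmorph_sign (@inx k n m)) res_zM. Qed.

Let tau := trform Phi (@res_z k n m V) (inz n phi).
Let P := trideal Phi (grad W) (@res_z k n m V) (inz n phi).

Let res_z_gen a f : in_ideal (grad W) (@res_z k n m V (mderiv a (inz n V - inx m W) * f)).
Proof.
move: a; apply: split_ind => i; last by rewrite mderivz_U res_z_grad; exact: in_ideal0.
rewrite mderivx_U -(rmorphN (@inx k n m)) res_zM mulrC.
by apply/in_idealM/in_idealN; exact: in_ideal_gen.
Qed.

Let tauD := trformD Phi (inz n phi) res_zD.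
Let tauN := trformN Phi (inz n phi) res_zD.
Let tauS := trformS Phi (inz n phi) res_zD.
Let PD := @tridealD _ _ _ _ _ _ _ Phi (grad W) _ (inz n phi) res_zD.
Let PN := @tridealN _ _ _ _ _ _ _ Phi (grad W) _ (inz n phi) res_zD.
Let P_anticomm := trideal_anticomm Phi_mor (grad W) (inz n phi) res_zD.
Let P_swap := trideal_swap (q := inz n phi) Phi_mor res_zD res_z_gen.

Let xw (w : seq 'I_n) : seq 'I_(n + m) := [seq lshift m i | i <- w].

Let P_xx i j M : P M ->
  P ((mderiv (lshift m i) (mderiv (lshift m j) (inz n V - inx m W))) *: M).
Proof.
move=> PM; rewrite /P /trideal trformZ.
have -> : mderiv (lshift m i) (mderiv (lshift m j) (inz n V - inx m W)) =
    inx m (- mderiv i (grad W j)).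
  rewrite mderivx_U raddfN /= [X in - X]mderiv_msubX; last exact: lshift_inj.
  by rewrite [RHS]rmorphN.
by rewrite res_zM; exact: in_idealM.
Qed.

Let Bx (s : seq 'I_n) : 'M[Q]_r := \prod_(b <- s) dx X b.

Let mw_xz w : mw (xw w ++ zs) = Bx w * Lz.
Proof. by rewrite mword_cat /mword /xw /zs !big_map; congr (_ * _). Qed.

(** In exterior degree zero [ev] contributes Lambda alone, and [coevt] contributes the reversed word
    of the complement of [S]. On the diagonal its divided differences become derivatives. *)
Lemma left_diag_row (S : {set 'I_n}) : ~~ odd #|S| ->
  msub (@diag k n) (gmx F set0 S) =
  (-1) ^+ shuffle S * tau (Bx (rev (enum (~: S))) * Lz).
Proof.
move=> even_S.
pose G : {mpoly k[n + m + n]} := \sum_(ij : 'I_r * 'I_r)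
  (\prod_(j < m) map_mx (msub (@lp k n m)) (dz X j)) ij.1 ij.2 *
  \sum_j' msub (@lp' k n m) (inz n phi * gmx Phi ij.2 j') *
    (@coevt_mx k n m W V X (ij.1, j') S).
have -> : gmx F set0 S = @res_l k n m V G.
  rewrite /gmx /F /= ffunE /G /res_l (coef_ext_sum (res_linear V_pot)).
  apply: eq_bigr => -[i j] _; congr (coef_ext _ _ (_ * _)).
    rewrite /ev_mx cards0 enum_set0 big_nil mulr1 bin0n mul0n !add0n.
    by rewrite -signr_odd (negbTE m_even) mul1r.
  rewrite ffunE (eq_bigr (fun x : 'I_r * 'I_r => (i == x.1)%:R *
    (msub (@lp' k n m) (gmx f0 j x.2) * @coevt k n m W V X [ffun T => (T == S)%:R] (x.1, x.2))));
    last by case=> i' j' _; rewrite mulrA.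
  rewrite -(pair_bigA _ (fun i' j' : 'I_r => (i == i')%:R *
    (msub (@lp' k n m) (gmx f0 j j') * @coevt k n m W V X [ffun T => (T == S)%:R] (i', j')))) /=.
  rewrite exchange_big; apply: eq_bigr => j' _ /=.
  rewrite (sum_deltal i (fun i' => _ * @coevt k n m W V X _ (i', j'))) /f0 gmx_scaled.
  congr (_ * _); rewrite ffunE -[RHS](sum_deltar S (fun T => @coevt_mx k n m W V X (i, j') T)).
  by apply: eq_bigr => T _; rewrite ffunE rmorph_nat.
(* The diagonal seen before the residue is taken: x' becomes x and z is kept. *)
pose Dg : 'I_(n + m + n) -> Q := pt (fun v => 'X_v) (fun i => 'X_(lshift m i)).
have DgP q : msub Dg (msub (@lp k n m) q) = q.
  rewrite msub_comp msub_id //; apply: split_ind => i; rewrite /lp ptE msubX /Dg ptE.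
    by [].
  by [].
have DgP' q : msub Dg (msub (@lp' k n m) q) = q.
  rewrite msub_comp msub_id //; apply: split_ind => i; rewrite /lp' ptE msubX /Dg ptE.
    by [].
  by [].
have -> : msub (@diag k n) (res_l V G) = @res_z k n m V (msub Dg G).
  apply: (coef_ext_natural (res_linear V_pot)).
  apply: split_ind => v; rewrite ptE; last first.
    rewrite /Dg ptE [LHS]mmapX mmap1U /diag !ptE [LHS]map_mpolyX.
    by rewrite [RHS]mmapX mmap1U ptE.
  rewrite /Dg [in RHS]ptE; move: v; apply: split_ind => i; rewrite ptE [RHS]mmapX mmap1U ptE.
    by rewrite [LHS]mmapX mmap1U /diag !ptE [LHS]map_mpolyX.
  exact: mmapC.
have DgL : map_mx (msub Dg) (\prod_(j < m) map_mx (msub (@lp k n m)) (dz X j)) = Lz.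
  rewrite map_mx_prod; apply: eq_bigr => j _.
  by apply/matrixP=> i i'; rewrite !mxE DgP.
have DgB : map_mx (msub Dg) (\prod_(b <- rev (enum (~: S))) dd_x X b) = Bx (rev (enum (~: S))).
  rewrite map_mx_prod; apply: eq_bigr => b _.
  apply/matrixP=> i i'; rewrite !mxE (msub_ddiff_diag _ (h := fun v => 'X_v)).
  - exact: msub_id.
  - by move=> w; have := DgP 'X_w; rewrite msubX.
  - by move=> w; have := DgP' 'X_w; rewrite msubX.
have -> : msub Dg G = (-1) ^+ shuffle S * (inz n phi *
    str par (Bx (rev (enum (~: S))) * Lz * PhiM)).
  rewrite -mulrA str_mul /G.
  rewrite (rmorph_sum (msub Dg)).
  transitivity (\sum_(i < r) \sum_(j < r) \sum_(j' < r)
      Lz i j * (inz n phi * PhiM j j' * ((-1) ^+ shuffle S *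
        ((-1) ^+ par j' * Bx (rev (enum (~: S))) j' i)))).
    rewrite pair_bigA; apply: eq_bigr => -[i j] _.
    rewrite (rmorphM (msub Dg)) (rmorph_sum (msub Dg)) mulr_sumr; apply: eq_bigr => j' _.
    rewrite -DgL -DgB !mxE (rmorphM (msub Dg)) DgP'; congr (_ * (_ * _)).
    rewrite /coevt_mx (rmorphM (msub Dg)) (rmorphXn (msub Dg)) rmorphN1 exprD -!mulrA.
    (* The complement of an even set is even, so the coefficient is odd and the sign of [coevt] is
       the one that turns the trace into a supertrace. *)
    have -> : (-1) ^+ (#|~: S|.+1 * par j') = (-1) ^+ par j' :> Q.
      by rewrite -signr_odd oddM /= (odd_setC _ n_even) even_S oddb.
    by rewrite mulrCA.
  transitivity (\sum_(i < r) \sum_(j' < r) (-1) ^+ shuffle S * (inz n phi *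
     ((-1) ^+ par j' * (Bx (rev (enum (~: S))) j' i * (Lz * PhiM) i j')))).
    apply: eq_bigr => i _; rewrite exchange_big; apply: eq_bigr => j' _ /=.
    rewrite [X in Bx _ _ _ * X]mxE !mulr_sumr; apply: eq_bigr => j _.
    move: (Lz i j) (PhiM j j') (Bx _ j' i) (inz n phi) ((-1) ^+ par j') ((-1) ^+ shuffle S).
    by move=> *; ring.
  rewrite exchange_big !mulr_sumr; apply: eq_bigr => j' _.
  by rewrite !mulr_sumr.
by rewrite (str_comm _ (entry_mx_par Phi_mor)) res_zS.
Qed.

(** [diag_row_ideal] at the complement of [C]. It settles the letters of [C] in decreasing order
    only; other orders come from [left_word_short]. *)
Lemma left_word_mem (C : {set 'I_n}) : ~~ odd #|C| -> C != setT ->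
  P (mw (xw (rev (enum C)) ++ zs)).
Proof.
move=> even_C C_T; rewrite mw_xz /P /trideal.
have := @left_diag_row (~: C); rewrite (odd_setC _ n_even) setCK => /(_ even_C) e.
have := diag_row_ideal W_pot left_mor (S := ~: C); rewrite e => h.
have {}h : in_ideal (grad W) ((-1) ^+ shuffle (~: C) * tau (Bx (rev (enum C)) * Lz)).
  by apply: h; apply: contra C_T => /eqP e'; rewrite -[C]setCK e' setC0.
have := in_idealM ((-1) ^+ shuffle (~: C)) h.
by rewrite mulrC mulrAC -expr2 sqrr_sign mul1r.
Qed.

Lemma left_word_swap i j u t : ~~ odd (size u + size t) ->
  P (mw (xw (u ++ t) ++ zs)) ->
  P (mw (xw u ++ lshift m i :: lshift m j :: xw t ++ zs) +
     mw (xw u ++ lshift m j :: lshift m i :: xw t ++ zs)).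
Proof.
move=> ev_ut h; apply: (P_swap).
  by rewrite size_cat size_zs !size_map addnA oddD (negbTE ev_ut).
by apply: P_xx; rewrite -mword_cat catA -map_cat.
Qed.

(** Strong induction on the length. Sorting into decreasing order reaches [left_word_mem], and each
    transposition costs a multiple of a word with two letters fewer. *)
Lemma left_word_short w : uniq w -> ~~ odd (size w) -> (size w < n)%N ->
  P (mw (xw w ++ zs)).
Proof.
have [l] := ubnP (size w); elim: l w => // l IHl w lt_w uniq_w even_w w_n.
pose C := [set i in w]; have wC : perm_eq w (rev (enum C)).
  rewrite uniq_perm ?rev_uniq ?enum_uniq // => i.
  by rewrite mem_rev mem_enum inE.
have cC : #|C| = size w by rewrite cardsE; apply/card_uniqP.
have := @mword_perm _ _ _ d D P PD PN P_anticomm [::]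
  (xw w) (xw (rev (enum C))) zs.
apply; first exact: perm_map.
  move=> a b u' t' e.
  have [i [j [u1 [t1 [-> -> -> -> {}e]]]]] := perm_map_split (@lshift_inj n m) e.
  have size_e := perm_size e; rewrite size_cat /= in size_e.
  have ev : ~~ odd (size u1 + size t1).
    by move: even_w; rewrite -size_e !addnS /= negbK.
  have lt : (size (u1 ++ t1) < size w)%N by rewrite -size_e size_cat !addnS.
  apply: left_word_swap => //; apply: IHl.
  - exact: leq_trans lt lt_w.
  - move: uniq_w; rewrite -(perm_uniq e) (uniq_catCA u1 [:: i; j] t1).
    by case/and3P.
  - by rewrite size_cat.
  - exact: ltn_trans lt w_n.
apply: left_word_mem; first by rewrite cC.
by apply: contraTneq w_n => e; rewrite -cC e cardsT card_ord ltnn.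
Qed.

Lemma left_value :
  in_ideal (grad W) (msub (@diag k n) (gmx F set0 set0) -
     (-1) ^+ 'C(n.+1, 2) * @res_z k n m V (inz n phi * defect_str Phi)).
Proof.
rewrite left_diag_row ?cards0 // setC0.
have -> : shuffle (set0 : {set 'I_n}) = 0%N.
  by apply: eq_card0 => -[i j]; rewrite !inE.
have -> : enum [set: 'I_n] = enum 'I_n by apply: eq_enum => i; rewrite !inE.
have -> : @res_z k n m V (inz n phi * defect_str Phi) = tau (Bx (enum 'I_n) * Lz).
  have -> : Bx (enum 'I_n) = \prod_(i < n) dx X i by rewrite /Bx enumT [index_enum _]unlock.
  by rewrite /tau /trform /Lz [entry_mx Phi * _]mulrA.
(* For even [n] the binomials of [n.+1] and of [n] over 2 have the same parity, and the second is
   the sign of reversing [n] letters. *)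
rewrite binS bin1 exprD -[(-1) ^+ n]signr_odd (negbTE n_even) mulr1 mul1r.
rewrite -tauS -tauN -tauD -!mw_xz.
have := @mword_rev _ _ _ d D P PD PN P_anticomm [::] (xw (enum 'I_n)) zs.
rewrite /= -map_rev size_map size_enum_ord; apply=> a b u' t' e.
have [i [j [u1 [t1 [-> -> -> -> {}e]]]]] := perm_map_split (@lshift_inj n m) e.
have ev : ~~ odd (size u1 + size t1).
  have := perm_size e; rewrite size_cat size_enum_ord /= !addnS => size_e.
  by have := congr1 odd size_e; rewrite /= negbK => ->.
apply: left_word_swap => //; apply: left_word_short.
- have := enum_uniq 'I_n; rewrite -(perm_uniq e) (uniq_catCA u1 [:: i; j] t1).
  by case/and3P.
- by rewrite size_cat.
- have lt : (size (u1 ++ t1) < size (u1 ++ i :: j :: t1))%N by rewrite !size_cat /= !addnS.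
  by rewrite (leq_trans lt) // (perm_size e) size_enum_ord.
Qed.

Lemma left_trace : homotopic F (@Delta_mul k n W ((-1) ^+ 'C(n.+1, 2) *
   @res_z k n m V (inz n phi * defect_str Phi))).
Proof. exact: (Delta_homotopic_mul W_pot left_mor left_value). Qed.

End LeftTrace.

Section RightTrace.
Variable psi : {mpoly k[n]}.
Let g0 := scaled Phi (inx m psi).
Let F : gel (Delta V) -> gel (Delta V) :=
  @evt k n m W V X \o XXdual_map g0 \o @coev k n m W V X.

Lemma right_mor : gmor F.
Proof.
have h1 := evt_mor n_even X W_pot.
have h2 := XXdual_map_mor (scaled_mor Phi_mor (inx m psi)).
have h3 := coev_mor m_even X.
exact: (gmor_comp (gmor_comp h1 h2) h3).
Qed.

Let res_xD f h : @res_x k n m W (f + h) = res_x W f + res_x W h.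
Proof. exact: (coef_extD (res_linear W_pot)). Qed.

Let res_xM q f : @res_x k n m W (inz n q * f) = q * res_x W f.
Proof.
by apply: (coef_extM (res_linear W_pot)) => i; rewrite [LHS]mmapX mmap1U ptE.
Qed.

Let res_x_grad j f : @res_x k n m W (inx m (grad W j) * f) = 0.
Proof.
apply: (coef_ext_ideal (res_linear W_pot)); last exact: res_grad.
by move=> i; rewrite [LHS]mmapX mmap1U ptE.
Qed.

Let res_xS s f : @res_x k n m W ((-1) ^+ s * f) = (-1) ^+ s * res_x W f.
Proof. by rewrite -(rmorph_sign (@inz k n m)) res_xM. Qed.

Let tau := trform Phi (@res_x k n m W) (inx m psi).
Let P := trideal Phi (grad V) (@res_x k n m W) (inx m psi).

Let res_x_gen a f : in_ideal (grad V) (@res_x k n m W (mderiv a (inz n V - inx m W) * f)).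
Proof.
move: a; apply: split_ind => i.
  rewrite mderivx_U -(rmorphN (@inx k n m)) -mulrN1 (rmorphM (@inx k n m)) -mulrA.
  by rewrite res_x_grad; exact: in_ideal0.
by rewrite mderivz_U res_xM mulrC; apply: in_idealM; exact: in_ideal_gen.
Qed.

Let tauD := trformD Phi (inx m psi) res_xD.
Let tauN := trformN Phi (inx m psi) res_xD.
Let PD := @tridealD _ _ _ _ _ _ _ Phi (grad V) _ (inx m psi) res_xD.
Let PN := @tridealN _ _ _ _ _ _ _ Phi (grad V) _ (inx m psi) res_xD.
Let P_anticomm := trideal_anticomm Phi_mor (grad V) (inx m psi) res_xD.
Let P_swap := trideal_swap (q := inx m psi) Phi_mor res_xD res_x_gen.

Let xs : seq 'I_(n + m) := [seq lshift m i | i <- enum 'I_n].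
Let size_xs : size xs = n. Proof. by rewrite size_map size_enum_ord. Qed.

Let Lx : 'M[Q]_r := \prod_(i < n) dx X i.

Let mw_zs : mw zs = Lz.
Proof. by rewrite /mword /zs /Lz big_map enumT [index_enum _]unlock. Qed.

Let mw_xs : mw xs = Lx.
Proof. by rewrite /mword /xs /Lx big_map enumT [index_enum _]unlock. Qed.

(** The sign is that of [coev] at word length [m]. [coev] already lists the z-derivatives in
    increasing order, so nothing has to be reversed. *)
Lemma right_diag_value :
  msub (@diag k m) (gmx F set0 set0) = (-1) ^+ 'C(m.+1, 2) * tau (Lz * Lx).
Proof.
pose G : {mpoly k[m + n + m]} := \sum_(ji : 'I_r * 'I_r)
  (-1) ^+ par ji.1 * (\prod_(i < n) map_mx (msub (@rp k n m)) (- dx X i)) ji.2 ji.1 *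
  \sum_(j' < r) msub (@rp k n m) (inx m psi * gmx Phi ji.1 j') *
    (@coev_mx k n m W V X (j', ji.2) set0).
have -> : gmx F set0 set0 = @res_r k n m W G.
  rewrite /gmx /F /= ffunE /G /res_r (coef_ext_sum (res_linear W_pot)).
  apply: eq_bigr => -[j i] _; congr (coef_ext _ _ (_ * _)).
    rewrite /evt_mx cards0 enum_set0 big_nil mul1r add0n; congr (_ * _).
    by rewrite -signr_odd oddM /= n_even oddb.
  rewrite ffunE (eq_bigr (fun x : 'I_r * 'I_r => (i == x.2)%:R *
    (msub (@rp k n m) (gmx g0 j x.1) * @coev k n m W V X [ffun T => (T == set0)%:R] (x.1, x.2))));
    last by case=> i' j' _; rewrite mulrCA mulrA.
  rewrite -(pair_bigA _ (fun j' i' : 'I_r => (i == i')%:R *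
    (msub (@rp k n m) (gmx g0 j j') * @coev k n m W V X [ffun T => (T == set0)%:R] (j', i')))) /=.
  apply: eq_bigr => j' _ /=.
  rewrite (sum_deltal i (fun i' => _ * @coev k n m W V X _ (j', i'))) /g0 gmx_scaled.
  congr (_ * _); rewrite ffunE -[RHS](sum_deltar set0 (fun T => @coev_mx k n m W V X (j', i) T)).
  by apply: eq_bigr => T _; rewrite ffunE rmorph_nat.
pose Dg : 'I_(m + n + m) -> Q :=
  pt (pt (fun j => 'X_(rshift n j)) (fun i => 'X_(lshift m i))) (fun j => 'X_(rshift n j)).
have DgP q : msub Dg (msub (@rp k n m) q) = q.
  rewrite msub_comp msub_id //; apply: split_ind => i;
    by rewrite /rp ptE msubX /Dg !ptE.
have DgP' q : msub Dg (msub (@rp' k n m) q) = q.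
  rewrite msub_comp msub_id //; apply: split_ind => i;
    by rewrite /rp' ptE msubX /Dg !ptE.
have -> : msub (@diag k m) (res_r W G) = @res_x k n m W (msub Dg G).
  apply: (coef_ext_natural (res_linear W_pot)).
  apply: split_ind => v; rewrite ptE; last first.
    rewrite /Dg ptE [LHS]mmapX mmap1U /diag !ptE [LHS]map_mpolyX.
    by rewrite [RHS]mmapX mmap1U ptE.
  rewrite /Dg [in RHS]ptE; move: v; apply: split_ind => i; rewrite !ptE [RHS]mmapX mmap1U ptE.
    by rewrite [LHS]mmapX mmap1U /diag !ptE [LHS]map_mpolyX.
  exact: mmapC.
have DgL : map_mx (msub Dg) (\prod_(i < n) map_mx (msub (@rp k n m)) (- dx X i)) = Lx.
  rewrite map_mx_prod (eq_bigr (fun i => - dx X i)).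
    (* The minus signs of the factors of Lambda cancel, there being an even number of them. *)
    rewrite prodrN card_ord -signr_odd (negbTE n_even) mul1r; reflexivity.
  by move=> i _; apply/matrixP=> a b; rewrite !mxE DgP.
have DgB : map_mx (msub Dg) (\prod_(b <- enum (~: set0)) dd_z X b) = Lz.
  have -> : enum (~: (set0 : {set 'I_m})) = index_enum 'I_m.
    by rewrite [index_enum _]unlock -enumT; apply: eq_enum => i; rewrite !inE.
  rewrite map_mx_prod.
  apply: eq_bigr => b _.
  apply/matrixP=> i i'; rewrite !mxE (msub_ddiff_diag _ (h := fun v => 'X_v)).
  - exact: msub_id.
  - by move=> w; have := DgP 'X_w; rewrite msubX.
  - by move=> w; have := DgP' 'X_w; rewrite msubX.
rewrite -res_xS /tau /trform -/PhiM; congr (res_x W _).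
rewrite mulrA str_mul /G (rmorph_sum (msub Dg)).
rewrite pair_bigA !mulr_sumr; apply: eq_bigr => -[j i] _; rewrite ![(_, _).1]/= ![(_, _).2]/=.
transitivity ((-1) ^+ par j * Lx i j * \sum_(j' < r) inx m psi * PhiM j j' *
    ((-1) ^+ 'C(m.+1, 2) * Lz j' i)).
  rewrite !(rmorphM (msub Dg)) (rmorph_sign (msub Dg)) (rmorph_sum (msub Dg)).
  rewrite [LHS]mulr_sumr [RHS]mulr_sumr; apply: eq_bigr => j' _.
  rewrite -DgL -DgB !mxE (rmorphM (msub Dg)) DgP; congr (_ * (_ * _)).
  rewrite /coev_mx (rmorphM (msub Dg)) (rmorph_sign (msub Dg)); congr (_ * _).
  have -> : #|~: (set0 : {set 'I_m})| = m by rewrite setC0 cardsT card_ord.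
  have -> : shuffle (set0 : {set 'I_m}) = 0%N.
    by apply: eq_card0 => -[i' j'']; rewrite !inE.
  rewrite addn0 -addnA exprD -[(-1) ^+ (m + _)]signr_odd oddD oddM.
  by rewrite (negbTE m_even) mulr1.
rewrite [(PhiM * Lz) j i]mxE.
move: (inx m psi) (Lx i j) ((-1) ^+ par j) ((-1) ^+ 'C(m.+1, 2)) => q l s1 s2.
rewrite mulr_suml !mulr_sumr; apply: eq_bigr => j' _.
by move: (Lz j' i) (PhiM j j') => *; ring.
Qed.

Lemma right_value :
  in_ideal (grad V) (msub (@diag k m) (gmx F set0 set0) -
     (-1) ^+ 'C(m.+1, 2) * @res_x k n m W (inx m psi * defect_str Phi)).
Proof.
have -> : @res_x k n m W (inx m psi * defect_str Phi) = tau (Lx * Lz).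
  by rewrite /tau /trform /Lx [entry_mx Phi * _]mulrA.
rewrite right_diag_value -mulrBr; apply: in_idealM.
rewrite -tauN -tauD -mw_xs -mw_zs -!mword_cat.
have := @mword_block _ _ _ d D P PD PN P_anticomm [::] zs xs [::].
(* Exchanging the blocks costs the sign of [m * n] transpositions, which is +1. *)
rewrite !cats0 size_zs size_xs -signr_odd oddM (negbTE m_even) mul1r.
apply=> a b u t /mapP[j _ ->] /mapP[i _ ->]; rewrite !size_cat size_zs size_xs add0n => size_ut.
apply: (P_swap).
  have := congr1 odd size_ut; rewrite /= negbK [RHS]oddD (negbTE m_even) (negbTE n_even).
  by move=> ->.
have -> : mderiv (rshift n j) (mderiv (lshift m i) (inz n V - inx m W)) = 0.
  by rewrite mderivx_U raddfN /= [X in - X]mderiv_msubX0 ?oppr0 // => i'; rewrite eq_rlshift.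
rewrite scale0r; exact: (P_zero P_anticomm).
Qed.

Lemma right_trace : homotopic F (@Delta_mul k m V ((-1) ^+ 'C(m.+1, 2) *
   @res_x k n m W (inx m psi * defect_str Phi))).
Proof. exact: (Delta_homotopic_mul V_pot right_mor right_value). Qed.

End RightTrace.
End DefectTraces.

(** The inverse unitor is determined only up to homotopy. The equivalences say that the class of the
    defect operator exists, that it is the same for every choice of inverse, and that it is the
    stated residue. *)
Theorem proposition8p2 (k : comNzRingType) (n m : nat)
    (n_even : ~~ odd n) (m_even : ~~ odd m)
    (W : {mpoly k[n]}) (V : {mpoly k[m]})
    (W_pot : potential W) (V_pot : potential V)
    (X : mfact (inz n V - inx m W))
    (Phi : gel (mfobj X) -> gel (mfobj X)) (Phi_mor : gmor Phi)
    (phi : {mpoly k[m]}) (phi_map : gel (Delta V) -> gel (Delta V))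
    (phi_mor : gmor phi_map) (phi_rep : homotopic phi_map (Delta_mul phi))
    (psi : {mpoly k[n]}) (psi_map : gel (Delta W) -> gel (Delta W))
    (psi_mor : gmor psi_map) (psi_rep : homotopic psi_map (Delta_mul psi)) :
  (forall D : gel (Delta W) -> gel (Delta W),
     defect_l Phi phi_map D <->
     homotopic D
       (Delta_mul ((-1) ^+ 'C(n.+1, 2) *
                   res_z V (inz n phi * defect_str Phi)))) /\
  (forall D : gel (Delta V) -> gel (Delta V),
     defect_r Phi psi_map D <->
     homotopic D
       (Delta_mul ((-1) ^+ 'C(m.+1, 2) *
                   res_x W (inx m psi * defect_str Phi)))).
Proof.
have trl := left_trace n_even m_even W_pot V_pot Phi_mor phi.
have trr := right_trace n_even m_even W_pot V_pot Phi_mor psi.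
(* For an arbitrary homotopy inverse the composite is reduced to the scaled endomorphism of [X]
   before the trace computation is applied. *)
have lE linv : hinverse (@lunitor k n m W V X) linv -> homotopic
    (@ev k n m W V X \o XdualX_map (@lunitor k n m W V X \o DeltaX_tens phi_map Phi \o linv)
      \o @coevt k n m W V X)
    (Delta_mul ((-1) ^+ 'C(n.+1, 2) * res_z V (inz n phi * defect_str Phi))).
  move=> linvP; apply: homotopic_trans trl.
  apply: (homotopic_compr (coevt_mor n_even X)); apply: (homotopic_compl (ev_mor m_even X V_pot)).
  by apply: XdualX_map_homotopic; exact: (left_map_homotopic Phi_mor phi_rep linvP).
have rE rinv : hinverse (@runitor k n m W V X) rinv -> homotopic
    (@evt k n m W V X \o XXdual_map (@runitor k n m W V X \o XDelta_tens Phi psi_map \o rinv)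
      \o @coev k n m W V X)
    (Delta_mul ((-1) ^+ 'C(m.+1, 2) * res_x W (inx m psi * defect_str Phi))).
  move=> rinvP; apply: homotopic_trans trr.
  apply: (homotopic_compr (coev_mor m_even X)); apply: (homotopic_compl (evt_mor n_even X W_pot)).
  by apply: XXdual_map_homotopic; exact: (right_map_homotopic Phi_mor psi_rep rinvP).
split=> D; split.
- by case=> linv [linvP DE]; exact: (homotopic_trans DE (lE linv linvP)).
(* In this direction an inverse has to be exhibited, and any one will do by [lE]. *)
- move=> DE; have [linv linvP] := lunitor_inverse X; exists linv; split=> //.
  exact: (homotopic_trans DE (homotopic_sym (lE linv linvP))).
- by case=> rinv [rinvP DE]; exact: (homotopic_trans DE (rE rinv rinvP)).
- move=> DE; have [rinv rinvP] := runitor_inverse X; exists rinv; split=> //.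
  exact: (homotopic_trans DE (homotopic_sym (rE rinv rinvP))).
Qed.
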